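(* Let $\mathbf{k}$ be a field of characteristic zero. Let $\mathscr{C}$ be a $2$-dimensional $\mathbf{k}$-linear Calabi-Yau category generated by a finite collection $\mathcal{E}=\{E_i\}_{i\in I}$ of generators satisfying \begin{itemize} \item $\mathrm{Ext}^0(E_i,E_i)=\mathbf{k}\cdot \mathrm{id}_{E_i}$ for all $i\in I$, \item $\mathrm{Ext}^0(E_i,E_j)=0$ for all $i\neq j$ in $I$, \item $\mathrm{Ext}^{<0}(E_i,E_j)=0$ for all $i,j\in I$. \end{itemize} The equivalence classes of such categories with respect to $A_\infty$-transformations preserving the Calabi-Yau structure and $\mathcal{E}$ are in one-to-one correspondence with finite symmetric quivers with an even number of loops at each vertex.
   Context: A $2$-dimensional $\mathbf{k}$-linear Calabi-Yau category is a $\mathbf{k}$-linear triangulated (weakly unital) $A_\infty$-category $\mathscr{C}$ such that each total space $\mathrm{Ext}^\bullet(E,F)=H^\bullet(\mathrm{Hom}^\bullet(E,F))$ is finite-dimensional, endowed with a Calabi-Yau structure of dimension $2$. The latter consists of pairings $(\cdot,\cdot):\mathrm{Hom}^\bullet(E,F)\otimes \mathrm{Hom}^\bullet(F,E)\to\mathbf{k}[-2]$ that are symmetric in the graded (super) sense, are non-degenerate on cohomology (so that $\mathrm{Ext}^m(E,F)\cong \mathrm{Ext}^{2-m}(F,E)^\vee$), and are such that the multilinear forms $(m_n(a_1,\dots,a_n),a_{n+1})$ obtained from the higher compositions $m_n$ are cyclically invariant in the graded sense (with the usual Koszul signs after shifting degrees by one). The notation $\mathrm{Ext}^{<0}(E_i,E_j)=0$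 means $\mathrm{Ext}^m(E_i,E_j)=0$ for all $m<0$. The collection $\mathcal{E}$ generates $\mathscr{C}$ if $\mathscr{C}$ is the smallest triangulated subcategory of itself, closed under isomorphism, containing all $E_i$. In this case $\mathscr{C}$ together with $\mathcal{E}$ is determined by the full $A_\infty$-subcategory on the objects $E_i$ with its pairings, or equivalently by a minimal model of it: a minimal $A_\infty$-structure ($m_1=0$) on the graded spaces $\mathrm{Ext}^\bullet(E_i,E_j)$, $i,j\in I$, that is cyclic with respect to the induced non-degenerate pairings of degree $-2$. An equivalence of $(\mathscr{C},\mathcal{E})$ and $(\mathscr{C}',\mathcal{E}')$ by an $A_\infty$-transformation preserving the Calabi-Yau structure and the collection is an $A_\infty$-equivalence $\mathscr{C}\to\mathscr{C}'$ that carries $\mathcal{E}$ to $\mathcal{E}'$ (via a bijection of the index sets) and is compatible with the pairings. In terms of minimal models it is an $A_\infty$-isomorphism $F=(F_n)_{n\ge1}$ that is cyclic: $(F_1(a),F_1(b))=(a,b)$, and for each $n\ge3$ the sum over $k+l=n$, $k,l\ge1$, of $(F_k(a_1,\dots,a_k),F_l(a_{k+1},\dots,a_n))$, with Koszul signs, vanishes. A quiver is finite if it has finitely many vertices and arrows. It is symmetric if for all vertices $i,j$ the number of arrows from $i$ to $j$ equals the number of arrows from $j$ to $i$. A loop at $i$ is an arrow from $i$ to $i$. As usual, quivers are considered up to isomorphism. *)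

(* Defs.v *)
From HB Require Import structures.
From mathcomp Require Import all_boot all_order all_algebra.

Set Implicit Arguments.
Unset Strict Implicit.
Unset Printing Implicit Defensive.

Import Order.TTheory GRing.Theory Num.Theory.
Local Open Scope ring_scope.

(* A pair (C, E), with C a triangulated Calabi-Yau category generated by the
   finite collection E, is represented by its minimal model: a minimal weakly
   unital A_infinity-structure on the spaces Ext^d(E_i, E_j), cyclic for
   nondegenerate pairings of degree -2.  An equivalence preserving E and the
   Calabi-Yau structure is a cyclic A_infinity-isomorphism of minimal models.

   Signs follow the bar convention: an element of Ext^d has shifted degree
   d - 1, and  op [a_1; ..; a_n]  is the suspended higher composition
   (-1)^(sum_k (n - k) |a_k|) m_n(a_1, .., a_n),  of shifted degree +1.
   Composition is written in diagrammatic order. *)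

Section Chains.

Variables (K : fieldType) (I : Type) (H : I -> I -> int -> vectType K).

(* Composable sequences of homogeneous elements. *)
Inductive chain : I -> I -> Type :=
| nilc i : chain i i
| consc i j k d (a : H i j d) (c : chain j k) : chain i k.

Definition onec i j d (a : H i j d) : chain i j := consc a (nilc j).

Fixpoint catc i j k (c : chain i j) : chain j k -> chain i k :=
  match c in chain i j return chain j k -> chain i k with
  | nilc _ => fun c' => c'
  | consc _ _ _ _ a c => fun c' => consc a (catc c c')
  end.

Fixpoint sizec i j (c : chain i j) : nat :=
  if c is consc _ _ _ _ _ c' then (sizec c').+1 else 0%N.

Fixpoint sdeg i j (c : chain i j) : int :=
  if c is consc _ _ _ d _ c' then (d - 1) + sdeg c' else 0.

(* All (p, q) with c = p ++ q, empty p and empty q included. *)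
Definition cut i k : Type := {j : I & (chain i j * chain j k)%type}.

Definition Cut i j k (p : chain i j) (q : chain j k) : cut i k :=
  existT (fun j => (chain i j * chain j k)%type) j (p, q).

Fixpoint cuts i k (c : chain i k) : seq (cut i k) :=
  match c in chain i k return seq (cut i k) with
  | nilc i => [:: Cut (nilc i) (nilc i)]
  | consc i _ k _ a c' =>
      Cut (nilc i) (consc a c')
        :: [seq Cut (consc a (projT2 s).1) (projT2 s).2 | s <- cuts c']
  end.

Definition multilinear (V : lmodType K) i l (f : chain i l -> V) : Prop :=
  forall j k d (p : chain i j) (r : chain k l) (x : K) (a b : H j k d),
    f (catc p (consc (x *: a + b) r))
    = x *: f (catc p (consc a r)) + f (catc p (consc b r)).

End Chains.

Arguments nilc {K I H} i.
Arguments onec {K I H i j d} a.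

Section CalabiYau.

Variable K : fieldType.

Section Operations.

Variables (I : Type) (H : I -> I -> int -> vectType K).

(* m d c is the degree d component of the value of an operation on c. *)
Definition operation : Type := forall i j d, chain H i j -> H i j d.

(* Sum over c = p ++ q ++ r of
   (-1)^(shifted degree of p) f(p, m(q), r),  with m of shifted degree +1. *)
Definition insertion (V : lmodType K) (m : operation) i l
    (f : chain H i l -> V) (c : chain H i l) : V :=
  \sum_(s <- cuts c) \sum_(t <- cuts (projT2 s).2)
    let p := (projT2 s).1 in let q := (projT2 t).1 in let r := (projT2 t).2 in
    (-1) ^ sdeg p *: f (catc p (consc (m _ _ (sdeg q + 2) q) r)).

Definition pairing_family : Type :=
  forall i j d e, H i j d -> H j i e -> K.

(* The pairing transported to shifted degrees: graded antisymmetric there when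
   the pairing is graded symmetric. *)
Definition suspended (b : pairing_family) i j d e
    (x : H i j d) (y : H j i e) : K := (-1) ^ d * b _ _ _ _ x y.

End Operations.

Record minCY2 : Type := MinCY2 {
  obj : finType;
  Ext : obj -> obj -> int -> vectType K;
  Ext_finite : exists N : nat, forall i j (d : int),
    (N < absz d)%N -> forall x : Ext i j d, x = 0;

  op : operation Ext;
  op_linear : forall i j d, multilinear (@op i j d);
  op_degree : forall i j d (c : chain Ext i j), d != sdeg c + 2 -> op d c = 0;
  op_uncurved : forall i d, op d (nilc i) = 0;
  op_minimal : forall i j d e (a : Ext i j d), op e (onec a) = 0;
  op_ainf : forall i j d (c : chain Ext i j), insertion op (@op i j d) c = 0;

  idm : forall i, Ext i i 0;
  idm_l : forall i j d (a : Ext i j d), op d (consc (idm i) (onec a)) = a;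
  idm_r : forall i j d (a : Ext i j d),
    op d (consc a (onec (idm j))) = (-1) ^ d *: a;

  pairing : pairing_family Ext;
  pairing_linear : forall i j d e (x : K) (a a' : Ext i j d) (b : Ext j i e),
    pairing (x *: a + a') b = x * pairing a b + pairing a' b;
  pairing_degree : forall i j d e (a : Ext i j d) (b : Ext j i e),
    d + e != 2 -> pairing a b = 0;
  pairing_sym : forall i j d e (a : Ext i j d) (b : Ext j i e),
    pairing a b = (-1) ^ (d * e) * pairing b a;
  pairing_nondegenerate : forall i j d (a : Ext i j d),
    (forall b : Ext j i (2 - d), pairing a b = 0) -> a = 0;
  pairing_cyclic : forall i j k d e
      (a : Ext i j d) (c : chain Ext j k) (b : Ext k i e),
    let ac := consc a c in let cb := catc c (onec b) in
    suspended pairing (op (sdeg ac + 2) ac) b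
    = (-1) ^ ((d - 1) * sdeg cb)
      * suspended pairing (op (sdeg cb + 2) cb) a
}.

Record simple_collection (C : minCY2) : Prop := SimpleCollection {
  Ext0_diag : forall i : obj C, basis_of {:Ext i i 0} [:: idm i];
  Ext0_offdiag : forall i j : obj C, i != j -> forall x : Ext i j 0, x = 0;
  Ext_neg : forall (i j : obj C) (d : int),
    d < 0 -> forall x : Ext i j d, x = 0
}.

Section Morphisms.

Variables (C C' : minCY2) (s : obj C -> obj C').

Let H := @Ext C.
Let H' := @Ext C'.

Definition component : Type :=
  forall i j d, chain H i j -> H' (s i) (s j) d.

(* The chains [F(c_1); ..; F(c_k)], where c_1 ++ .. ++ c_k = p ++ c is a
   decomposition into consecutive blocks whose first block extends p.  All
   blocks are nonempty if p is. *)
Fixpoint blocks_from (F : component) h i j (p : chain H h i) (c : chain H i j) :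
    seq (chain H' (s h) (s j)) :=
  match c in chain _ i j return chain H h i -> seq (chain H' (s h) (s j)) with
  | nilc _ => fun p => [:: onec (F _ _ (sdeg p + 1) p)]
  | consc _ _ _ _ a c' => fun p =>
      blocks_from F (catc p (onec a)) c'
      ++ [seq consc (F _ _ (sdeg p + 1) p) b | b <- blocks_from F (onec a) c']
  end p.

Definition blocks (F : component) i j (c : chain H i j) :
    seq (chain H' (s i) (s j)) :=
  match c in chain _ i j return seq (chain H' (s i) (s j)) with
  | nilc i => [:: nilc (s i)]
  | consc _ _ _ _ a c' => blocks_from F (onec a) c'
  end.

(* F has shifted degree 0, which is why no sign occurs in front of the
   blocks. *)
Record cyclic_ainf_iso (F : component) : Prop := CyclicAinfIso {
  cai_linear : forall i j d, multilinear (@F i j d);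
  cai_degree : forall i j d (c : chain H i j), d != sdeg c + 1 -> F i j d c = 0;
  cai_uncurved : forall i d, F i i d (nilc i) = 0;
  cai_ainf : forall i j d (c : chain H i j),
    insertion (@op C) (@F i j d) c = \sum_(b <- blocks F c) op d b;
  cai_iso : forall i j d, bijective (fun a : H i j d => F i j d (onec a));
  cai_pairing : forall i j d e (a : H i j d) (b : H j i e),
    pairing (F i j d (onec a)) (F j i e (onec b)) = pairing a b;
  cai_cyclic : forall i (c : chain H i i), (3 <= sizec c)%N ->
    \sum_(t <- cuts c)
      suspended (@pairing C')
        (F _ _ (sdeg (projT2 t).1 + 1) (projT2 t).1)
        (F _ _ (sdeg (projT2 t).2 + 1) (projT2 t).2) = 0
}.

End Morphisms.

Definition CY_equivalent (C C' : minCY2) : Prop :=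
  exists s : obj C -> obj C',
    bijective s /\ exists F : component s, cyclic_ainf_iso F.

End CalabiYau.

Record quiver : Type := Quiver {
  vertex : finType;
  arrow : finType;
  source : arrow -> vertex;
  target : arrow -> vertex
}.

Definition arrows (Q : quiver) (i j : vertex Q) : {set arrow Q} :=
  [set a | (source a == i) && (target a == j)].

Definition symmetric_quiver (Q : quiver) : Prop :=
  forall i j : vertex Q, #|arrows i j| = #|arrows j i|.

Definition even_loops (Q : quiver) : Prop :=
  forall i : vertex Q, ~~ odd #|arrows i i|.

Definition quiver_iso (Q Q' : quiver) : Prop :=
  exists (f : vertex Q -> vertex Q') (g : arrow Q -> arrow Q'),
    [/\ bijective f, bijective g,
        forall a, source (g a) = f (source a) &
        forall a, target (g a) = f (target a)].

(* dim Ext^1(E_i, E_j) arrows from i to j. *)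
Definition ext_quiver (K : fieldType) (C : minCY2 K) : quiver :=
  @Quiver (obj C)
    {p : obj C * obj C & 'I_(\dim {:Ext p.1 p.2 1})}
    (fun a => (tag a).1) (fun a => (tag a).2).

(* f induces a one-to-one correspondence between the eqA-classes of the
   objects satisfying PA and the eqB-classes of those satisfying PB. *)
Definition bijection_on_classes (A B : Type)
    (PA : A -> Prop) (eqA : A -> A -> Prop)
    (PB : B -> Prop) (eqB : B -> B -> Prop) (f : A -> B) : Prop :=
  [/\ forall x, PA x -> PB (f x),
      forall x y, PA x -> PA y -> (eqA x y <-> eqB (f x) (f y)) &
      forall b, PB b -> exists2 x, PA x & eqB (f x) b].

(* Main.v *)
Require Import Defs.
From HB Require Import structures.
From mathcomp Require Import all_boot all_order all_algebra.
From mathcomp Require Import boolp ring lra zify.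

Set Implicit Arguments.
Unset Strict Implicit.
Unset Printing Implicit Defensive.

Import Order.TTheory GRing.Theory Num.Theory.
Local Open Scope ring_scope.

(** A simple collection is determined by its quiver because its
    A_infinity-structure can be brought to a standard form, which only depends
    on the dimensions of the spaces Ext^1, by cyclic changes of variables.

    Dualize.  Choose bases of the Ext spaces adapted to the pairing: the
    identities, their duals in degree 2, and in degree 1 vectors that are paired
    off like a symplectic basis.  Index them by letters z_i, w_i and v_a.  The
    operations of a category become an odd derivation D of the algebra of
    noncommutative power series in these letters; the A_infinity-relations
    become D D = 0, and cyclicity becomes D omega = 0, where omega is the sum
    over the letters x of the signed products x x*, x* being the letter dual to
    x ([ev_insertion], [ev_der_omega]).  A morphism whose linear part matches
    the bases becomes a substitution phi with phi(x) = x + higher terms; it is a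
    cyclic A_infinity-isomorphism as soon as D phi = phi D' and
    phi(omega) = omega ([ev_blocks], [framed_equivalence]).

    The quadratic part of D is the same for all simple collections with given
    dimensions of the spaces Ext^1: the identities force z_i -> z_i z_i and
    v -> z v - v z, and cyclicity then forces w_i -> omega_i, the part of omega
    that starts at i ([bar_der_c2]).  Call it c2.  Since c2 does not depend on
    the category, it remains to conjugate D to D' by a symplectic substitution
    ([conjugation]).  The defect D phi - phi D' is pushed to higher and higher
    word length; its leading term e is closed under the bracket with c2 and
    preserves omega, and [key_lemma] says that such an e is the bracket of c2
    with an even derivation that preserves omega.  Correcting phi by this
    derivation disturbs phi(omega) in the next length only, where it is repaired
    by a formal Darboux lemma ([darboux]).

    The vanishing behind [key_lemma] is a count of degrees.  Encode e by a
    rotation-invariant function on closed words.  Its total degree is -1, and z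
    is the only kind of letter of negative degree, so every word that matters
    contains a z.  Doubling a letter z is a homotopy between 0 and the operator
    multiplying a word by minus its number of runs of z's ([contraction]); this
    number is positive, and invertible in characteristic zero.

    Linear algebra turns the pairing on degree 1 into the statement that
    Ext^1(E_i, E_j) and Ext^1(E_j, E_i) are dual and that Ext^1(E_i, E_i) is
    symplectic, hence of even dimension ([ext1_dim_sym], [ext1_dim_even]).
    Conversely c2 squares to zero and preserves omega for any symmetric quiver
    with evenly many loops at each vertex, so it defines a category with this
    quiver ([standard_category]). *)

(** * Noncommutative power series *)

(** The value at a word is the coefficient of that word. *)
Definition series (K : fieldType) (X : finType) : Type := seq X -> K.

Section SeriesRing.
Variables (K : fieldType) (X : finType).
Local Notation P := (series K X).
Implicit Types (f g h : P) (u p q : seq X).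

HB.instance Definition _ := gen_eqMixin P.
HB.instance Definition _ := gen_choiceMixin P.

(** The coefficients of the words that start with x: f is its constant term
    plus the sum of the products x * lquo x f ([seriesE]). *)
Definition lquo (x : X) f : P := fun u => f (x :: u).

(** The Cauchy product, summing f p * g q over all factorizations p q of the
    word ([mulsE]); the recursion peels off the first letter. *)
Fixpoint conv f g u : K :=
  if u is x :: u' then f [::] * g u + conv (lquo x f) g u'
  else f [::] * g [::].

Lemma seriesP f g : f =1 g -> f = g. Proof. by move=> /funext. Qed.

Definition add_series f g : P := fun u => f u + g u.
Definition opp_series f : P := fun u => - f u.
Definition scale_series (k : K) f : P := fun u => k * f u.
Definition mul_series f g : P := fun u => conv f g u.
Definition one_series : P := fun u => (u == [::])%:R.

Fact add_seriesA : associative add_series.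
Proof. by move=> f g h; apply: seriesP => u; apply: addrA. Qed.
Fact add_seriesC : commutative add_series.
Proof. by move=> f g; apply: seriesP => u; apply: addrC. Qed.
Fact add0_series : left_id (fun _ => 0 : K) add_series.
Proof. by move=> f; apply: seriesP => u; apply: add0r. Qed.
Fact addN_series : left_inverse (fun _ => 0 : K) opp_series add_series.
Proof. by move=> f; apply: seriesP => u; apply: addNr. Qed.
HB.instance Definition _ := GRing.isZmodule.Build P
  add_seriesA add_seriesC add0_series addN_series.

Fact scale_seriesA a b f : scale_series a (scale_series b f) = scale_series (a * b) f.
Proof. by apply: seriesP => u; apply: mulrA. Qed.
Fact scale_series1 : left_id 1 scale_series.
Proof. by move=> f; apply: seriesP => u; apply: mul1r. Qed.
Fact scale_seriesDr : right_distributive scale_series +%R.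
Proof. by move=> a f g; apply: seriesP => u; apply: mulrDr. Qed.
Fact scale_seriesDl f : {morph scale_series^~ f : a b / a + b}.
Proof. by move=> a b; apply: seriesP => u; apply: mulrDl. Qed.
HB.instance Definition _ := GRing.Zmodule_isLmodule.Build K P
  scale_seriesA scale_series1 scale_seriesDr scale_seriesDl.

Lemma lquoD x f g : lquo x (f + g) = lquo x f + lquo x g. Proof. by []. Qed.
Lemma lquoZ x k f : lquo x (k *: f) = k *: lquo x f. Proof. by []. Qed.

Lemma convDl f f' g u : conv (f + f') g u = conv f g u + conv f' g u.
Proof.
elim: u f f' => [|x u IH] f f' /=; first exact: mulrDl.
by rewrite lquoD IH mulrDl addrACA.
Qed.

Lemma convDr f g g' u : conv f (g + g') u = conv f g u + conv f g' u.
Proof.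
elim: u f => [|x u IH] f /=; first exact: mulrDr.
by rewrite IH mulrDr addrACA.
Qed.

Lemma convZl k f g u : conv (k *: f) g u = k * conv f g u.
Proof.
elim: u f => [|x u IH] f /=; first by rewrite mulrA.
by rewrite lquoZ IH mulrDr mulrA.
Qed.

Lemma convZr k f g u : conv f (k *: g) u = k * conv f g u.
Proof.
elim: u f => [|x u IH] f /=; first by rewrite mulrCA.
by rewrite IH mulrDr mulrCA.
Qed.

Lemma conv0l g u : conv (0 : P) g u = 0.
Proof. by have := convZl 0 0 g u; rewrite scale0r mul0r. Qed.

Lemma lquo_mul x f g :
  lquo x (mul_series f g) = f [::] *: lquo x g + mul_series (lquo x f) g.
Proof. by []. Qed.

Fact mul_seriesA : associative mul_series.
Proof.
move=> f g h; apply: seriesP => u; rewrite {1 3}/mul_series.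
elim: u f => [|x u IH] f; first by rewrite /= mulrA.
rewrite [LHS]/= IH [RHS]/= lquo_mul convDl convZl addrA; congr (_ + _).
by rewrite {1}/mul_series /= mulrDr mulrA.
Qed.
Fact mul1_series : left_id one_series mul_series.
Proof.
move=> f; apply: seriesP => -[|x u]; rewrite /mul_series /= mul1r //.
by rewrite (_ : lquo x _ = 0) ?conv0l ?addr0.
Qed.
Fact mulr1_series : right_id one_series mul_series.
Proof.
move=> f; apply: seriesP; rewrite /mul_series => u.
elim: u f => [|x u IH] f /=; first by rewrite mulr1.
by rewrite IH mulr0 add0r.
Qed.
Fact mul_seriesDl : left_distributive mul_series +%R.
Proof. by move=> f g h; apply: seriesP => u; apply: convDl. Qed.
Fact mul_seriesDr : right_distributive mul_series +%R.
Proof. by move=> f g h; apply: seriesP => u; apply: convDr. Qed.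
Fact one_series_neq0 : one_series != 0.
Proof.
by apply/eqP => /(congr1 (fun f : P => f [::])) /eqP; rewrite /= oner_eq0.
Qed.
HB.instance Definition _ := GRing.Zmodule_isNzRing.Build P
  mul_seriesA mul1_series mulr1_series mul_seriesDl mul_seriesDr one_series_neq0.

Fact scale_seriesAl (k : K) f g : k *: (f * g) = (k *: f) * g.
Proof. by apply: seriesP => u; rewrite /= -[RHS]/(conv _ _ u) convZl. Qed.
HB.instance Definition _ := GRing.Lmodule_isLalgebra.Build K P scale_seriesAl.
Fact scale_seriesAr (k : K) f g : k *: (f * g) = f * (k *: g).
Proof. by apply: seriesP => u; rewrite /= -[RHS]/(conv _ _ u) convZr. Qed.
HB.instance Definition _ := GRing.Lalgebra_isAlgebra.Build K P scale_seriesAr.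

Lemma addsE f g u : (f + g) u = f u + g u. Proof. by []. Qed.
Lemma oppsE f u : (- f) u = - f u. Proof. by []. Qed.
Lemma subsE f g u : (f - g) u = f u - g u. Proof. by []. Qed.
Lemma zeroE u : (0 : P) u = 0. Proof. by []. Qed.
Lemma oneE u : (1 : P) u = (u == [::])%:R. Proof. by []. Qed.
Lemma scalesE k f u : (k *: f) u = k * f u. Proof. by []. Qed.
Lemma muls_nil f g : (f * g) [::] = f [::] * g [::]. Proof. by []. Qed.
Lemma muls_cons f g x u :
  (f * g) (x :: u) = f [::] * g (x :: u) + (lquo x f * g) u.
Proof. by []. Qed.
Lemma sumsE (J : Type) (r : seq J) (Q : pred J) (F : J -> P) u :
  (\sum_(i <- r | Q i) F i) u = \sum_(i <- r | Q i) F i u.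
Proof. by elim/big_rec2: _ => // i y f _ <-. Qed.

Lemma lquoM x f g : lquo x (f * g) = f [::] *: lquo x g + lquo x f * g.
Proof. by []. Qed.
Lemma lquoN x f : lquo x (- f) = - lquo x f. Proof. by []. Qed.
Lemma lquo_sum x (J : Type) (r : seq J) (Q : pred J) (F : J -> P) :
  lquo x (\sum_(i <- r | Q i) F i) = \sum_(i <- r | Q i) lquo x (F i).
Proof. by apply: seriesP => u; rewrite /lquo !sumsE. Qed.

Lemma mulsE f g u :
  (f * g) u = \sum_(k < (size u).+1) f (take k u) * g (drop k u).
Proof.
elim: u f => [|x u IH] f; first by rewrite big_ord1.
by rewrite muls_cons big_ord_recl take0 drop0 IH.
Qed.

Definition letter (x : X) : P := fun u => (u == [:: x])%:R.

Lemma letter_nil x : letter x [::] = 0. Proof. by []. Qed.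
Lemma lquo_letter x y : lquo y (letter x) = (y == x)%:R *: 1.
Proof.
by apply: seriesP => u; rewrite /lquo /letter scalesE oneE eqseq_cons -natrM mulnb.
Qed.
Lemma lmul_nil x f : (letter x * f) [::] = 0.
Proof. by rewrite muls_nil letter_nil mul0r. Qed.
Lemma lmul_cons x f y u : (letter x * f) (y :: u) = (y == x)%:R * f u.
Proof.
by rewrite muls_cons letter_nil mul0r add0r lquo_letter -scalerAl mul1r scalesE.
Qed.
Lemma rmul_rcons x f y u : (f * letter x) (rcons u y) = f u * (x == y)%:R.
Proof.
elim: u f => [|a u IH] f; rewrite /= muls_cons /= -[in RHS]/(lquo _ f _).
  by rewrite muls_nil letter_nil mulr0 addr0 /letter eqseq_cons eqxx andbT eq_sym.
by rewrite IH /letter eqseq_cons; case: u {IH} => [|? ?]; rewrite andbF mulr0 add0r.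
Qed.
Lemma rmul_nil x f : (f * letter x) [::] = 0.
Proof. by rewrite muls_nil letter_nil mulr0. Qed.

Lemma seriesE f : f = f [::] *: 1 + \sum_x letter x * lquo x f.
Proof.
apply: seriesP => -[|y u]; rewrite addsE scalesE oneE sumsE /=.
  by rewrite mulr1 big1 ?addr0 // => x _; rewrite lmul_nil.
rewrite mulr0 add0r (bigD1 y) //= lmul_cons eqxx mul1r big1 ?addr0 // => x.
by rewrite lmul_cons eq_sym => /negbTE ->; rewrite mul0r.
Qed.

(** f belongs to the n-th power of the augmentation ideal. *)
Definition ord n f : Prop := forall u, (size u < n)%N -> f u = 0.

Lemma ordW m n f : (m <= n)%N -> ord n f -> ord m f.
Proof. by move=> mn fn u um; apply: fn; apply: leq_trans um mn. Qed.
Lemma ordD n f g : ord n f -> ord n g -> ord n (f + g).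
Proof. by move=> fn gn u un; rewrite addsE fn ?gn ?addr0. Qed.
Lemma ordN n f : ord n f -> ord n (- f).
Proof. by move=> fn u un; rewrite oppsE fn ?oppr0. Qed.
Lemma ordB n f g : ord n f -> ord n g -> ord n (f - g).
Proof. by move=> fn gn; apply: ordD => //; apply: ordN. Qed.
Lemma ordZ n k f : ord n f -> ord n (k *: f).
Proof. by move=> fn u un; rewrite scalesE fn ?mulr0. Qed.
Lemma ord_sum n (J : Type) (r : seq J) (Q : pred J) (F : J -> P) :
  (forall i, Q i -> ord n (F i)) -> ord n (\sum_(i <- r | Q i) F i).
Proof. by move=> Fn; elim/big_ind: _ => // f g; apply: ordD. Qed.
Lemma ordM m n f g : ord m f -> ord n g -> ord (m + n)%N (f * g).
Proof.
move=> fm gn u un; rewrite mulsE big1 // => k _.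
have [km|mk] := ltnP (size (take k u)) m; first by rewrite fm ?mul0r.
rewrite gn ?mulr0 // size_drop; move: mk; rewrite size_take.
have ku : (k <= size u)%N by rewrite -ltnS.
case: ltnP => [_ mk|uk mk]; last first.
  have ek : (k : nat) = size u by apply/eqP; rewrite eqn_leq ku.
  rewrite ek subnn; rewrite ltnNge; apply/negP => n0.
  by move: un; rewrite ltnNge (leq_trans _ mk) //; move: n0; rewrite leqn0 => /eqP ->; rewrite addn0.
by rewrite ltn_subLR //; apply: leq_trans un _; rewrite leq_add2r.
Qed.
Lemma ord_letter x : ord 1 (letter x). Proof. by case. Qed.
Lemma ord_lquo n x f : ord n f -> ord n.-1 (lquo x f).
Proof. by case: n => // n fn u un; apply: fn. Qed.

(** The homogeneous part of length n. *)
Definition hp n f : P := fun u => if size u == n then f u else 0.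
Definition homog n f : Prop := forall u, size u != n -> f u = 0.

Lemma hp_homog n f : homog n (hp n f).
Proof. by move=> u /negbTE; rewrite /hp => ->. Qed.
Lemma hp_ord n f : ord n f -> ord n.+1 (f - hp n f).
Proof.
move=> fn u; rewrite ltnS subsE /hp; case: eqP => [-> _|]; first by rewrite subrr.
by move=> /eqP ne le; rewrite fn ?subr0 // ltn_neqAle ne.
Qed.
Lemma homog_ord n f : homog n f -> ord n f.
Proof. by move=> fn u un; apply: fn; rewrite neq_ltn un. Qed.
Lemma homog_eq0 n f : homog n f -> ord n.+1 f -> f = 0.
Proof.
move=> fh fo; apply: seriesP => u; have [e|] := eqVneq (size u) n; last exact: fh.
by rewrite fo // e.
Qed.
Lemma homogD n f g : homog n f -> homog n g -> homog n (f + g).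
Proof. by move=> fn gn u un; rewrite addsE fn ?gn ?addr0. Qed.
Lemma homogN n f : homog n f -> homog n (- f).
Proof. by move=> fn u un; rewrite oppsE fn ?oppr0. Qed.
Lemma homogZ n k f : homog n f -> homog n (k *: f).
Proof. by move=> fn u un; rewrite scalesE fn ?mulr0. Qed.
Lemma homog_sum n (J : Type) (r : seq J) (Q : pred J) (F : J -> P) :
  (forall i, Q i -> homog n (F i)) -> homog n (\sum_(i <- r | Q i) F i).
Proof. by move=> Fn; elim/big_ind: _ => // f g; apply: homogD. Qed.
Lemma homogM m n f g : homog m f -> homog n g -> homog (m + n)%N (f * g).
Proof.
move=> fm gn u un; rewrite mulsE big1 // => k _.
have [mk|km] := eqVneq (size (take k u)) m; last by rewrite fm ?mul0r.
have [nk|kn] := eqVneq (size (drop k u)) n; last by rewrite gn ?mulr0.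
by move: un; rewrite -{1}(cat_take_drop k u) size_cat mk nk eqxx.
Qed.
Lemma homog_letter x : homog 1 (letter x).
Proof. by move=> u; rewrite /letter; case: (u =P [:: x]) => [->|]. Qed.
Lemma homog_lquo n x f : homog n.+1 f -> homog n (lquo x f).
Proof. by move=> fn u un; apply: fn. Qed.

(** The recursion consumes one letter of the word at a time, so that it
    determines the operator.  Identities between operators are proved below by
    exhibiting a common recursion. *)
Lemma taylor_unique (tau : X -> K) (L R B : P -> P) :
  (forall f, L f = B f + \sum_x tau x *: (letter x * L (lquo x f))) ->
  (forall f, R f = B f + \sum_x tau x *: (letter x * R (lquo x f))) ->
  forall f, L f = R f.
Proof.
move=> HL HR f; apply: seriesP => u; elim: u f => [|y u IH] f.
  rewrite HL HR !addsE !sumsE; congr (_ + _).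
  by rewrite !big1 // => x _; rewrite scalesE lmul_nil mulr0.
rewrite HL HR !addsE !sumsE; congr (_ + _); apply: eq_bigr => x _.
by rewrite !scalesE !lmul_cons IH.
Qed.

Section Derivation.
Variables (tau : X -> K) (D : X -> P).

(** The tau-twisted derivation with D x as value at the letter x: on a product
    of a letter x and a series g it is D x * g + tau x * x * der g. *)
Fixpoint der_rec f u : K :=
  (\sum_x D x * lquo x f) u +
  (if u is y :: u' then tau y * der_rec (lquo y f) u' else 0).
Definition der f : P := der_rec f.

(** The automorphism that multiplies each letter by its weight; for the sign
    weights it produces the Koszul signs of an odd derivation. *)
Definition twist f : P := fun u => \prod_(x <- u) tau x * f u.

Lemma derE f : der f =
  \sum_x D x * lquo x f + \sum_x tau x *: (letter x * der (lquo x f)).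
Proof.
apply: seriesP => -[|y u]; rewrite addsE /der /=; congr (_ + _); rewrite sumsE.
  by rewrite big1 // => x _; rewrite scalesE lmul_nil mulr0.
rewrite (bigD1 y) //= scalesE lmul_cons eqxx mul1r big1 ?addr0 // => x.
by rewrite scalesE lmul_cons eq_sym => /negbTE ->; rewrite mul0r mulr0.
Qed.

Let head f : P := \sum_x D x * lquo x f.
Let headD f g : head (f + g) = head f + head g.
Proof. by rewrite -big_split; apply: eq_bigr => x _; rewrite lquoD mulrDr. Qed.
Let headZ k f : head (k *: f) = k *: head f.
Proof. by rewrite scaler_sumr; apply: eq_bigr => x _; rewrite lquoZ scalerAr. Qed.

Lemma derD f g : der (f + g) = der f + der g.
Proof.
apply: seriesP => u; rewrite addsE; elim: u f g => [|y u IH] f g.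
  by rewrite /der /= -!/(head _) headD !addr0.
rewrite /der /= -!/(head _) -!/(der _ _) headD.
by rewrite lquoD IH mulrDr addrACA.
Qed.

Lemma derZ k f : der (k *: f) = k *: der f.
Proof.
apply: seriesP => u; rewrite scalesE; elim: u f => [|y u IH] f.
  by rewrite /der /= -!/(head _) headZ !addr0.
rewrite /der /= -!/(head _) -!/(der _ _) headZ.
by rewrite lquoZ IH mulrDr mulrCA.
Qed.

Lemma der0 : der 0 = 0. Proof. by have := derZ 0 0; rewrite !scale0r. Qed.
Lemma derN f : der (- f) = - der f. Proof. by rewrite -scaleN1r derZ scaleN1r. Qed.
Lemma derB f g : der (f - g) = der f - der g. Proof. by rewrite derD derN. Qed.
Lemma der_sum (J : Type) (r : seq J) (Q : pred J) (F : J -> P) :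
  der (\sum_(i <- r | Q i) F i) = \sum_(i <- r | Q i) der (F i).
Proof. by elim/big_rec2: _ => [|i g f _ <-]; rewrite ?der0 ?derD. Qed.

Lemma der1 : der 1 = 0.
Proof.
rewrite derE !big1 ?addr0 // => x _.
  by rewrite (_ : lquo x 1 = 0) ?der0 ?mulr0 ?scaler0.
by rewrite (_ : lquo x 1 = 0) ?mulr0.
Qed.

Lemma der_letter x : der (letter x) = D x.
Proof.
rewrite derE (bigD1 x) //= lquo_letter eqxx scale1r mulr1 big1.
  rewrite addr0 big1 ?addr0 // => y _.
  by rewrite lquo_letter derZ der1 scaler0 mulr0 scaler0.
by move=> y; rewrite lquo_letter => /negbTE ->; rewrite scale0r mulr0.
Qed.

Lemma twistE f :
  twist f = f [::] *: 1 + \sum_x tau x *: (letter x * twist (lquo x f)).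
Proof.
apply: seriesP => -[|y u]; rewrite addsE scalesE oneE sumsE /twist.
  by rewrite big_nil mul1r mulr1 big1 ?addr0 // => x _; rewrite scalesE lmul_nil mulr0.
rewrite mulr0 add0r big_cons (bigD1 y) //= scalesE lmul_cons eqxx mul1r mulrA.
rewrite [X in _ = _ + X]big1 ?addr0 // => x; rewrite scalesE lmul_cons eq_sym.
by move=> /negbTE ->; rewrite mul0r mulr0.
Qed.

Lemma derM f g : der (f * g) = der f * g + twist f * der g.
Proof.
pose B f : P := \sum_x D x * lquo x f * g + f [::] *: der g.
pose R f := der f * g + twist f * der g.
apply: (@taylor_unique tau (fun f => der (f * g)) R B) => {}f.
  rewrite derE.
  have -> : \sum_x D x * lquo x (f * g) = \sum_x D x * lquo x f * g
      + f [::] *: (\sum_x D x * lquo x g).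
    rewrite scaler_sumr -big_split; apply: eq_bigr => x _.
    by rewrite lquoM mulrDr addrC -scalerAr mulrA.
  have -> : \sum_x tau x *: (letter x * der (lquo x (f * g))) =
     \sum_x tau x *: (letter x * der (lquo x f * g)) +
     f [::] *: \sum_x tau x *: (letter x * der (lquo x g)).
    rewrite scaler_sumr -big_split; apply: eq_bigr => x _.
    rewrite lquoM derD derZ mulrDr addrC scalerDr; congr (_ + _).
    by rewrite -scalerAr !scalerA mulrC.
  rewrite /B [in f [::] *: der g]derE scalerDr -!addrA; congr (_ + _).
  by congr (_ + _); rewrite addrC.
rewrite /R /B {1}derE {1}twistE !mulrDl -scalerAl mul1r !mulr_suml -!addrA.
congr (_ + _); rewrite addrCA; congr (_ + _).
rewrite -big_split; apply: eq_bigr => x _.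
by rewrite mulrDr scalerDr !mulrA !scalerAl.
Qed.

End Derivation.

Lemma der_ord r tau D n f :
  (forall x, ord r.+1 (D x)) -> ord n f -> ord (r + n)%N (der tau D f).
Proof.
move=> Dr fn u; rewrite /der; elim: u n f fn => [|y u IH] n f fn un /=.
  by rewrite addr0 sumsE big1 // => x _; rewrite muls_nil Dr ?mul0r.
have un1 : (size u < r + n.-1)%N.
  by case: n un {fn} => [|n]; rewrite /= ?addn0 ?addnS ?ltnS //; apply: ltnW.
rewrite (IH n.-1) ?mulr0 ?addr0 //; last exact: ord_lquo.
rewrite sumsE big1 // => x _; apply: (@ordM r.+1 n.-1) => //; exact: ord_lquo.
Qed.

Lemma derDl tau D D' f :
  der tau (fun x => D x + D' x) f = der tau D f + der tau D' f.
Proof.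
pose B f : P := \sum_x D x * lquo x f + \sum_x D' x * lquo x f.
apply: (@taylor_unique tau _ (fun f => der tau D f + der tau D' f) B) => {}f.
  by rewrite derE /B; congr (_ + _); rewrite -big_split; apply: eq_bigr => x _; rewrite mulrDl.
rewrite !(derE _ _ f) /B addrACA; congr (_ + _).
by rewrite -big_split; apply: eq_bigr => x _; rewrite mulrDr scalerDr.
Qed.

Lemma derZl tau k D f : der tau (fun x => k *: D x) f = k *: der tau D f.
Proof.
apply: (@taylor_unique tau _ (fun f => k *: der tau D f)
   (fun f => k *: (\sum_x D x * lquo x f))) => {}f.
  by rewrite derE; congr (_ + _); rewrite scaler_sumr; apply: eq_bigr => x _; rewrite scalerAl.
rewrite derE scalerDr; congr (_ + _); rewrite scaler_sumr.
by apply: eq_bigr => x _; rewrite -scalerAr !scalerA mulrC.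
Qed.

Lemma eq_der tau D D' : D =1 D' -> der tau D =1 der tau D'.
Proof. by move=> /funext ->. Qed.

Lemma derNl tau D f : der tau (fun x => - D x) f = - der tau D f.
Proof.
rewrite -scaleN1r -derZl; apply: eq_der => x; by rewrite scaleN1r.
Qed.

Section Substitution.
Variable phi : X -> P.

(** The recursion computes the sum over x of psi x * subst (lquo x f), see
    [subst_fromE].  Splitting off one letter of the word makes it structural,
    although each phi x may consume any positive number of letters. *)
Fixpoint subst_from (psi : X -> P) f u : K :=
  if u is y :: u' then
    subst_from (fun x => lquo y (psi x)) f u' +
    \sum_x psi x [::] * subst_from (fun x' => lquo y (phi x')) (lquo x f) u'
  else \sum_x psi x [::] * f [:: x].

(** The continuous algebra endomorphism x -> phi x. *)
Definition subst f : P := fun u =>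
  if u is y :: u' then subst_from (fun x => lquo y (phi x)) f u' else f [::].

Lemma subst_fromE psi f :
  subst_from psi f =1 (\sum_x psi x * subst (lquo x f) : P).
Proof.
move=> u; elim: u psi f => [|y u IH] psi f; rewrite sumsE.
  by apply: eq_bigr => x _; rewrite muls_nil.
transitivity (\sum_x (psi x [::] * subst (lquo x f) (y :: u) +
   (lquo y (psi x) * subst (lquo x f)) u)); last exact: eq_bigr.
by rewrite big_split [LHS]/= IH sumsE addrC.
Qed.

Hypothesis phi0 : forall x, phi x [::] = 0.

Lemma substE f : subst f = f [::] *: 1 + \sum_x phi x * subst (lquo x f).
Proof.
apply: seriesP => -[|y u]; rewrite addsE scalesE oneE sumsE /=.
  by rewrite mulr1 big1 ?addr0 // => x _; rewrite muls_nil phi0 mul0r.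
rewrite mulr0 add0r subst_fromE sumsE; apply: eq_bigr => x _.
by rewrite [RHS]muls_cons phi0 mul0r add0r.
Qed.

(** As phi x has no constant term, each occurrence of the operator on the right
    is evaluated at a strictly shorter word. *)
Lemma phi_unique (L R B : P -> P) (tau : X -> K) :
  (forall f, L f = B f + \sum_x tau x *: (phi x * L (lquo x f))) ->
  (forall f, R f = B f + \sum_x tau x *: (phi x * R (lquo x f))) ->
  forall f, L f = R f.
Proof.
move=> HL HR f; apply: seriesP => u.
have [n] := ubnP (size u); elim: n u f => // n IH u f un.
rewrite HL HR !addsE !sumsE; congr (_ + _); apply: eq_bigr => x _.
rewrite !scalesE; congr (_ * _).
case: u un => [|y u] un; first by rewrite !muls_nil phi0 !mul0r.
rewrite !mulsE; apply: eq_bigr => -[k kl] _ /=.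
case: k kl => [|k] kl; first by rewrite phi0 !mul0r.
by rewrite IH // /= size_drop; apply: leq_ltn_trans (leq_subr _ _) _.
Qed.

Lemma substD f g : subst (f + g) = subst f + subst g.
Proof.
pose B f g : P := (f [::] + g [::]) *: 1.
have H u : forall f g, subst (f + g) u = subst f u + subst g u.
  have [n] := ubnP (size u); elim: n u => // n IH [|y u] un {}f {}g //.
  rewrite !(substE) !addsE !scalesE !oneE !mulr0 !add0r !sumsE -big_split /=.
  apply: eq_bigr => x _; rewrite lquoD !muls_cons !phi0 !mul0r !add0r.
  rewrite -addsE -mulrDr !mulsE; apply: eq_bigr => k _; congr (_ * _); rewrite addsE.
  by apply: IH; rewrite size_drop; apply: leq_ltn_trans (leq_subr _ _) _.
by apply: seriesP => u; apply: H.
Qed.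

Lemma substZ k f : subst (k *: f) = k *: subst f.
Proof.
apply: (@phi_unique (fun f => subst (k *: f)) (fun f => k *: subst f)
   (fun f => (k * f [::]) *: 1) (fun => 1)) => {}f; rewrite substE.
  by congr (_ + _); apply: eq_bigr => x _; rewrite scale1r lquoZ.
rewrite scalerDr scalerA scaler_sumr; congr (_ + _).
by apply: eq_bigr => x _; rewrite scale1r scalerAr.
Qed.

Lemma subst0 : subst 0 = 0. Proof. by have := substZ 0 0; rewrite !scale0r. Qed.
Lemma substN f : subst (- f) = - subst f.
Proof. by rewrite -scaleN1r substZ scaleN1r. Qed.
Lemma substB f g : subst (f - g) = subst f - subst g.
Proof. by rewrite substD substN. Qed.
Lemma subst_sum (J : Type) (r : seq J) (Q : pred J) (F : J -> P) :
  subst (\sum_(i <- r | Q i) F i) = \sum_(i <- r | Q i) subst (F i).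
Proof. by elim/big_rec2: _ => [|i g f _ <-]; rewrite ?subst0 ?substD. Qed.

Lemma subst1 : subst 1 = 1.
Proof.
rewrite substE oneE scale1r big1 ?addr0 // => x _.
by rewrite (_ : lquo x 1 = 0) // subst0 mulr0.
Qed.

Lemma subst_letter x : subst (letter x) = phi x.
Proof.
rewrite substE letter_nil scale0r add0r (bigD1 x) //= lquo_letter eqxx scale1r.
rewrite subst1 mulr1 big1 ?addr0 // => y; rewrite lquo_letter => /negbTE ->.
by rewrite scale0r subst0 mulr0.
Qed.

Lemma substM f g : subst (f * g) = subst f * subst g.
Proof.
apply: (@phi_unique (fun f => subst (f * g)) (fun f => subst f * subst g)
   (fun f => f [::] *: subst g) (fun => 1)) => {}f; rewrite substE.
  rewrite [subst g]substE scalerDr scalerA -addrA; congr (_ + _).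
  rewrite scaler_sumr -big_split; apply: eq_bigr => x _.
  by rewrite lquoM substD substZ mulrDr scale1r -scalerAr.
rewrite mulrDl -scalerAl mul1r mulr_suml; congr (_ + _).
by apply: eq_bigr => x _; rewrite scale1r mulrA.
Qed.

Lemma subst_ord n f : ord n f -> ord n (subst f).
Proof.
move=> fn u; have [N] := ubnP (size u); elim: N u n f fn => // N IH u n f fn uN un.
case: u uN un => [|y u] uN un; first exact: fn.
rewrite substE addsE scalesE mulr0 add0r sumsE big1 // => x _.
rewrite muls_cons phi0 mul0r add0r mulsE big1 // => k _.
rewrite (IH (drop k u) n.-1) ?mulr0 //; first exact: ord_lquo.
  by rewrite size_drop; apply: leq_ltn_trans (leq_subr _ _) _.
rewrite size_drop; apply: leq_ltn_trans (leq_subr _ _) _.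
by case: n un {fn}.
Qed.

End Substitution.

Lemma subst_id f : subst letter f = f.
Proof.
apply: (@phi_unique letter letter_nil (subst letter) id (fun f => f [::] *: 1) (fun => 1)) => {}f.
  by rewrite (substE letter_nil); congr (_ + _); apply: eq_bigr => x _; rewrite scale1r.
by rewrite {1}(seriesE f); congr (_ + _); apply: eq_bigr => x _; rewrite scale1r.
Qed.

(** A product of m letters is deformed by replacing one of them by a value of
    e, which has order n, while the other m - 1 letters keep order at least 1. *)
Lemma deform_ord (phi psi e : X -> P) (tau : X -> K) (E : P -> P) n m f :
  (forall x, phi x [::] = 0) -> (forall x, psi x [::] = 0) ->
  (forall x, ord n (e x)) ->
  (forall f, E f = \sum_x e x * subst phi (lquo x f)
                 + \sum_x tau x *: (psi x * E (lquo x f))) ->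
  ord m f -> ord (n + m.-1)%N (E f).
Proof.
move=> p0 q0 eo EE fm u.
have [N] := ubnP (size u); elim: N u m f fm => // N IH u m f fm uN un.
rewrite EE addsE !sumsE !big1 ?addr0 // => x _; last first.
  by apply: (ordM (eo x) (subst_ord p0 (ord_lquo x fm))).
rewrite scalesE; case: u uN un => [|y u] uN un; first by rewrite muls_nil q0 mul0r mulr0.
rewrite muls_cons q0 mul0r add0r mulsE big1 ?mulr0 // => k _.
have sd : (size (drop k u) <= size u)%N by rewrite size_drop leq_subr.
rewrite (IH _ m.-1) ?mulr0 //; first exact: ord_lquo.
  by apply: leq_ltn_trans sd _.
apply: leq_ltn_trans sd _; move: un; rewrite /=.
by case: m {fm} => [|[|m]]; rewrite /= ?addn0 ?addnS //; apply: ltnW.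
Qed.

Lemma subst_diff_ord (phi psi : X -> P) n m f :
  (forall x, phi x [::] = 0) -> (forall x, psi x [::] = 0) ->
  (forall x, ord n (phi x - psi x)) -> ord m f ->
  ord (n + m.-1)%N (subst phi f - subst psi f).
Proof.
move=> p0 q0 d fm.
apply: (@deform_ord phi psi (fun x => phi x - psi x) (fun=> 1)
  (fun f => subst phi f - subst psi f)) => // {d m fm} {}f.
rewrite (substE p0) (substE q0) opprD addrACA subrr add0r -sumrB -big_split.
by apply: eq_bigr => x _; rewrite /= scale1r mulrBl mulrBr addrA subrK.
Qed.

Lemma der_homog tau r n D f :
  (forall x, homog r.+1 (D x)) -> homog n f -> homog (r + n)%N (der tau D f).
Proof.
move=> Dr fn u; rewrite /der; elim: u n f fn => [|y u IH] n f fn un /=.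
  by rewrite addr0 sumsE big1 // => x _; rewrite muls_nil Dr ?mul0r.
case: n fn un => [|n] fn un.
  have l0 x : lquo x f = 0 by apply: seriesP => v; apply: fn.
  rewrite sumsE big1 => [|x _]; last by rewrite l0 mulr0.
  by rewrite -/(der_rec _ _ _) l0 add0r -[der_rec _ _ _ _]/(der tau D 0 u) der0 mulr0.
have un' : size u != (r + n)%N by move: un; rewrite addnS eqSS.
rewrite (IH n) ?mulr0 ?addr0 //; last exact: homog_lquo.
rewrite sumsE big1 // => x _; apply: (@homogM r.+1 n) => //; exact: homog_lquo.
Qed.

End SeriesRing.

(** * Letters, gradings and signs *)
Section Letters.
Variables (I A : finType).

(** The letters [zl i], [wl i] and [vl a] are the coordinates dual to the
    identity of the i-th object, to the dual class in degree 2, and to the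
    basis vector of index a in degree 1. *)
Definition letters : finType := (I + I + A)%type.
Definition zl (i : I) : letters := inl (inl i).
Definition wl (i : I) : letters := inl (inr i).
Definition vl (a : A) : letters := inr a.

Variables (sA tA : A -> I) (star : A -> A).

Definition src (x : letters) : I :=
  match x with inl (inl i) => i | inl (inr i) => i | inr a => sA a end.
Definition tgt (x : letters) : I :=
  match x with inl (inl i) => i | inl (inr i) => i | inr a => tA a end.
(** The letter of the basis vector with which the one of x is paired. *)
Definition st (x : letters) : letters :=
  match x with inl (inl i) => wl i | inl (inr i) => zl i | inr a => vl (star a) end.
Definition isz (x : letters) : bool := if x is inl (inl _) then true else false.
(** The shifted degree: the degree minus one. *)
Definition sd (x : letters) : int :=
  match x with inl (inl _) => -1 | inl (inr _) => 1 | inr _ => 0 end.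

Definition sdw (u : seq letters) : int := \sum_(x <- u) sd x.

(** The composable words from i to j. *)
Fixpoint pth (i j : I) (u : seq letters) : bool :=
  if u is x :: u' then (src x == i) && pth (tgt x) j u' else i == j.

Lemma sdw_nil : sdw [::] = 0. Proof. exact: big_nil. Qed.
Lemma sdw_cons x u : sdw (x :: u) = sd x + sdw u. Proof. exact: big_cons. Qed.
Lemma sdw_cat u v : sdw (u ++ v) = sdw u + sdw v. Proof. exact: big_cat. Qed.
Lemma sdw_rcons x u : sdw (rcons u x) = sdw u + sd x.
Proof. by rewrite -cats1 sdw_cat sdw_cons sdw_nil addr0. Qed.

Lemma pth_cat i j k p q : pth i k p -> pth k j q -> pth i j (p ++ q).
Proof.
elim: p i => [|x p IH] i /=; first by move=> /eqP ->.
by move=> /andP[-> /IH]; apply.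
Qed.

Lemma pth_rcons i j u x : pth i j (rcons u x) = pth i (src x) u && (tgt x == j).
Proof.
elim: u i => [|y u IH] i /=; first by rewrite eq_sym.
by rewrite IH andbA.
Qed.

Lemma pth_end i j j' u : pth i j u -> pth i j' u -> j = j'.
Proof.
elim: u i => [|x u IH] i /=; first by move=> /eqP <- /eqP <-.
by move=> /andP[_ h] /andP[_]; apply: IH.
Qed.

End Letters.

Section Symplectic.
Variables (K : fieldType) (I A : finType).
Variables (sA tA : A -> I) (star : A -> A) (eps : A -> K).
Hypothesis starK : involutive star.
Hypothesis sA_star : forall a, sA (star a) = tA a.
Hypothesis tA_star : forall a, tA (star a) = sA a.
Hypothesis eps_star : forall a, eps (star a) = - eps a.
Hypothesis eps_sqr : forall a, eps a * eps a = 1.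

Local Notation X := (letters I A).
Local Notation P := (series K X).
Local Notation zl := (@zl I A).
Local Notation wl := (@wl I A).
Local Notation vl := (@vl I A).
Local Notation src := (@src I A sA).
Local Notation tgt := (@tgt I A tA).
Local Notation st := (@st I A star).
Local Notation isz := (@isz I A).
Local Notation sd := (@sd I A).
Local Notation sdw := (@sdw I A).
Local Notation pth := (@pth I A sA tA).
Local Notation L := (@letter K X).
Implicit Types (f g h : P) (u p q r : seq X) (x y : X).

(** The value of the suspended pairing on the basis vectors of x and st x. *)
Definition ep x : K := if x is inr a then eps a else 1.
Definition sg x : K := (-1) ^ sd x.
Definition sgw u : K := (-1) ^ sdw u.

Lemma sgzD (m n : int) : (-1 : K) ^ (m + n) = (-1) ^ m * (-1) ^ n.
Proof. by rewrite exprzDr // unitrN unitr1. Qed.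
Lemma sgzN (m : int) : (-1 : K) ^ (- m) = (-1) ^ m.
Proof. by rewrite -exprz_inv invrN invr1. Qed.
Lemma sgz_sqr (m : int) : (-1 : K) ^ m * (-1) ^ m = 1.
Proof. by rewrite -{2}sgzN -sgzD subrr. Qed.

Lemma sgzE i : sg (zl i) = -1. Proof. by rewrite /sg /= sgzN expr1z. Qed.
Lemma sgwE i : sg (wl i) = -1. Proof. by rewrite /sg /= expr1z. Qed.
Lemma sgvE a : sg (vl a) = 1. Proof. by rewrite /sg /= expr0z. Qed.

Lemma sg_isz x : isz x -> sg x = -1.
Proof. by case: x => [[i|i]|a] // _; exact: sgzE. Qed.

Lemma stK : involutive st.
Proof. by move=> [[i|i]|a] //=; rewrite starK. Qed.
Lemma src_st x : src (st x) = tgt x.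
Proof. by case: x => [[i|i]|a] /=. Qed.
Lemma tgt_st x : tgt (st x) = src x.
Proof. by case: x => [[i|i]|a] /=. Qed.
Lemma sd_st x : sd (st x) = - sd x.
Proof. by case: x => [[i|i]|a]. Qed.
Lemma sg_st x : sg (st x) = sg x.
Proof. by rewrite /sg sd_st sgzN. Qed.
Lemma sg_sqr x : sg x * sg x = 1.
Proof. exact: sgz_sqr. Qed.
Lemma ep_st x : ep (st x) = - sg x * ep x.
Proof. by case: x => [[i|i]|a] /=; rewrite ?sgzE ?sgwE ?sgvE ?opprK ?mulr1 ?eps_star ?mulN1r. Qed.
Lemma ep_sqr x : ep x * ep x = 1.
Proof. by case: x => [[i|i]|a]; rewrite /= ?eps_sqr ?mulr1. Qed.

Lemma sgw_nil : sgw [::] = 1. Proof. by rewrite /sgw sdw_nil. Qed.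
Lemma sgw_cons x u : sgw (x :: u) = sg x * sgw u.
Proof. by rewrite /sgw sdw_cons sgzD. Qed.
Lemma sgw_rcons x u : sgw (rcons u x) = sgw u * sg x.
Proof. by rewrite /sgw sdw_rcons sgzD. Qed.
Lemma prod_sg u : \prod_(x <- u) sg x = sgw u.
Proof. by elim: u => [|x u IH]; rewrite ?big_nil ?sgw_nil // big_cons IH sgw_cons. Qed.

(** f only involves composable words from i to j of total shifted degree d. *)
Definition sup i j (d : int) f : Prop :=
  forall u, f u != 0 -> pth i j u /\ sdw u = d.

Lemma sup_out i j d f u : sup i j d f -> ~~ (pth i j u && (sdw u == d)) -> f u = 0.
Proof.
move=> fs; apply: contraNeq => /fs [-> ->]; exact: eqxx.
Qed.
Lemma supD i j d f g : sup i j d f -> sup i j d g -> sup i j d (f + g).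
Proof.
move=> fs gs u; rewrite addsE; have [->|/fs //] := eqVneq (f u) 0.
by rewrite add0r => /gs.
Qed.
Lemma supZ i j d k f : sup i j d f -> sup i j d (k *: f).
Proof. by move=> fs u; rewrite scalesE mulf_eq0 negb_or => /andP[_ /fs]. Qed.
Lemma supN i j d f : sup i j d f -> sup i j d (- f).
Proof. by move=> fs; rewrite -scaleN1r; apply: supZ. Qed.
Lemma supB i j d f g : sup i j d f -> sup i j d g -> sup i j d (f - g).
Proof. by move=> fs gs; apply: supD => //; apply: supN. Qed.
Lemma sup0 i j d : sup i j d 0.
Proof. by move=> u; rewrite eqxx. Qed.
Lemma sup_sum i j d (J : Type) (r : seq J) (Q : pred J) (F : J -> P) :
  (forall k, Q k -> sup i j d (F k)) -> sup i j d (\sum_(k <- r | Q k) F k).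
Proof. by move=> Fs; elim/big_ind: _ => // *; [exact: sup0|exact: supD]. Qed.
Lemma supM i j k d e f g : sup i k d f -> sup k j e g -> sup i j (d + e) (f * g).
Proof.
move=> fs gs u; rewrite mulsE => nz.
have [l] : exists l : 'I_(size u).+1, f (take l u) * g (drop l u) != 0.
  apply/existsP; apply: contraNT nz; rewrite negb_exists => /forallP nz.
  by rewrite big1 // => l _; apply/eqP; rewrite -[_ == _]negbK nz.
rewrite mulf_eq0 negb_or => /andP[/fs [p1 <-] /gs [p2 <-]].
by rewrite -sdw_cat -{1}(cat_take_drop l u) cat_take_drop; split=> //;
  rewrite -(cat_take_drop l u); apply: pth_cat p1 p2.
Qed.
Lemma sup_letter x : sup (src x) (tgt x) (sd x) (L x).
Proof.
move=> u; rewrite /letter; case: (u =P [:: x]) => [->|]; last by rewrite eqxx.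
by rewrite sdw_cons sdw_nil addr0 /= !eqxx.
Qed.
Lemma sup_lquo x i j d f : sup i j d f -> sup (tgt x) j (d - sd x) (lquo x f).
Proof.
move=> fs u /fs [/= /andP[_ ->]]; rewrite sdw_cons => <-.
by rewrite [sd x + _]addrC addrK.
Qed.
Lemma lquo_sup0 x i j d f : sup i j d f -> src x != i -> lquo x f = 0.
Proof.
move=> fs xi; apply: seriesP => u; apply: (sup_out fs).
by rewrite /= (negbTE xi).
Qed.
Lemma sup_hp n i j d f : sup i j d f -> sup i j d (hp n f).
Proof. by move=> fs u; rewrite /hp; case: ifP => _; [apply: fs|rewrite eqxx]. Qed.
Lemma twist_sup i j d f : sup i j d f -> twist sg f = (-1) ^ d *: f.
Proof.
move=> fs; apply: seriesP => u; rewrite scalesE /twist prod_sg.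
have [->|/fs [_ <-] //] := eqVneq (f u) 0; by rewrite !mulr0.
Qed.

(** The quadratic differential [c2] minus the graded commutator with the sum of
    all z_i: on a path from i to j, the derivation given by [c2] is the one
    given by [c0] plus a product with z_i on the left and one with z_j on the
    right ([der_c2]). *)
Definition c0 x : P :=
  match x with
  | inl (inl i) => - (L (zl i) * L (zl i))
  | inl (inr i) => \sum_(a | sA a == i) eps a *: (L (vl a) * L (vl (star a)))
  | inr a => 0
  end.

(** The part of D0 that acts at the first letter of the word, see [D0_cons]. *)
Definition h0 f x u : K :=
  match x, u with
  | inl (inl i), y :: u' => - (y == zl i)%:R * f (y :: u')
  | inr a, y :: u' => eps a * ((y == vl (star a))%:R * f (wl (sA a) :: u'))
  | _, _ => 0
  end.

Local Notation D0 := (der sg c0).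

Lemma D0_nil f : D0 f [::] = 0.
Proof.
rewrite /der /= addr0 sumsE big1 // => -[[i|i]|a] _ /=.
- by rewrite muls_nil oppsE lmul_nil oppr0 mul0r.
- rewrite muls_nil sumsE big1 ?mul0r // => a _.
  by rewrite scalesE lmul_nil mulr0.
by rewrite mul0r.
Qed.

Lemma D0_cons f x u : D0 f (x :: u) = h0 f x u + sg x * D0 (lquo x f) u.
Proof.
rewrite /der /=; congr (_ + _); rewrite sumsE !big_sumType /=.
rewrite [X in _ + X]big1 ?addr0; last by move=> a _; rewrite mul0r.
rewrite (eq_bigr (fun i => - ((x == zl i)%:R * ((L (zl i) * lquo (zl i) f) u)))); last first.
  by move=> i _; rewrite mulNr -mulrA oppsE lmul_cons.
rewrite [X in _ + X](eq_bigr (fun i => \sum_(a | sA a == i)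
    eps a * ((x == vl a)%:R * (L (vl (star a)) * lquo (wl i) f) u))); last first.
  move=> i _; rewrite mulr_suml sumsE; apply: eq_bigr => a _.
  by rewrite -scalerAl scalesE -mulrA lmul_cons.
case: x => [[i|i]|a].
- rewrite (bigD1 i) //= eqxx mul1r big1 ?addr0; last first.
    by move=> j /negbTE ji; rewrite (_ : (_ == _) = false) ?mul0r ?oppr0 //; apply/eqP => -[/esym /eqP]; rewrite ji.
  rewrite big1 ?addr0; last by move=> j _; rewrite big1 // => a _; rewrite mul0r mulr0.
  case: u => [|y u]; first by rewrite lmul_nil oppr0.
  by rewrite lmul_cons mulNr /lquo; case: eqP => [->|]; rewrite ?mul0r.
- rewrite big1 ?add0r; last by move=> j _; rewrite mul0r oppr0.
  by rewrite big1 // => j _; rewrite big1 // => a _; rewrite mul0r mulr0.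
rewrite big1 ?add0r; last by move=> j _; rewrite mul0r oppr0.
rewrite (bigD1 (sA a)) //= (bigD1 a) //= eqxx mul1r big1 ?addr0; last first.
  move=> b /andP[_ /negbTE ba]; rewrite (_ : (_ == _) = false) ?mul0r ?mulr0 //.
  by apply/eqP => -[/esym /eqP]; rewrite ba.
rewrite big1 ?addr0; last first.
  move=> j /negbTE ji; rewrite big1 // => b /eqP bj.
  rewrite (_ : (_ == _) = false) ?mul0r ?mulr0 //.
  by apply/eqP => -[ab]; move: ji; rewrite -bj ab eqxx.
case: u => [|y u] /=; first by rewrite lmul_nil mulr0.
by rewrite lmul_cons.
Qed.

(** The coefficient of p z r in dup f is the sum, over the occurrences of a
    letter z in the word, of the sign of p times the coefficient of p z z r. *)
Fixpoint dup_rec f u : K :=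
  if u is x :: u' then
    (isz x)%:R * f (x :: x :: u') + sg x * dup_rec (lquo x f) u'
  else 0.
Definition dup f : P := dup_rec f.

Lemma dup_nil f : dup f [::] = 0. Proof. by []. Qed.
Lemma dup_cons f x u :
  dup f (x :: u) = (isz x)%:R * f (x :: x :: u) + sg x * dup (lquo x f) u.
Proof. by []. Qed.

Lemma dupD f g : dup (f + g) = dup f + dup g.
Proof.
apply: seriesP => u; rewrite addsE.
elim: u f g => [|x u IH] f g; first by rewrite !dup_nil addr0.
by rewrite !dup_cons lquoD IH addsE !mulrDr addrACA.
Qed.
Lemma dupZ k f : dup (k *: f) = k *: dup f.
Proof.
apply: seriesP => u; rewrite scalesE.
elim: u f => [|x u IH] f; first by rewrite !dup_nil mulr0.
by rewrite !dup_cons lquoZ IH scalesE mulrDr; congr (_ + _); rewrite mulrCA.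
Qed.
Lemma dup0 : dup 0 = 0.
Proof. by have := dupZ 0 0; rewrite !scale0r. Qed.

Definition headis x u : bool := if u is y :: _ then y == x else false.

(** The number of maximal blocks of equal letters z. *)
Fixpoint zruns u : nat :=
  if u is x :: u' then (isz x && ~~ headis x u') + zruns u' else 0.

Lemma dup_head x f u :
  dup (fun v => (headis x v)%:R * f v : K) u = (headis x u)%:R * dup f u.
Proof.
case: u => [|y u]; first by rewrite !dup_nil mulr0.
rewrite !dup_cons (_ : lquo y _ = (y == x)%:R *: lquo y f) // dupZ scalesE mulrDr.
by congr (_ + _); rewrite mulrCA.
Qed.

(** The signs of the positions inside a block of equal z's alternate.  Hence
    doubling a letter of the block gives zero in total if its length is even,
    and D0, which undoes a doubling, gives zero if the length is odd: for every
    block exactly one of the two compositions contributes - f u.  The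
    contributions of pairs of distinct blocks cancel, and so do those of the
    terms v v* of D0. *)
Lemma contraction f u :
  D0 (dup f) u + dup (D0 f) u = - ((zruns u)%:R * f u).
Proof.
elim: u f => [|x u IH] f; first by rewrite D0_nil mul0r oppr0 addr0.
rewrite D0_cons.
rewrite (_ : lquo x (dup f) = (isz x)%:R *: lquo x (lquo x f) + sg x *: dup (lquo x f)) //.
rewrite derD !derZ addsE !scalesE mulrDr [sg x * (sg x * _)]mulrA sg_sqr mul1r.
rewrite [dup (D0 f) _]dup_cons D0_cons.
rewrite (_ : lquo x (D0 f) = (h0 f x : P) + sg x *: D0 (lquo x f)); last first.
  by apply: seriesP => v; rewrite addsE scalesE -D0_cons.
rewrite dupD dupZ addsE scalesE [sg x * (dup _ u + _)]mulrDr.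
rewrite [sg x * (sg x * _)]mulrA sg_sqr mul1r.
have -> : D0 (lquo x f) (x :: u) =
  h0 (lquo x f) x u + sg x * D0 (lquo x (lquo x f)) u by rewrite D0_cons.
have H := IH (lquo x f).
rewrite /= natrD mulrDl opprD -[f (x :: u)]/(lquo x f u) -H {H IH}.
set a := D0 (dup _) u; set b := dup (D0 _) u; set c := D0 (lquo x (lquo x f)) u.
suff E : h0 (dup f) x u + (isz x)%:R * (h0 f x (x :: u) + sg x * (h0 (lquo x f) x u)) +
  sg x * dup (h0 f x) u = - ((isz x && ~~ headis x u)%:R * lquo x f u).
  have [z|z] := boolP (isz x); last first.
    by move: E; rewrite (negbTE z) /= mulr0n !mul0r addr0 oppr0 => E;
      rewrite mulr0 !add0r -[RHS]add0r -E; ring.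
  move: E; rewrite z !mul1r /= => <-.
  rewrite ?mulr1n ?mul1r (sg_isz z); ring.
case: x {a b c} => [[i|i]|a].
- rewrite -/(zl i) sgzE mul1r /=.
  have -> : dup (h0 f (zl i)) u = - ((headis (zl i) u)%:R * dup f u).
    rewrite -dup_head -mulN1r -scalesE -dupZ; congr (dup _ u); apply: seriesP => -[|y v];
     rewrite scalesE ?mul0r ?mulr0 //= mulN1r mulNr //.
  case: u => [|y u] /=; first by rewrite eqxx /lquo ?mulr1n ?mulr0n ?dup_nil; ring.
  rewrite eqxx; case: (y =P _) => [->|_] /=; rewrite /lquo ?mulr1n ?mulr0n; ring.
- have h00 : h0 f (wl i) = 0 :> P by apply: seriesP => -[].
  rewrite -/(wl i) h00 dup0 zeroE mulr0 addr0 /= mulr0n !mul0r addr0 oppr0.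
  by [].
rewrite -/(vl a) /= mul0r addr0 sgvE mul1r mul0r oppr0.
case: u => [|y u] /=; first by rewrite addr0.
have -> : lquo y (h0 f (vl a)) = (eps a * (y == vl (star a))%:R) *: lquo (wl (sA a)) f.
  by apply: seriesP => v; rewrite scalesE /lquo /= mulrA.
rewrite dupZ mul0r sgwE add0r scalesE; case: eqP => [->|_].
  by rewrite sgvE ?mulr1n ?mulr0n; ring.
by rewrite ?mulr1n ?mulr0n; ring.
Qed.

End Symplectic.

Arguments sup_letter [K I A] sA tA x.
Arguments sup0 [K I A] sA tA i j d.

(** * Rotation of words *)

(** Linear identities between series hold coefficient by coefficient. *)
Ltac pointwise := apply: seriesP => ?; rewrite ?(addsE, oppsE, scalesE, zeroE); ring.

Section Cyclic.
Variables (K : fieldType) (I A : finType).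
Variables (sA tA : A -> I) (star : A -> A) (eps : A -> K).
Hypothesis starK : involutive star.
Hypothesis sA_star : forall a, sA (star a) = tA a.
Hypothesis tA_star : forall a, tA (star a) = sA a.
Hypothesis eps_star : forall a, eps (star a) = - eps a.
Hypothesis eps_sqr : forall a, eps a * eps a = 1.

Local Notation X := (letters I A).
Local Notation P := (series K X).
Local Notation zl := (@zl I A).
Local Notation wl := (@wl I A).
Local Notation vl := (@vl I A).
Local Notation isz := (@isz I A).
Local Notation sdw := (@sdw I A).
Local Notation pth := (@pth I A sA tA).
Local Notation L := (@letter K X).
Local Notation sg := (@sg K I A).
Local Notation sgw := (@sgw K I A).
Local Notation c0 := (@c0 K I A sA star eps).
Local Notation h0 := (@h0 K I A sA star eps).
Local Notation D0 := (der sg c0).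
Implicit Types (f g h : P) (u p q r : seq X) (x y : X).

(** Invariance under the two moves z <-> z z and w <-> v v* by which D0 relates
    coefficients; multiplication by such a weight commutes with D0. *)
Definition weight_invariant (w : seq X -> K) : Prop :=
  (forall p i r, w (p ++ zl i :: zl i :: r) = w (p ++ zl i :: r)) /\
  (forall p a r, w (p ++ vl a :: vl (star a) :: r) = w (p ++ wl (sA a) :: r)).

Definition wmul (w : seq X -> K) f : P := fun u => w u * f u.

Lemma weight_invariant_cons w x : weight_invariant w -> weight_invariant (fun u => w (x :: u)).
Proof. by move=> [wz wv]; split=> p; [exact: (wz (x :: p))|exact: (wv (x :: p))]. Qed.

Lemma D0_weight w f u : weight_invariant w -> D0 (wmul w f) u = w u * D0 f u.
Proof.
elim: u w f => [|x u IH] w f wi; first by rewrite !D0_nil mulr0.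
rewrite !D0_cons (_ : lquo x _ = wmul (fun v => w (x :: v)) (lquo x f)) //.
rewrite IH; last exact: weight_invariant_cons.
rewrite mulrDr mulrCA; congr (_ + _).
case: x {IH} => [[i|i]|a]; case: u => [|y u] /=; rewrite ?mulr0 // /wmul.
  case: (y =P _) => [->|_]; last by rewrite ?mulr0n; ring.
  by have := wi.1 [::] i u; rewrite -/(zl i) /= => ->; ring.
case: (y =P _) => [->|_]; last by rewrite ?mulr0n; ring.
by have := wi.2 [::] a u; rewrite -/(vl a) /= => ->; ring.
Qed.

(** [cyclic_zruns] counts the ends of blocks of equal z's on the circle: the first
    letter is appended again so that a block is not counted twice across the
    cut.  A circle filled by a single letter counts zero. *)
Fixpoint cnt x u : nat :=
  if u is y :: u' then (isz x && (y != x)) + cnt y u' else 0.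
Definition cyclic_zruns u : nat := if u is x :: u' then cnt x (rcons u' x) else 0.

Lemma cnt_rcons x u y z :
  cnt x (rcons (rcons u y) z) = (cnt x (rcons u y) + (isz y && (z != y)))%N.
Proof.
elim: u x => [|a u IH] x /=; first by rewrite !addn0.
by rewrite IH addnA.
Qed.

Lemma cyclic_zruns_rot x u : cyclic_zruns (rcons u x) = cyclic_zruns (x :: u).
Proof.
case: u => [|y u] //=.
by rewrite cnt_rcons addnC.
Qed.

Lemma rot_cat (f : seq X -> nat) :
  (forall x u, f (rcons u x) = f (x :: u)) -> forall p q, f (p ++ q) = f (q ++ p).
Proof.
move=> fr p; elim: p => [|x p IH] q; first by rewrite cats0.
by rewrite /= -fr -cats1 -catA IH -catA.
Qed.

Lemma zruns_cnt x u c : ~~ isz c -> zruns (x :: u) = cnt x (rcons u c).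
Proof.
move=> cz; elim: u x => [|y u IH] x; last first.
  by rewrite -[LHS]/((isz x && ~~ headis x (y :: u)) + zruns (y :: u))%N IH.
rewrite /= addn0 andbT; case: (boolP (isz x)) => //= xz.
by rewrite addn0; case: (c =P x) cz => // ->; rewrite xz.
Qed.

Lemma cyclic_zruns_lin x u : ~~ isz x -> cyclic_zruns (x :: u) = zruns (x :: u).
Proof. by move=> xz; rewrite (zruns_cnt _ _ xz). Qed.

Lemma cyclic_zruns_wt (g : nat -> K) : weight_invariant (fun u => g (cyclic_zruns u)).
Proof.
split=> [p i r|p a r]; congr g; rewrite !(rot_cat cyclic_zruns_rot p) /=.
  by rewrite eqxx.
by rewrite -[in RHS](@zruns_cnt (wl (sA a)) _ (wl (sA a))) // -(@zruns_cnt (vl (star a)) _ (vl a)).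
Qed.

Lemma nz_sdw u : ~~ has isz u -> 0 <= sdw u.
Proof.
elim: u => [|x u IH] /=; first by rewrite sdw_nil.
rewrite negb_or sdw_cons => /andP[xz /IH]; case: x xz => [[i|i]|a] //= _; lia.
Qed.

Lemma zruns_eq0 u : zruns u = 0%N -> ~~ has isz u.
Proof.
elim: u => [|x u IH] //= /eqP; rewrite addn_eq0 => /andP[h /eqP /IH nz].
rewrite negb_or nz andbT; case: (boolP (isz x)) h => //= xz.
by case: u nz {IH} => [|y u] //=; case: (y =P x) => [->|//]; rewrite xz.
Qed.

Lemma dup_rcons f u x :
  dup f (rcons u x) = dup (fun v => f (rcons v x) : K) u +
    sgw u * ((isz x)%:R * f (rcons (rcons u x) x)).
Proof.
elim: u f => [|y u IH] f.
  by rewrite dup_cons dup_nil mulr0 addr0 sgw_nil mul1r dup_nil add0r.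
rewrite rcons_cons !dup_cons IH sgw_cons mulrDr !addrA; congr (_ + _).
by rewrite !mulrA.
Qed.

(** In total degree -1 the word obtained by doubling has degree 0, so that
    moving one letter around it costs only the sign of that letter. *)
Lemma dup_rot (G : P) x u :
  (forall y v, G (y :: v) = G (rcons v y)) -> (forall v, G v != 0 -> sdw v = -1) ->
  dup G (x :: u) = sg x * dup G (rcons u x).
Proof.
move=> Gr Gs; rewrite dup_cons dup_rcons mulrDr addrC; congr (_ + _).
  by congr (_ * dup _ u); apply: seriesP => v; apply: Gr.
have [xz|xz] := boolP (isz x); last by rewrite mulr0n !mul0r !mulr0.
rewrite mulr1n !mul1r -Gr -rcons_cons -Gr mulrA (sg_isz _ xz).
have [->|/Gs] := eqVneq (G [:: x, x & u]) 0; first by rewrite mulr0.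
rewrite !sdw_cons => e; have -> : sgw u = -1; last by rewrite mulrNN !mul1r.
rewrite /sgw (_ : sdw u = 1) ?expr1z //.
by case: x xz e => [[i|i]|a] //= _; lia.
Qed.

Lemma dup_supp f u : dup f u != 0 ->
  exists p x r, [/\ u = p ++ x :: r, isz x & f (p ++ x :: x :: r) != 0].
Proof.
elim: u f => [|x u IH] f; first by rewrite dup_nil eqxx.
rewrite dup_cons; have [->|] := eqVneq ((isz x)%:R * f [:: x, x & u]) 0.
  rewrite add0r mulf_eq0 negb_or => /andP[_ /IH [p [y [r [-> yz nz]]]]].
  by exists (x :: p), y, r.
rewrite mulf_eq0 negb_or => /andP[xz nz] _; exists [::], x, u; split=> //.
by case: (isz x) xz => //; rewrite eqxx.
Qed.

Lemma dup_homog n f : homog n.+1 f -> homog n (dup f).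
Proof.
move=> fh u un; apply/eqP; apply/negPn/negP => /dup_supp [p [x [r [e _]]]].
rewrite fh ?eqxx //; apply: contra un => /eqP.
by rewrite e !size_cat /= !addnS => -[->].
Qed.

Lemma pth_dup i j p x r : isz x -> pth i j (p ++ x :: x :: r) -> pth i j (p ++ x :: r).
Proof.
move=> xz; elim: p i => [|y p IH] i /=.
  by case: x xz => [[k|k]|a] //= _ /andP[-> /andP[_ ->]].
by move=> /andP[-> /IH].
Qed.

(** On closed words, D0 misses the move w -> v* v whose two letters sit at the two
    ends of the word; this is the missing term. *)
Definition wrap_fun f u : K :=
  if u is inr b :: u' then eps b * (lquo (wl (tA b)) f * L (vl (star b))) u' else 0.
Definition wrap f : P := wrap_fun f.

Lemma dup_mul_letter f y : ~~ isz y -> dup (f * L y) = dup f * L y.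
Proof.
move=> yz; apply: seriesP => u; case/lastP: u => [|u x]; first by rewrite dup_nil rmul_nil.
rewrite dup_rcons !rmul_rcons [dup f u * _]mulrC -scalesE -dupZ.
rewrite (_ : (fun v => _) = (y == x)%:R *: f); last first.
  by apply: seriesP => v; rewrite rmul_rcons scalesE mulrC.
case: (y =P x) => [<-|_]; last by rewrite mulr0n !mulr0 addr0.
by rewrite (negbTE yz) mulr0n mul0r mulr0 addr0.
Qed.

Lemma wrap_dup f : wrap (dup f) = - dup (wrap f).
Proof.
apply: seriesP => -[|x u]; first by rewrite oppsE dup_nil oppr0.
rewrite oppsE dup_cons.
case: x => [[i|i]|b].
- by rewrite (_ : lquo _ _ = 0) // dup0 zeroE !mulr0 addr0 oppr0.
- by rewrite (_ : lquo _ _ = 0) // dup0 zeroE !mulr0 addr0 oppr0.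
rewrite mulr0n mul0r add0r -/(vl b) sgvE mul1r.
rewrite (_ : lquo (vl b) (wrap f) = eps b *: (lquo (wl (tA b)) f * L (vl (star b)))) //.
rewrite dupZ dup_mul_letter // scalesE /wrap /= -mulrN; congr (_ * _).
have -> : lquo (wl (tA b)) (dup f) = - dup (lquo (wl (tA b)) f); last by rewrite mulNr.
by apply: seriesP => v; rewrite /lquo dup_cons mulr0n mul0r add0r sgwE mulN1r.
Qed.

Lemma h0_v f b u : h0 f (vl b) u = eps b * (L (vl (star b)) * lquo (wl (sA b)) f) u.
Proof. by case: u => [|y u]; rewrite /= ?lmul_nil ?mulr0 // lmul_cons. Qed.

(** The number of blocks is a function of the cyclic word, on which the
    wrap-around move is a move like any other. *)
Lemma wt_wrap (g : nat -> K) f u :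
  wrap (wmul (fun v => g (cyclic_zruns v)) f) u = g (cyclic_zruns u) * wrap f u.
Proof.
case: u => [|[[i|i]|b] u]; rewrite /wrap /= ?mulr0 //.
rewrite mulrCA; congr (_ * _).
case/lastP: u => [|u x]; first by rewrite !rmul_nil mulr0.
rewrite !rmul_rcons mulrA; case: (_ =P x) => [<-|_]; last by rewrite !mulr0.
congr (_ * _); rewrite {1}/lquo {1}/wmul; congr (_ * _).
have wt := cyclic_zruns_wt g.
have := wt.2 [::] (star b) u; rewrite /= starK sA_star => <-.
by rewrite -[RHS]/(g (cyclic_zruns (rcons (vl b :: u) (vl (star b))))) cyclic_zruns_rot.
Qed.

End Cyclic.

(** * The quadratic differential *)
Section Quadratic.
Variables (K : fieldType) (I A : finType).
Variables (sA tA : A -> I) (star : A -> A) (eps : A -> K).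
Hypothesis starK : involutive star.
Hypothesis sA_star : forall a, sA (star a) = tA a.
Hypothesis tA_star : forall a, tA (star a) = sA a.
Hypothesis eps_star : forall a, eps (star a) = - eps a.
Hypothesis eps_sqr : forall a, eps a * eps a = 1.

Local Notation X := (letters I A).
Local Notation P := (series K X).
Local Notation zl := (@zl I A).
Local Notation wl := (@wl I A).
Local Notation vl := (@vl I A).
Local Notation src := (@src I A sA).
Local Notation tgt := (@tgt I A tA).
Local Notation st := (@st I A star).
Local Notation sd := (@sd I A).
Local Notation L := (@letter K X).
Local Notation ep := (@ep K I A eps).
Local Notation sg := (@sg K I A).
Local Notation sup := (@sup K I A sA tA).
Local Notation c0 := (@c0 K I A sA star eps).
Local Notation D0 := (der sg c0).
Implicit Types (f g h : P) (u p q r : seq X) (x y : X).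

Local Notation sup_letter := (@sup_letter K I A sA tA).
Local Notation sup0 := (@sup0 K I A sA tA).
(** The graded commutator of x with the sum of the letters z. *)
Definition adz x : P := L (zl (src x)) * L x - sg x *: (L x * L (zl (tgt x))).
(** The quadratic part of the structure of every simple collection:
    z -> z z, v -> z v - v z and w -> omega_at ([c2_z], [c2_v], [c2_w]). *)
Definition c2 x : P := c0 x + adz x.
Definition omega_at i : P := \sum_(x | src x == i) ep x *: (L x * L (st x)).
(** The constant symplectic form given by the pairing. *)
Definition omega : P := \sum_x ep x *: (L x * L (st x)).
Local Notation one := (fun _ : X => 1 : K).

Lemma twist_letter (tau : X -> K) x : twist tau (L x) = tau x *: L x.
Proof.
apply: seriesP => u; rewrite scalesE /twist /letter.
by case: (u =P _) => [->|_]; rewrite ?mulr0 // big_seq1.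
Qed.
Lemma twist_one f : twist one f = f.
Proof. by apply: seriesP => u; rewrite /twist big1 ?mul1r. Qed.

Lemma der_LL (tau : X -> K) (b : X -> P) x y :
  der tau b (L x * L y) = b x * L y + tau x *: (L x * b y).
Proof. by rewrite derM !der_letter twist_letter -scalerAl. Qed.

Lemma der_omega (tau : X -> K) (b : X -> P) : der tau b omega =
  \sum_x ep x *: (b x * L (st x) + tau x *: (L x * b (st x))).
Proof. by rewrite der_sum; apply: eq_bigr => x _; rewrite derZ der_LL. Qed.

(** A derivation kills omega if and only if these two terms cancel for all words,
    which is a rotation invariance. *)
Lemma der_omegaE (tau : X -> K) (b : X -> P) a c d :
  der tau b omega (a :: rcons c d) =
  - sg d * ep d * b (st d) (a :: c) + tau a * ep a * b (st a) (rcons c d).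
Proof.
rewrite der_omega sumsE.
under eq_bigr => x _ do rewrite scalesE addsE scalesE -rcons_cons rmul_rcons lmul_cons mulrDr.
rewrite big_split /= (bigD1 (st d)) //= (stK starK) eqxx mulr1 big1; last first.
  move=> x xd; rewrite (_ : (_ == _) = false) ?mulr0 //; apply/eqP => e.
  by move: xd; rewrite -e (stK starK) eqxx.
rewrite (ep_st eps_star) addr0; congr (_ + _).
rewrite (bigD1 a) //= eqxx mul1r big1 ?addr0; last first.
  by move=> x /negbTE; rewrite eq_sym => ->; rewrite mul0r !mulr0.
by rewrite mulrCA mulrA.
Qed.

Lemma ord_c2 x : ord 2 (c2 x).
Proof.
have o2 y z : ord 2 (L y * L z) by apply: (@ordM _ _ 1 1); exact: ord_letter.
apply: ordD; last by apply: ordB; [|apply: ordZ].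
case: x => [[i|i]|a] //=; first exact: ordN.
by apply: ord_sum => a _; apply: ordZ.
Qed.

Lemma homog_c2 x : homog 2 (c2 x).
Proof.
have o2 y z : homog 2 (L y * L z) by apply: (@homogM _ _ 1 1); exact: homog_letter.
apply: homogD; last by apply: homogD; [|apply: homogN; apply: homogZ].
case: x => [[i|i]|a] //=; first exact: homogN.
by apply: homog_sum => a _; apply: homogZ.
Qed.

Lemma sup_LL x y : tgt x = src y -> sup (src x) (tgt y) (sd x + sd y) (L x * L y).
Proof.
by move=> e; apply: (supM (sup_letter x)); rewrite e; apply: sup_letter.
Qed.

Lemma sup_c0 x : sup (src x) (tgt x) (sd x - 1) (c0 x).
Proof.
case: x => [[i|i]|a] /=; last exact: sup0.
  by apply: supN; apply: (@sup_LL (zl i) (zl i)).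
apply: sup_sum => a /eqP <-; apply: supZ.
rewrite -{2}(tA_star a).
by apply: (@sup_LL (vl a) (vl (star a))) => /=; rewrite sA_star.
Qed.

Lemma der_sup (tau : X -> K) (k : int) (D : X -> P) i j d f :
  (forall x, sup (src x) (tgt x) (sd x + k) (D x)) ->
  sup i j d f -> sup i j (d + k) (der tau D f).
Proof.
move=> Ds fs u; elim: u i d f fs => [|y u IH] i d f fs.
all: have Hs : sup i j (d + k) (\sum_x D x * lquo x f).
1,3: apply: sup_sum => x _; have [e|xi] := eqVneq (src x) i;
       last by rewrite (lquo_sup0 fs xi) mulr0; apply: sup0.
1,2: rewrite (_ : d + k = sd x + k + (d - sd x)); last (by lia);
     by apply: supM (sup_lquo fs); rewrite -e; apply: Ds.
  by rewrite /der /= addr0; apply: Hs.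
rewrite /der /= -/(der _ _ _ _) => nz.
have [e0|] := eqVneq ((\sum_x D x * lquo x f) (y :: u)) 0; last exact: Hs.
move: nz; rewrite e0 add0r mulf_eq0 negb_or => /andP[_ nz].
have [yi|yi] := eqVneq (src y) i; last first.
  by move: nz; rewrite (lquo_sup0 fs yi) der0 zeroE eqxx.
have [p] := IH _ _ _ (sup_lquo (x := y) fs) nz.
by rewrite sdw_cons => ->; rewrite p; split=> //; lia.
Qed.

Lemma sup_adz x : sup (src x) (tgt x) (sd x - 1) (adz x).
Proof.
apply: supB; last apply: supZ.
  by rewrite addrC; apply: (@sup_LL (zl (src x)) x).
by apply: (@sup_LL x (zl (tgt x))).
Qed.

Lemma sup_c2 x : sup (src x) (tgt x) (sd x - 1) (c2 x).
Proof. by apply: supD; [exact: sup_c0|exact: sup_adz]. Qed.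

Lemma sgz_sub (d e : int) : (-1 : K) ^ (d - e) = (-1) ^ d * (-1) ^ e.
Proof. by rewrite sgzD sgzN. Qed.

(** The commutators telescope along a path: only the two outermost ones are
    left. *)
Lemma der_adz i j d f : sup i j d f ->
  der sg adz f = L (zl i) * f - (-1) ^ d *: (f * L (zl j)).
Proof.
move=> fs; apply: seriesP => u; rewrite subsE scalesE.
elim: u f i d fs => [|y u IH] f i d fs.
  rewrite lmul_nil rmul_nil mulr0 subr0 /der /= addr0 sumsE big1 // => x _.
  by rewrite muls_nil /adz subsE scalesE lmul_nil rmul_nil mulr0 subr0 mul0r.
rewrite /der -/der_rec [der_rec _ _ _ _]/= -/(der sg adz _ u).
rewrite (IH _ _ _ (sup_lquo (x:=y) fs)) sgz_sub.
have -> : \sum_x adz x * lquo x f = L (zl i) * (f - f [::] *: 1) -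
   \sum_x sg x *: (L x * (L (zl (tgt x)) * lquo x f)).
  rewrite {2}(seriesE f) [f [::] *: 1 + _]addrC addrK mulr_sumr -sumrB.
  apply: eq_bigr => x _; rewrite mulrBl -scalerAl -!mulrA; congr (_ - _).
  have [->|xi] := eqVneq (src x) i; first by [].
  by rewrite (lquo_sup0 fs xi) !mulr0.
rewrite subsE sumsE (bigD1 y) //= scalesE [(L y * _) _]lmul_cons eqxx mul1r.
rewrite big1 ?addr0; last first.
  move=> x; rewrite scalesE lmul_cons eq_sym => /negbTE ->.
  by rewrite mul0r mulr0.
rewrite mulrBr -scalerAr mulr1 subsE scalesE [(f * _) (y :: u)]muls_cons.
have e : f [::] * L (zl i) (y :: u) = (-1) ^ d * (f [::] * L (zl j) (y :: u)).
  have [->|/fs [/= /eqP -> ]] := eqVneq (f [::]) 0; first by rewrite !mul0r mulr0.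
  by rewrite sdw_nil => <-; rewrite expr0z mul1r.
have s2 := sg_sqr K y; rewrite e.
rewrite mulrBr !mulrA.
have -> : sg y * (-1) ^ d * sg y = (-1) ^ d by rewrite mulrAC s2 mul1r.
ring.
Qed.

Lemma der_c2 i j d f : sup i j d f ->
  der sg c2 f = D0 f + L (zl i) * f - (-1) ^ d *: (f * L (zl j)).
Proof. by move=> fs; rewrite derDl (der_adz fs) addrA. Qed.

Lemma omega_sum : omega = \sum_i omega_at i.
Proof.
rewrite /omega /omega_at (exchange_big_dep xpredT) //=; apply: eq_bigr => x _.
by rewrite (big_pred1 (src x)) // => i; rewrite /= eq_sym.
Qed.

Lemma omega_atE i : omega_at i = L (zl i) * L (wl i) + L (wl i) * L (zl i) +
  \sum_(a | sA a == i) eps a *: (L (vl a) * L (vl (star a))).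
Proof.
rewrite /omega_at big_mkcond !big_sumType /= -!big_mkcond /=.
by rewrite !big_pred1_eq !scale1r.
Qed.

Lemma sup_omega_at i : sup i i 0 (omega_at i).
Proof.
apply: sup_sum => x /eqP <-; apply: supZ.
have := @sup_LL x (st x); rewrite (src_st sA_star) (tgt_st tA_star) sd_st subrr; exact.
Qed.

Lemma c2_w i : c2 (wl i) = omega_at i.
Proof.
rewrite omega_atE /c2 /adz /= sgwE scaleN1r opprK; exact: addrC.
Qed.

Lemma c2_z i : c2 (zl i) = L (zl i) * L (zl i).
Proof. rewrite /c2 /adz /= sgzE scaleN1r opprK; exact: addKr. Qed.

Lemma c2_v a : c2 (vl a) = L (zl (sA a)) * L (vl a) - L (vl a) * L (zl (tA a)).
Proof. by rewrite /c2 /adz /= sgvE scale1r add0r. Qed.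

Lemma D0_V i : D0 (\sum_(a | sA a == i) eps a *: (L (vl a) * L (vl (star a)))) = 0.
Proof.
rewrite der_sum big1 // => a _; rewrite derZ der_LL /= mul0r mulr0 scaler0 addr0.
by rewrite scaler0.
Qed.

Lemma c2_omega_at i : der sg c2 (omega_at i) = 0.
Proof.
rewrite (der_c2 (sup_omega_at (i:=i))) expr0z scale1r omega_atE.
rewrite !derD D0_V !der_LL /= -/(zl i) -/(wl i) sgzE sgwE !scaleN1r.
set V := \sum_(a | _) _; set z := L (zl i); set w := L (wl i).
rewrite !(mulrDl, mulrDr, mulNr, mulrN) !mulrA.
by pointwise.
Qed.

Lemma c2_omega : der sg c2 omega = 0.
Proof. by rewrite omega_sum der_sum big1 // => i _; apply: c2_omega_at. Qed.

Lemma c2_sqr x : der sg c2 (c2 x) = 0.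
Proof.
case: x => [[i|i]|a].
- rewrite -/(zl i) c2_z der_LL c2_z sgzE scaleN1r mulrA; exact: subrr.
- by rewrite -/(wl i) c2_w c2_omega_at.
rewrite -/(vl a) c2_v derB !der_LL c2_v !c2_z sgvE sgzE scaleN1r scale1r.
set s := L (zl (sA a)); set t := L (zl (tA a)); set v := L (vl a).
rewrite !(mulrDl, mulrDr, mulNr, mulrN) !mulrA.
by pointwise.
Qed.

(** The graded Jacobi identity for [c2, d] acting on omega. *)
Lemma c2_commutator (b d : X -> P) :
  (forall x, twist sg (d x) = sg x *: d x) ->
  (forall x, b x = der sg c2 (d x) - der one d (c2 x)) ->
  der sg b omega = der sg c2 (der one d omega) - der one d (der sg c2 omega).
Proof.
move=> dt bE; rewrite !der_sum -sumrB; apply: eq_bigr => x _.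
rewrite !derZ -scalerBr; congr (_ *: _).
rewrite !der_LL !derD !derZ !derM !der_letter !twist_one !twist_letter dt !bE.
rewrite !scale1r -!scalerAl !(mulrDl, mulrDr, mulNr, mulrN).
rewrite !scalerDr !scalerN.
by pointwise.
Qed.

Lemma homog2E f : homog 2 f ->
  f = \sum_x \sum_y f [:: x; y] *: (L x * L y).
Proof.
move=> fh; apply: seriesP => u; rewrite sumsE.
under eq_bigr => x _ do rewrite sumsE.
have [su|su] := eqVneq (size u) 2; last first.
  rewrite fh // big1 // => x _; rewrite big1 // => y _; rewrite scalesE.
  by rewrite (@homogM _ _ 1 1) ?mulr0 //; exact: homog_letter.
case: u su => [|a [|b [|//]]] // _.
have E x y : (L x * L y) [:: a; b] = (a == x)%:R * (b == y)%:R.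
  by rewrite lmul_cons /letter eqseq_cons andbT.
rewrite (bigD1 a) //= (bigD1 b) //= scalesE E !eqxx !mulr1 !big1 ?addr0 //.
  move=> x xa; rewrite big1 // => y _; rewrite scalesE E eq_sym (negbTE xa).
  by rewrite mul0r mulr0.
by move=> y yb; rewrite scalesE E [b == y]eq_sym (negbTE yb) !mulr0.
Qed.

Lemma homog_omega : homog 2 omega.
Proof.
apply: homog_sum => x _; apply: homogZ.
by apply: (@homogM _ _ 1 1); exact: homog_letter.
Qed.

End Quadratic.

Arguments sup_c2 [K I A sA tA star] eps sA_star tA_star x.
Arguments sup_c0 [K I A sA tA star] eps sA_star tA_star x.

(** * Exactness of closed symplectic derivations *)
Section KeyLemma.
Variables (K : fieldType) (I A : finType).
Variables (sA tA : A -> I) (star : A -> A) (eps : A -> K).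
Hypothesis starK : involutive star.
Hypothesis sA_star : forall a, sA (star a) = tA a.
Hypothesis tA_star : forall a, tA (star a) = sA a.
Hypothesis eps_star : forall a, eps (star a) = - eps a.
Hypothesis eps_sqr : forall a, eps a * eps a = 1.

Local Notation X := (letters I A).
Local Notation P := (series K X).
Local Notation zl := (@zl I A).
Local Notation wl := (@wl I A).
Local Notation vl := (@vl I A).
Local Notation src := (@src I A sA).
Local Notation tgt := (@tgt I A tA).
Local Notation st := (@st I A star).
Local Notation isz := (@isz I A).
Local Notation sd := (@sd I A).
Local Notation sdw := (@sdw I A).
Local Notation pth := (@pth I A sA tA).
Local Notation L := (@letter K X).
Local Notation ep := (@ep K I A eps).
Local Notation sg := (@sg K I A).
Local Notation sup := (@sup K I A sA tA).
Local Notation c0 := (@c0 K I A sA star eps).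
Local Notation h0 := (@h0 K I A sA star eps).
Local Notation D0 := (der sg c0).
Implicit Types (f g h : P) (u p q r : seq X) (x y : X).

Local Notation wrap := (@wrap K I A tA star eps).
Local Notation sup0 := (@sup0 K I A sA tA).
Local Notation c2 := (@c2 K I A sA tA star eps).
Local Notation omega := (@omega K I A star eps).
Local Notation one := (fun _ : X => 1 : K).
Hypothesis charK0 : [pchar K] =i pred0.

Lemma natr_neq0 n : (0 < n)%N -> (n%:R : K) != 0.
Proof. by move=> n0; rewrite ((pcharf0P K).1 charK0) -lt0n. Qed.

(** The Hamiltonian of the odd derivation e, as a function on words: preserving
    omega is equivalent to its invariance under rotation. *)
Definition cyclic_form (e : X -> P) : P :=
  (fun u => if u is y :: u' then sg y * ep y * e (st y) u' else 0).

Lemma cyclic_form_lquo e y : lquo y (cyclic_form e) = (sg y * ep y) *: e (st y).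
Proof. by []. Qed.

Lemma cyclic_form_homog n e : (forall x, homog n (e x)) -> homog n.+1 (cyclic_form e).
Proof. by move=> eh [|y u] // un; rewrite /cyclic_form eh ?mulr0. Qed.

Lemma cyclic_form_rot e : der sg e omega = 0 ->
  forall y v, cyclic_form e (y :: v) = cyclic_form e (rcons v y).
Proof.
move=> eo y [|a c] //; have := congr1 (fun f : P => f (a :: rcons c y)) eo.
rewrite (der_omegaE starK eps_star) zeroE !mulNr => /eqP; rewrite addrC subr_eq0.
by move=> /eqP.
Qed.

Lemma cyclic_form_supp e : (forall x, sup (src x) (tgt x) (sd x - 1) (e x)) ->
  forall u, cyclic_form e u != 0 -> (exists i, pth i i u) /\ sdw u = -1.
Proof.
move=> es [|y u] /=; first by rewrite eqxx.
rewrite mulf_eq0 negb_or => /andP[_ /es].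
rewrite (src_st sA_star) (tgt_st tA_star) sd_st sdw_cons => -[p ->].
by split; [exists (src y); rewrite eqxx|lia].
Qed.

Section Equation.
Variable e : X -> P.
Hypothesis es : forall x, sup (src x) (tgt x) (sd x - 1) (e x).
Hypothesis ec : forall x, der sg c2 (e x) + der sg e (c2 x) = 0.

(** Here and in [D0_ev], the vanishing of the bracket with c2 is spelled out at
    one letter; the products of e x with letters z, which come from both terms
    of the bracket, cancel. *)
Lemma D0_ez i : D0 (e (zl i)) = 0.
Proof.
have := ec (zl i); rewrite (der_c2 _ _ (@es _)) c2_z der_LL /= sgzE.
rewrite (_ : (-1 : int) - 1 = -2) // sgzN (_ : (-1 : K) ^ 2 = 1); last by rewrite -exprnP sqrrN expr1n.
rewrite !scale1r scaleN1r => <-; by pointwise.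
Qed.

Lemma D0_ev a : D0 (e (vl a)) =
  L (vl a) * e (zl (tA a)) - e (zl (sA a)) * L (vl a).
Proof.
have := ec (vl a); rewrite (der_c2 _ _ (@es _)) c2_v derB !der_LL /= sgvE sgzE.
rewrite (_ : (0 : int) - 1 = -1) // sgzN expr1z !scaleN1r scale1r => /eqP.
rewrite addr_eq0 => /eqP /(canRL (addrK _)) /(canRL (addrK _)) ->.
by pointwise.
Qed.

(** The equations [D0_ez] and [D0_ev] combine into one equation for the
    Hamiltonian.  The words that start with z would correspond to the
    bracket at the letter w. *)
Lemma cyclic_form_closed x u : ~~ isz x -> D0 (cyclic_form e) (x :: u) = wrap (cyclic_form e) (x :: u).
Proof.
case: x => [[i|i]|b] // _; rewrite D0_cons cyclic_form_lquo derZ scalesE.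
  by rewrite /= D0_ez zeroE !mulr0 addr0.
rewrite -/(vl b) h0_v // !cyclic_form_lquo sgvE !mul1r.
rewrite -/(st (wl (sA b))) /wrap /= cyclic_form_lquo /= sgwE mulr1 -!scalerAr -!scalerAl !scaleN1r.
rewrite D0_ev sA_star tA_star !(subsE, oppsE); ring.
Qed.

End Equation.

(** The homotopy applied to the Hamiltonian, divided beforehand by the number of
    blocks of z's that [contraction] will produce. *)
Definition primitive (e : X -> P) : P :=
  - dup (wmul (fun u => (cyclic_zruns u)%:R^-1) (cyclic_form e)).

(** The derivation with Hamiltonian H: the value at y is the derivative of H by
    the letter dual to y. *)
Definition ham_field (H : P) (y : X) : P := ep (st y) *: lquo (st y) H.

Lemma ep_neq0 x : ep x != 0.
Proof. by apply/eqP => e; have := ep_sqr eps_sqr x; rewrite e mul0r => /eqP; rewrite eq_sym oner_eq0. Qed.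

Lemma lquo_ham H x : lquo x H = ep x *: ham_field H (st x).
Proof. by rewrite /ham_field (stK starK) scalerA (ep_sqr eps_sqr) scale1r. Qed.

Lemma ham_field_sup (H : P) :
  (forall u, H u != 0 -> (exists i, pth i i u) /\ sdw u = 0) ->
  forall y, sup (src y) (tgt y) (sd y) (ham_field H y).
Proof.
move=> Hs y u; rewrite /ham_field scalesE mulf_eq0 negb_or => /andP[_ /Hs [[i]]].
rewrite [_ (_ :: _)]/= (src_st sA_star) (tgt_st tA_star) sdw_cons sd_st.
by move=> /andP[/eqP <- ->] /eqP; rewrite addrC subr_eq0 => /eqP.
Qed.

(** The even counterpart of [cyclic_form_rot]: the two terms of [der_omegaE] cancel when H is
    invariant under signed rotation. *)
Lemma ham_field_omega n (H : P) : homog n.+2 H ->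
  (forall y v, H (y :: v) = sg y * H (rcons v y)) ->
  der one (ham_field H) omega = 0.
Proof.
move=> Hh Hr; have d0 y : ham_field H y [::] = 0.
  by rewrite /ham_field scalesE /lquo Hh ?mulr0.
apply: seriesP => -[|a u].
  rewrite der_omega sumsE big1 // => x _.
  by rewrite scalesE addsE scalesE rmul_nil lmul_nil mulr0 addr0 mulr0.
case/lastP: u => [|c b].
  rewrite der_omega sumsE big1 // => x _.
  by rewrite scalesE addsE scalesE !mulsE !big_ord_recl !big_ord0 /= !d0 /letter /= !(mulr0, mul0r, addr0).
rewrite (der_omegaE starK eps_star) zeroE /ham_field !scalesE /lquo !(stK starK) !mul1r.
rewrite !mulrA -[- sg b * ep b * ep b]mulrA !(ep_sqr eps_sqr) mulr1 mul1r.
by rewrite mulNr Hr mulrA sg_sqr mul1r rcons_cons addNr.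
Qed.

Section Primitive.
Variables (n : nat) (e : X -> P).
Hypothesis eh : forall x, homog n.+2 (e x).
Hypothesis es : forall x, sup (src x) (tgt x) (sd x - 1) (e x).
Hypothesis eo : der sg e omega = 0.
Hypothesis ec : forall x, der sg c2 (e x) + der sg e (c2 x) = 0.

Local Notation T := (cyclic_form e).
Local Notation H := (primitive e).

(** By [contraction], D0 H is the form itself plus dup applied to D0 of the
    weighted form.  By closedness the latter is a wrap-around term, and it
    cancels the one of H. *)
Lemma primitive_eq x u : ~~ isz x ->
  D0 H (x :: u) - wrap H (x :: u) = T (x :: u).
Proof.
move=> xz; rewrite /primitive derN oppsE.
have RN f : wrap (- f) = - wrap f.
  apply: seriesP => -[|[[i|i]|b] v]; rewrite oppsE /wrap /= ?oppr0 //.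
  by rewrite lquoN mulNr oppsE mulrN.
rewrite RN wrap_dup // opprK.
set G := wmul _ _.
have -> : D0 (dup G) (x :: u) = - dup (D0 G) (x :: u) - (zruns (x :: u))%:R * G (x :: u).
  by rewrite addrC; apply: (canRL (addrK _)); apply: contraction.
have F0 v y : ~~ isz y -> D0 G (y :: v) = wrap G (y :: v).
  move=> yz; rewrite (D0_weight _ _ _ (cyclic_zruns_wt sA star (fun n => n%:R^-1))).
  rewrite (wt_wrap _ starK sA_star (fun n => n%:R^-1)) cyclic_form_closed //.
have -> : dup (D0 G) (x :: u) = dup (wrap G) (x :: u).
  rewrite !dup_cons (negbTE xz) mulr0n !mul0r !add0r; congr (_ * dup _ u).
  by apply: seriesP => v; apply: F0.
rewrite opprD !opprK addrAC subrr add0r.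
rewrite -cyclic_zruns_lin // /G /wmul mulrA.
have [->|nz] := eqVneq (T (x :: u)) 0; first by rewrite mulr0.
rewrite divff ?mul1r // natr_neq0 // cyclic_zruns_lin // lt0n.
apply/eqP => /zruns_eq0 /nz_sdw.
by have [_ ->] := cyclic_form_supp es nz.
Qed.

Lemma primitive_homog : homog n.+2 H.
Proof.
apply: homogN; apply: dup_homog => u un; rewrite /wmul.
by rewrite (cyclic_form_homog eh) ?mulr0.
Qed.

Lemma primitive_rot y v : H (y :: v) = sg y * H (rcons v y).
Proof.
rewrite /primitive !oppsE mulrN; congr (- _); apply: dup_rot => {y v}.
  by move=> y v; rewrite /wmul (cyclic_form_rot eo) cyclic_zruns_rot.
move=> v; rewrite /wmul mulf_eq0 negb_or => /andP[_ nz].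
by have [] := cyclic_form_supp es nz.
Qed.

Lemma primitive_supp u : H u != 0 -> (exists i, pth i i u) /\ sdw u = 0.
Proof.
rewrite /primitive oppsE oppr_eq0 => /dup_supp [p [x [r [-> xz]]]].
rewrite /wmul mulf_eq0 negb_or => /andP[_ /(cyclic_form_supp es) [[i ip] ds]].
split; first by exists i; apply: pth_dup ip.
move: ds; rewrite !sdw_cat !sdw_cons; case: x xz {ip} => [[k|k]|a] //= _; lia.
Qed.

Local Notation d := (ham_field H).

Lemma field_omega : der one d omega = 0.
Proof. exact: ham_field_omega primitive_homog primitive_rot. Qed.

Lemma field_sup y : sup (src y) (tgt y) (sd y) (d y).
Proof. exact: ham_field_sup primitive_supp y. Qed.

Lemma field_homog y : homog n.+1 (d y).
Proof. by apply: homogZ; apply: homog_lquo; exact: primitive_homog. Qed.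

Let b x := der sg c2 (d x) - der one d (c2 x).

Let b_z i : b (zl i) = e (zl i).
Proof.
rewrite /b (der_c2 _ _ (@field_sup _)) c2_z der_LL /= sgzN expr1z scaleN1r scale1r opprK.
have -> : D0 (d (zl i)) = e (zl i); last by pointwise.
apply: seriesP => u.
have := @primitive_eq (wl i) u isT.
rewrite D0_cons sgwE [h0 _ _ _]/= add0r mulN1r /wrap /= subr0 sgwE mulr1 mulN1r => /oppr_inj <-.
by rewrite /ham_field /= scale1r.
Qed.

Let b_v a : b (vl a) = e (vl a).
Proof.
rewrite /b (der_c2 _ _ (@field_sup _)) c2_v derB !der_LL /= expr0z !scale1r.
apply: seriesP => u; pose c := star a.
have := @primitive_eq (vl c) u isT.
rewrite D0_cons sgvE mul1r h0_v !lquo_ham /= /c starK scale1r derZ.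
rewrite !lquo_ham /= scale1r sA_star tA_star scalesE sgvE mul1r => /eqP.
have en : eps (star a) != 0 := ep_neq0 (vl (star a)).
rewrite -mulrDr -mulrBr -subr_eq0 -mulrBr mulf_eq0 (negbTE en) subr_eq0 /=.
by move=> /eqP <-; rewrite !(addsE, subsE, oppsE); ring.
Qed.

(** On the letters z and v this is [primitive_eq].  On w it comes for free: the
    difference preserves omega, so its cyclic form is determined, by rotation,
    by its values on words that contain a letter other than z, where it is
    known to vanish. *)
Lemma field_commutator x : der sg c2 (d x) - der one d (c2 x) = e x.
Proof.
rewrite -/(b x).
pose b' y := e y - b y.
suff b0 : b' x = 0 by apply/eqP; rewrite eq_sym -subr_eq0 -/(b' x) b0.
have b'o : der sg b' omega = 0.
  have -> : der sg b' omega = der sg e omega - der sg b omega.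
    by rewrite /b' derDl derNl.
  have dt y : twist sg (d y) = sg y *: d y by rewrite (twist_sup (@field_sup y)).
  have bo := @c2_commutator _ _ _ sA tA star eps b d dt (fun=> erefl).
  by rewrite eo bo field_omega (c2_omega eps sA_star tA_star) !der0 !subr0.
have b'z i : b' (zl i) = 0 by rewrite /b' b_z subrr.
have b'v a : b' (vl a) = 0 by rewrite /b' b_v subrr.
case: x => [[i|i]|a]; [exact: b'z| |exact: b'v].
have bo : ord 1 (b' (wl i)).
  apply: ordB; first by apply: ordW (homog_ord (eh _)).
  apply: ordB.
    apply: (ordW (m:=1)) (@der_ord _ _ 1 sg _ n.+1 _ _ _) => //.
      by move=> y; apply: ord_c2.
    exact: homog_ord (field_homog _).
  apply: (ordW (m:=1)) (@der_ord _ _ 0 one _ 2 _ _ _) => //; last exact: ord_c2.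
  by move=> y; apply: ordW (homog_ord (field_homog y)).
have Tr := cyclic_form_rot b'o.
have T0 x u : ~~ isz x -> cyclic_form b' (x :: u) = 0.
  by case: x => [[j|j]|a] // _; rewrite /= ?b'z ?b'v zeroE mulr0.
have Tcat p q : cyclic_form b' (p ++ q) = cyclic_form b' (q ++ p).
  elim: p q => [|y p IH] q; first by rewrite cats0.
  by rewrite cat_cons Tr -cats1 -catA IH -catA.
have bsup y : sup (src y) (tgt y) (sd y - 1) (b' y).
  case: y => [[j|j]|a]; rewrite -?/(zl j) -?/(wl j) -?/(vl a).
  - by rewrite b'z; apply: sup0.
  - apply: supB; first exact: (@es _).
    have ds := @field_sup (wl j); have cs := sup_c2 eps sA_star tA_star.
    apply: supB; first exact: der_sup cs ds.
    rewrite -[sd (wl j) - 1]addr0.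
    apply: (@der_sup K I A sA tA one 0 d _ _ _ _ _ (cs (wl j))) => y.
    by rewrite addr0; apply: field_sup.
  - by rewrite b'v; apply: sup0.
apply: seriesP => u; suff: cyclic_form b' (zl i :: u) = 0.
  by rewrite /= sgzE mulr1 mulN1r => /eqP; rewrite oppr_eq0 => /eqP.
have [zz|] := boolP (all isz (zl i :: u)); last first.
  (* rotate a letter other than z to the front *)
  move=> /allPn [y yu yz].
  have [p [r ->]] : exists p r, zl i :: u = p ++ y :: r.
    by case/splitPr: yu => p r; exists p, r.
  by rewrite Tcat cat_cons; apply: T0.
have [//|nz] := eqVneq (cyclic_form b' (zl i :: u)) 0.
have [_] := cyclic_form_supp bsup nz.
(* a word in z's of degree -1 has one letter, too short for the order of b' *)
have -> : sdw (zl i :: u) = - (size (zl i :: u))%:Z.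
  elim: (zl i :: u) zz => [|y v IH] /=; first by rewrite sdw_nil.
  by case: y => [[j|j]|a] //= /IH; rewrite sdw_cons => -> /=; lia.
case: u nz {zz} => [|y u] nz; last by rewrite /=; lia.
by move: nz; rewrite /= bo // mulr0 eqxx.
Qed.

End Primitive.

(** The obstruction to conjugating two structures vanishes in every length at
    least 2: an odd closed derivation preserving omega is the bracket of c2 with
    an even derivation preserving omega. *)
Lemma key_lemma n (e : X -> P) :
  (forall x, homog n.+2 (e x)) ->
  (forall x, sup (src x) (tgt x) (sd x - 1) (e x)) ->
  der sg e omega = 0 ->
  (forall x, der sg c2 (e x) + der sg e (c2 x) = 0) ->
  exists d : X -> P, [/\ forall x, homog n.+1 (d x),
    forall x, sup (src x) (tgt x) (sd x) (d x),
    der one d omega = 0 &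
    forall x, der sg c2 (d x) - der one d (c2 x) = e x].
Proof.
move=> eh es eo ec; exists (ham_field (primitive e)); split.
- exact: field_homog.
- by move=> x; apply: field_sup.
- exact: field_omega.
- exact: field_commutator.
Qed.
End KeyLemma.

Arguments ham_field_sup [K I A sA tA star] eps sA_star tA_star [H] _ y.

(** * A formal Darboux lemma *)
Section Darboux.
Variables (K : fieldType) (I A : finType).
Variables (sA tA : A -> I) (star : A -> A) (eps : A -> K).
Hypothesis starK : involutive star.
Hypothesis sA_star : forall a, sA (star a) = tA a.
Hypothesis tA_star : forall a, tA (star a) = sA a.
Hypothesis eps_star : forall a, eps (star a) = - eps a.
Hypothesis eps_sqr : forall a, eps a * eps a = 1.

Local Notation X := (letters I A).
Local Notation P := (series K X).
Local Notation src := (@src I A sA).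
Local Notation tgt := (@tgt I A tA).
Local Notation st := (@st I A star).
Local Notation sd := (@sd I A).
Local Notation sdw := (@sdw I A).
Local Notation pth := (@pth I A sA tA).
Local Notation ep := (@ep K I A eps).
Local Notation sg := (@sg K I A).
Local Notation sgw := (@sgw K I A).
Local Notation sup := (@sup K I A sA tA).
Implicit Types (f g h : P) (u p q r : seq X) (x y : X).

Local Notation omega := (@omega K I A star eps).
Local Notation one := (fun _ : X => 1 : K).
Hypothesis charK0 : [pchar K] =i pred0.
Local Notation ham_field := (@ham_field K I A star eps).

(** Rotation by one letter with its Koszul sign. *)
Definition spin f : P := fun u => if u is b :: v then sg b * f (rcons v b) else 0.

Lemma spinD f g : spin (f + g) = spin f + spin g.
Proof. by apply: seriesP => -[|b v]; rewrite addsE /= ?addr0 // mulrDr. Qed.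
Lemma spinZ k f : spin (k *: f) = k *: spin f.
Proof. by apply: seriesP => -[|b v]; rewrite scalesE /= ?mulr0 // mulrCA. Qed.
Lemma spin_sum (J : Type) (r : seq J) (Q : pred J) (F : J -> P) :
  spin (\sum_(i <- r | Q i) F i) = \sum_(i <- r | Q i) spin (F i).
Proof.
elim/big_rec2: _ => [|i g f _ <-]; last exact: spinD.
by have := spinZ 0 0; rewrite !scale0r.
Qed.

Lemma iter_spin k f u : (k <= size u)%N ->
  iter k spin f u = sgw (take k u) * f (rot k u).
Proof.
elim: k f => [|k IH] f ku; first by rewrite take0 rot0 sgw_nil mul1r.
rewrite iterSr IH; last exact: ltnW.
have x0 : X by case: u ku {IH} => [//|x u' _]; exact: x.
rewrite (rotS ku) (take_nth x0 ku) sgw_rcons -mulrA; congr (_ * _).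
have -> : rot k u = nth x0 u k :: (drop k.+1 u ++ take k u) by rewrite /rot (drop_nth x0 ku).
by rewrite rot1_cons.
Qed.

Definition closed_word u : Prop := (exists i, pth i i u) /\ sdw u = 0.
Definition csupp f : Prop := forall u, f u != 0 -> closed_word u.

Lemma spin_csupp f : csupp f -> csupp (spin f).
Proof.
move=> fc [|b v]; rewrite /spin ?eqxx // mulf_eq0 negb_or => /andP[_ /fc [[i]]].
rewrite pth_rcons /closed_word sdw_rcons sdw_cons addrC => /andP[p /eqP e] ->.
by split=> //; exists (src b); rewrite /= eqxx e.
Qed.
Lemma spin_homog n f : homog n f -> homog n (spin f).
Proof. by move=> fh [|b v] // vn; rewrite /= fh ?mulr0 // size_rcons. Qed.
Lemma csuppD f g : csupp f -> csupp g -> csupp (f + g).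
Proof.
move=> fc gc u; rewrite addsE; have [->|/fc //] := eqVneq (f u) 0.
by rewrite add0r => /gc.
Qed.
Lemma csuppZ k f : csupp f -> csupp (k *: f).
Proof. by move=> fc u; rewrite scalesE mulf_eq0 negb_or => /andP[_ /fc]. Qed.
Lemma csupp_sum (J : Type) (r : seq J) (Q : pred J) (F : J -> P) :
  (forall i, Q i -> csupp (F i)) -> csupp (\sum_(i <- r | Q i) F i).
Proof.
by move=> Fc; elim/big_ind: _ => // *; [move=> u; rewrite eqxx|exact: csuppD].
Qed.

Lemma iter_spin_full m f : csupp f -> homog m f -> iter m spin f = f.
Proof.
move=> fc fh; have ih k : homog m (iter k spin f).
  by elim: k => //= k; apply: spin_homog.
have ic k : csupp (iter k spin f) by elim: k => //= k; apply: spin_csupp.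
apply: seriesP => u; have [um|um] := eqVneq (size u) m; last by rewrite ih ?fh.
rewrite -{1}um iter_spin // take_size rot_size.
have [->|/fc [_ u0]] := eqVneq (f u) 0; first by rewrite mulr0.
by rewrite /sgw u0 expr0z mul1r.
Qed.

Lemma sum_by_parts (b : nat -> P) m :
  \sum_(k < m) k.+1%:R *: (b k.+1 - b k) = m%:R *: b m - \sum_(k < m) b k.
Proof.
elim: m => [|m IH]; first by rewrite !big_ord0 scale0r subr0.
rewrite !big_ord_recr /= IH -[m.+1]addn1 natrD !(scalerBr, scalerDl) !scale1r.
rewrite addn1; by pointwise.
Qed.

(** If the rotations of g sum to zero, then g is a coboundary for the cyclic
    group; the potential with coefficients 1, .., m + 1 is found by summation by
    parts, and dividing by the order of the group needs characteristic zero. *)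
Lemma spin_potential m g : csupp g -> homog m.+1 g ->
  \sum_(k < m.+1) iter k spin g = 0 ->
  exists H, [/\ csupp H, homog m.+1 H & spin H - H = spin g].
Proof.
move=> gc gh g0.
exists (m.+1%:R^-1 *: \sum_(k < m.+1) k.+1%:R *: iter k.+1 spin g); split.
- apply/csuppZ/csupp_sum => k _; apply: csuppZ.
  by elim: (k : nat).+1 => //= l; apply: spin_csupp.
- apply/homogZ/homog_sum => k _; apply: homogZ.
  by elim: (k : nat).+1 => //= l; apply: spin_homog.
rewrite spinZ spin_sum -scalerBr -sumrB.
under eq_bigr => k _ do rewrite spinZ -scalerBr -iterS.
rewrite (sum_by_parts (fun k => iter k.+1 spin g)) iterS (iter_spin_full gc gh).
rewrite scalerBr scalerA mulVf ?natr_neq0 // scale1r.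
under eq_bigr => k _ do rewrite iterS.
rewrite -spin_sum g0; have := spinZ 0 0; rewrite !scale0r => ->.
by rewrite scaler0 subr0.
Qed.

(** Hamiltonian derivations change omega exactly by the coboundaries of
    [spin_potential]. *)
Lemma darboux m g : csupp g -> homog m.+2 g ->
  \sum_(k < m.+2) iter k spin g = 0 ->
  exists d : X -> P, [/\ forall x, homog m.+1 (d x),
    forall x, sup (src x) (tgt x) (sd x) (d x) & der one d omega = g].
Proof.
move=> gc gh /(spin_potential gc gh) [H [Hc Hh HE]].
exists (ham_field H); split.
- by move=> x; apply: homogZ; apply: homog_lquo.
- exact: ham_field_sup.
have d0 y : ham_field H y [::] = 0.
  by rewrite /ham_field scalesE /lquo Hh ?mulr0.
apply: seriesP => -[|a u].
  rewrite gh // der_omega sumsE big1 // => x _.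
  by rewrite scalesE addsE scalesE rmul_nil lmul_nil mulr0 addr0 mulr0.
case/lastP: u => [|c b].
  rewrite gh // der_omega sumsE big1 // => x _.
  by rewrite scalesE addsE scalesE !mulsE !big_ord_recl !big_ord0 /= !d0 /letter /= !(mulr0, mul0r, addr0).
rewrite (der_omegaE starK eps_star) /ham_field !scalesE /lquo !(stK starK) !mul1r.
rewrite !mulrA -[- sg b * ep b * ep b]mulrA !(ep_sqr eps_sqr) mulr1 mul1r.
have := congr1 (fun f : P => sg b * f (b :: a :: c)) HE.
rewrite subsE /spin mulrBr !mulrA sg_sqr !mul1r rcons_cons => <-.
by rewrite addrC mulNr.
Qed.

(** Exchanging the two factors of phi x * phi (st x) is a rotation, and it
    reverses the sign because the pairing is antisymmetric in shifted degrees. *)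
Lemma spin_omega (phi : X -> P) m u :
  (forall x, sup (src x) (tgt x) (sd x) (phi x)) ->
  (forall x, phi x [::] = 0) -> size u = m -> sgw u = 1 ->
  \sum_(k < m) iter k spin (\sum_x ep x *: (phi x * phi (st x))) u = 0.
Proof.
move=> ps p0 um su.
pose G x j : P := fun v => phi x (take j v) * phi (st x) (drop j v).
pose N f : K := \sum_(k < m) iter k spin f u.
have NE f : N f = \sum_(k < m) sgw (take k u) * f (rot k u).
  by apply: eq_bigr => k _; rewrite iter_spin // um ltnW.
have Next f g : (forall v, size v = m -> f v = g v) -> N f = N g.
  by move=> fg; rewrite !NE; apply: eq_bigr => k _; rewrite fg // size_rot.
have ND f g : N (f + g) = N f + N g.
  by rewrite !NE -big_split; apply: eq_bigr => k _; rewrite addsE mulrDr.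
have NZ k f : N (k *: f) = k * N f.
  by rewrite !NE mulr_sumr; apply: eq_bigr => l _; rewrite scalesE mulrCA.
have N0 : N 0 = 0 by have := NZ 0 0; rewrite scale0r mul0r.
have NS (J : Type) (r : seq J) (Q : pred J) F :
    N (\sum_(i <- r | Q i) F i) = \sum_(i <- r | Q i) N (F i).
  by elim/big_rec2: _ => [//|i y f _ <-]; apply: ND.
have Nspin f : N (spin f) = N f.
  rewrite /N; case: m um {G N NE Next ND NZ N0 NS} => [|m] um; first by rewrite !big_ord0.
  under eq_bigr => k _ do rewrite -iterSr.
  have e : iter m.+1 spin f u = f u.
    by rewrite iter_spin ?um // -um take_size rot_size su mul1r.
  by rewrite big_ord_recr big_ord_recl addrC /= -iterS e.
have Niter j f : N (iter j spin f) = N f by elim: j => //= j <-; apply: Nspin.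
have GS x j : (0 < j < m)%N -> N (G x j) = sg x * N (G (st x) (m - j)%N).
  move=> /andP[j0 jm]; rewrite -[in RHS](Niter j) -NZ; apply: Next => v vm.
  rewrite scalesE iter_spin ?vm 1?ltnW // /G (stK starK) /=.
  have -> : take (m - j) (rot j v) = drop j v.
    by rewrite /rot take_cat size_drop vm ltnn subnn take0 cats0.
  have -> : drop (m - j) (rot j v) = take j v.
    by rewrite /rot drop_cat size_drop vm ltnn subnn drop0.
  have [->|/ps [_ e]] := eqVneq (phi x (take j v)) 0; first by rewrite mul0r !mulr0.
  have -> : sgw (take j v) = sg x by rewrite /sgw e.
  by rewrite [RHS]mulrA sg_sqr mul1r mulrC.
have NM x : N (phi x * phi (st x)) = \sum_(1 <= j < m) N (G x j).
  rewrite -NS; apply: Next => v vm; rewrite mulsE vm sumsE.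
  rewrite -(big_mkord xpredT (fun k => phi x (take k v) * phi (st x) (drop k v))).
  rewrite big_ltn // take0 p0 mul0r add0r.
  have [->|m0] := posnP m; first by rewrite !big_geq.
  by rewrite big_nat_recr //= -vm drop_size p0 mulr0 addr0.
rewrite -/(N (\sum_x ep x *: (phi x * phi (st x)))); set S := N _; have SE : S = \sum_x ep x * \sum_(1 <= j < m) N (G x j).
  by rewrite /S NS; apply: eq_bigr => x _; rewrite NZ NM.
have S1 : S = \sum_x ep x * (sg x * \sum_(1 <= j < m) N (G (st x) j)).
  rewrite SE; apply: eq_bigr => x _; congr (_ * _).
  rewrite mulr_sumr [RHS]big_nat_rev; apply: eq_big_nat => j jm.
  by rewrite (GS x j jm) add1n subSS.
(* exchange x and st x in one of the two expressions for S *)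
have SN : S = - S.
  rewrite {1}SE (reindex_inj (inv_inj (stK starK))) S1 -sumrN.
  by apply: eq_bigr => x _; rewrite (ep_st eps_star); ring.
have /eqP : 2%:R * S = 0 by rewrite mulr_natl mulr2n {1}SN addNr.
by rewrite mulf_eq0 (negbTE (natr_neq0 charK0 _)) // => /eqP.
Qed.

End Darboux.

(** * Conjugating two structures with the same quadratic part *)
Section Comparison.
Variables (K : fieldType) (I A : finType).
Variables (sA tA : A -> I) (star : A -> A) (eps : A -> K).
Hypothesis starK : involutive star.
Hypothesis sA_star : forall a, sA (star a) = tA a.
Hypothesis tA_star : forall a, tA (star a) = sA a.
Hypothesis eps_star : forall a, eps (star a) = - eps a.
Hypothesis eps_sqr : forall a, eps a * eps a = 1.

Local Notation X := (letters I A).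
Local Notation P := (series K X).
Local Notation src := (@src I A sA).
Local Notation tgt := (@tgt I A tA).
Local Notation st := (@st I A star).
Local Notation sd := (@sd I A).
Local Notation sdw := (@sdw I A).
Local Notation L := (@letter K X).
Local Notation ep := (@ep K I A eps).
Local Notation sg := (@sg K I A).
Local Notation sgw := (@sgw K I A).
Local Notation sup := (@sup K I A sA tA).
Implicit Types (f g h : P) (u p q r : seq X) (x y : X).

Local Notation sup_letter := (@sup_letter K I A sA tA).
Local Notation c2 := (@c2 K I A sA tA star eps).
Local Notation omega := (@omega K I A star eps).
Local Notation one := (fun _ : X => 1 : K).
Hypothesis charK0 : [pchar K] =i pred0.

Lemma twist_phi (phi : X -> P) x k : sup (src x) (tgt x) (sd x + k) (phi x) ->
  twist sg (phi x) = ((-1) ^ k * sg x) *: phi x.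
Proof. by move=> /twist_sup ->; rewrite sgzD mulrC. Qed.

Lemma subst_sup (phi : X -> P) : (forall x, phi x [::] = 0) ->
  (forall x, sup (src x) (tgt x) (sd x) (phi x)) ->
  forall i j d f, sup i j d f -> sup i j d (subst phi f).
Proof.
move=> p0 ps i j d f fs u.
have [N] := ubnP (size u); elim: N u i d f fs => // N IH u i d f fs uN nz.
case: u uN nz => [|y u] uN; first by rewrite /subst => /fs.
rewrite substE // addsE scalesE mulr0 add0r sumsE => nz.
have [x] : exists x, (phi x * subst phi (lquo x f)) (y :: u) != 0.
  apply/existsP; apply: contraNT nz; rewrite negb_exists => /forallP nz.
  by rewrite big1 // => l _; apply/eqP; rewrite -[_ == _]negbK nz.
rewrite mulsE => {}nz.
have [k] : exists k : 'I_(size (y :: u)).+1,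
    phi x (take k (y :: u)) * subst phi (lquo x f) (drop k (y :: u)) != 0.
  apply/existsP; apply: contraNT nz; rewrite negb_exists => /forallP nz.
  by rewrite big1 // => l _; apply/eqP; rewrite -[_ == _]negbK nz.
rewrite mulf_eq0 negb_or => /andP[].
case: k => -[|k] kl; first by rewrite /= p0 eqxx.
move=> /ps [p1 d1] nz2.
have [xi|xi] := eqVneq (src x) i; last first.
  by move: nz2; rewrite (lquo_sup0 fs xi) subst0 // eqxx.
have sk : (size (drop k.+1 (y :: u)) < N)%N.
  by rewrite /= size_drop; apply: leq_ltn_trans (leq_subr _ _) _.
have [p2 d2] := IH _ _ _ _ (sup_lquo (x := x) fs) sk nz2.
rewrite -(cat_take_drop k.+1 (y :: u)) sdw_cat d1 d2 addrC subrK.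
by split=> //; apply: pth_cat p2; rewrite -xi.
Qed.

(** A substitution is compatible with the pairing, in the sense of cyclic
    morphisms, when this expression equals omega. *)
Lemma subst_omega (phi : X -> P) : (forall x, phi x [::] = 0) ->
  subst phi omega = \sum_x ep x *: (phi x * phi (st x)).
Proof.
move=> p0; rewrite subst_sum //; apply: eq_bigr => x _.
by rewrite substZ // substM // !subst_letter.
Qed.

Section Error.
Variables D D' : X -> P.
Hypothesis Ds : forall x, sup (src x) (tgt x) (sd x - 1) (D x).
Hypothesis Dc : forall x, ord 3 (D x - c2 x).
Hypothesis DD : forall x, der sg D (D x) = 0.
Hypothesis Do : der sg D omega = 0.
Hypothesis Dc' : forall x, ord 3 (D' x - c2 x).
Hypothesis DD' : forall x, der sg D' (D' x) = 0.
Hypothesis Do' : der sg D' omega = 0.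
Hypothesis Ds' : forall x, sup (src x) (tgt x) (sd x - 1) (D' x).

Lemma D_ord (B : X -> P) x : ord 3 (B x - c2 x) -> ord 2 (B x).
Proof.
move=> h; rewrite -[B x](subrK (c2 x)); apply: ordD; first exact: ordW h.
exact: ord_c2.
Qed.

Lemma der_sqr f : der sg D (der sg D f) = 0.
Proof.
apply: (@taylor_unique K X one (fun f => der sg D (der sg D f)) (fun=> 0) (fun=> 0)) => {}f.
  rewrite [der sg D f in LHS]derE derD !der_sum add0r -big_split; apply: eq_bigr => x _ /=.
  rewrite derM derZ derM der_letter twist_letter DD mul0r add0r.
  rewrite (twist_phi (@Ds x)) sgzN expr1z mulN1r scale1r scaleNr mulNr.
  by rewrite -!scalerAl scalerDr addrA addNr add0r scalerA sg_sqr ?scale1r.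
by rewrite add0r big1 // => x _; rewrite mulr0 scaler0.
Qed.

Section Phi.
Variable phi : X -> P.
Hypothesis p0 : forall x, phi x [::] = 0.
Hypothesis ps : forall x, sup (src x) (tgt x) (sd x) (phi x).

(** The failure of the substitution to intertwine the two differentials. *)
Definition defect f : P := der sg D (subst phi f) - subst phi (der sg D' f).

Lemma twist_p x : twist sg (phi x) = sg x *: phi x.
Proof. exact: twist_sup. Qed.

(** The defect is a derivation along phi, hence small on long words as soon as
    it is small on letters. *)
Lemma defect_rec f : defect f = \sum_x defect (L x) * subst phi (lquo x f)
                      + \sum_x sg x *: (phi x * defect (lquo x f)).
Proof.
rewrite /defect [subst phi f in LHS](substE p0) [der sg D' f in LHS]derE derD derZ der1 scaler0 add0r der_sum.
rewrite substD // !subst_sum // opprD -big_split /= -!sumrN -!big_split /=.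
apply: eq_bigr => x _; rewrite subst_letter // der_letter derM twist_p.
rewrite substM // substZ // substM // subst_letter // -!scalerAl mulrBr scalerBr mulrBl.
by pointwise.
Qed.

(** The Bianchi identity; its leading term is [lead_square]. *)
Lemma defect_D' x : der sg D (defect (L x)) + defect (D' x) = 0.
Proof.
by rewrite /defect subst_letter // der_letter derB der_sqr DD' subst0 // subr0 sub0r addNr.
Qed.

Lemma defect_omega : defect omega = der sg D (subst phi omega - omega).
Proof. by rewrite /defect Do' subst0 // subr0 derB Do subr0. Qed.

Lemma defect_sup x : sup (src x) (tgt x) (sd x - 1) (defect (L x)).
Proof.
rewrite /defect subst_letter // der_letter; apply: supB.
  exact: (der_sup Ds (@ps x)).
exact: subst_sup.
Qed.

Variable n : nat.
Hypothesis En : forall x, ord n (defect (L x)).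
Hypothesis p1 : forall x, ord 2 (phi x - L x).
Let e x := hp n (defect (L x)).

Lemma defect_ord m f : ord m f -> ord (n + m.-1)%N (defect f).
Proof. exact: (deform_ord p0 p0 En defect_rec). Qed.

Lemma defect_LL x y : defect (L x * L y) = defect (L x) * phi y + sg x *: (phi x * defect (L y)).
Proof.
rewrite {1}/defect substM // !subst_letter // derM twist_p der_LL.
rewrite substD // substZ // !substM // !subst_letter //.
rewrite /defect !subst_letter // !der_letter -!scalerAl mulrBl mulrBr scalerBr.
by pointwise.
Qed.

(** On quadratic series phi may be replaced by the identity and the defect on
    letters by its leading term, at the cost of terms of higher order. *)
Lemma defect_lead f : homog 2 f -> ord n.+2 (defect f - der sg e f).
Proof.
have ErD g h : defect (g + h) = defect g + defect h.
  by rewrite /defect substD // !derD substD // opprD addrACA.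
have ErZ k g : defect (k *: g) = k *: defect g.
  by rewrite /defect substZ // !derZ substZ // scalerBr.
move=> /homog2E ->; pose F g := defect g - der sg e g.
have FD g h : F (g + h) = F g + F h by rewrite /F ErD derD opprD addrACA.
have FZ k g : F (k *: g) = k *: F g by rewrite /F ErZ derZ [RHS]scalerBr.
have F0 : ord n.+2 (F 0) by have := FZ 0 0; rewrite !scale0r => ->.
rewrite -/(F _); apply: (big_ind (fun g => ord n.+2 (F g))) => //.
  by move=> g h og oh; rewrite FD; apply: ordD.
move=> x _; apply: (big_ind (fun g => ord n.+2 (F g))) => //.
  by move=> g h og oh; rewrite FD; apply: ordD.
move=> y _; rewrite FZ; apply: ordZ; rewrite /F defect_LL der_LL.
have -> : defect (L x) * phi y + sg x *: (phi x * defect (L y)) -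
  (e x * L y + sg x *: (L x * e y)) =
  (defect (L x) - e x) * phi y + e x * (phi y - L y) +
  sg x *: ((phi x - L x) * defect (L y) + L x * (defect (L y) - e y)).
  rewrite !(mulrBl, mulrBr) !scalerDr !scalerN; by pointwise.
have py z : ord 1 (phi z) by move=> [|//].
have ee z : ord n.+1 (defect (L z) - e z) by apply: hp_ord.
have en z : ord n (e z) by apply: homog_ord; apply: hp_homog.
apply: ordD; [apply: ordD|apply/ordZ/ordD].
- by apply: ordW (ordM (ee x) (py y)); rewrite addn1.
- by apply: ordW (ordM (en x) (p1 y)); rewrite addn2.
- by apply: ordW (ordM (p1 x) (En y)); rewrite add2n.
- by apply: ordW (ordM (@ord_letter _ _ x) (ee y)); rewrite add1n.
Qed.

Lemma lead_omega : ord n.+1 (subst phi omega - omega) -> der sg e omega = 0.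
Proof.
move=> o; apply: (@homog_eq0 _ _ n.+1).
  rewrite der_omega; apply: homog_sum => x _; apply/homogZ/homogD; last apply: homogZ.
    by rewrite -addn1; apply: homogM (@homog_letter _ _ _); apply: hp_homog.
  by rewrite -add1n; apply: homogM (@homog_letter _ _ _) _; apply: hp_homog.
have h := defect_lead (homog_omega star eps).
rewrite -[der sg e omega](subKr (defect omega)); apply: ordB h.
rewrite defect_omega; apply: (@der_ord _ _ 1 sg) o.
by move=> x; apply: D_ord.
Qed.

Lemma lead_square x : der sg c2 (e x) + der sg e (c2 x) = 0.
Proof.
apply: (@homog_eq0 _ _ n.+1).
  apply: homogD.
    by apply: (@der_homog _ _ sg 1) (hp_homog _); move=> y; apply: homog_c2.
  rewrite (homog2E (homog_c2 _ _ _ _ x)) der_sum; apply: homog_sum => y _.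
  rewrite der_sum; apply: homog_sum => z _; rewrite derZ der_LL; apply: homogZ.
  apply: homogD; last apply: homogZ.
    by rewrite -addn1; apply: homogM (@homog_letter _ _ _); apply: hp_homog.
  by rewrite -add1n; apply: homogM (@homog_letter _ _ _) _; apply: hp_homog.
have -> : der sg c2 (e x) + der sg e (c2 x) =
  - (der sg c2 (defect (L x) - e x) + der sg (fun y => D y - c2 y) (defect (L x)) +
     (defect (c2 x) - der sg e (c2 x)) + defect (D' x - c2 x)).
  have ErB g h : defect (g - h) = defect g - defect h.
    by rewrite /defect substB // !derB substB // !opprD !opprK addrACA.
  have := defect_D' x; rewrite derDl derNl derB ErB => /eqP.
  rewrite addr_eq0 => /eqP ->; by pointwise.
apply/ordN/ordD; [apply: ordD; [apply: ordD|]|].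
- apply: (@der_ord _ _ 1 sg _ n.+1); last exact: hp_ord.
  by move=> y; apply: ord_c2.
- apply: (@der_ord _ _ 2 sg _ n) => //.
- by apply: defect_lead; apply: homog_c2.
- by have := defect_ord (@Dc' x); rewrite addn2.
Qed.

End Phi.
Lemma phi_nil (phi : X -> P) : (forall x, ord 2 (phi x - L x)) ->
  forall x, phi x [::] = 0.
Proof. by move=> p1 x; have := p1 x [::] isT; rewrite subsE letter_nil subr0. Qed.

Section Perturb.
Variables (phi d : X -> P) (k : nat).
Hypothesis k2 : (2 <= k)%N.
Hypothesis p1 : forall x, ord 2 (phi x - L x).
Hypothesis dk : forall x, ord k (d x).
Local Notation psi := (fun x => phi x + d x).

Lemma perturb_letter x : ord 2 (psi x - L x).
Proof. by rewrite addrAC; apply: ordD => //; apply: ordW (dk x). Qed.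

Let p0 := phi_nil p1.
Let q0 := phi_nil perturb_letter.

(** Adding d to phi acts on quadratic series, to leading order, as the derivation
    with values d. *)
Lemma perturb_lead f : homog 2 f ->
  ord k.+2 (subst psi f - subst phi f - der one d f).
Proof.
move=> /homog2E ->; pose F g := subst psi g - subst phi g - der one d g.
have FD g h : F (g + h) = F g + F h.
  by rewrite /F !substD // derD; pointwise.
have FZ c g : F (c *: g) = c *: F g.
  by rewrite /F !substZ // derZ !scalerBr.
have F0 : ord k.+2 (F 0) by have := FZ 0 0; rewrite !scale0r => ->.
rewrite -/(F _); apply: (big_ind (fun g => ord k.+2 (F g))) => //.
  by move=> g h og oh; rewrite FD; apply: ordD.
move=> x _; apply: (big_ind (fun g => ord k.+2 (F g))) => //.
  by move=> g h og oh; rewrite FD; apply: ordD.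
move=> y _; rewrite FZ; apply: ordZ; rewrite /F !substM // !subst_letter // der_LL scale1r.
have -> : (phi x + d x) * (phi y + d y) - phi x * phi y -
    (d x * L y + L x * d y) =
  d x * (phi y - L y) + (phi x - L x) * d y + d x * d y.
  by rewrite !(mulrBl, mulrBr, mulrDl, mulrDr); pointwise.
apply: ordD; [apply: ordD|].
- by apply: ordW (ordM (dk x) (p1 y)); rewrite addn2.
- by apply: ordW (ordM (p1 x) (dk y)); rewrite add2n.
- by apply: ordW (ordM (dk x) (dk y)); rewrite -addn2 leq_add2l.
Qed.

Lemma perturb_ord m f : ord m f -> ord (k + m.-1)%N (subst psi f - subst phi f).
Proof.
apply: subst_diff_ord => // x.
by rewrite addrAC subrr add0r.
Qed.

(** To leading order the defect changes by the bracket of c2 with d, which is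
    what [key_lemma] provides. *)
Lemma perturb_defect x : ord k.+2 (defect psi (L x) -
  (defect phi (L x) + (der sg c2 (d x) - der one d (c2 x)))).
Proof.
rewrite /defect !subst_letter // !der_letter derD.
have -> : der sg D (phi x) + der sg D (d x) - subst psi (D' x) -
   (der sg D (phi x) - subst phi (D' x) + (der sg c2 (d x) - der one d (c2 x))) =
   der sg (fun y => D y - c2 y) (d x) -
   ((subst psi (c2 x) - subst phi (c2 x) - der one d (c2 x)) +
    (subst psi (D' x - c2 x) - subst phi (D' x - c2 x))).
  by rewrite derDl derNl !substB //; pointwise.
apply: ordB; first exact: (@der_ord _ _ 2 sg _ k).
apply: ordD; first by apply: perturb_lead; apply: homog_c2.
by have := perturb_ord (@Dc' x); rewrite addn2.
Qed.

End Perturb.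

(** The induction hypothesis: phi(omega) is known to be correct in one length
    more than the defect, as [lead_omega] needs in order to see that the
    leading term of the defect preserves omega. *)
Definition stage n (phi : X -> P) : Prop :=
  [/\ forall x, sup (src x) (tgt x) (sd x) (phi x),
      forall x, ord 2 (phi x - L x),
      ord n.+1 (subst phi omega - omega) &
      forall x, ord n (defect phi (L x))].

(** The correction has length one less than the leading term of the defect.  It
    does not change phi(omega) in the leading length, because it preserves
    omega. *)
Lemma key_step n phi : stage n.+3 phi -> exists psi : X -> P,
  [/\ forall x, sup (src x) (tgt x) (sd x) (psi x),
      forall x, ord 2 (psi x - L x),
      ord n.+4 (subst psi omega - omega),
      forall x, ord n.+4 (defect psi (L x)) &
      forall x, ord n.+2 (psi x - phi x)].
Proof.
move=> [ps p1 po pE]; have p0 := phi_nil p1.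
have [d [dh ds do_ dc]] := key_lemma starK sA_star tA_star eps_star eps_sqr charK0
   (fun x => hp_homog (n := n.+3) (defect phi (L x)))
   (fun x => sup_hp (@defect_sup phi p0 ps x)) (lead_omega p0 ps pE p1 po)
   (lead_square p0 ps pE p1).
have dk x : ord n.+2 (- d x) by apply/ordN/homog_ord.
exists (fun x => phi x + - d x); split.
- by move=> x; apply: supB.
- exact: (perturb_letter (k := n.+2) isT p1 dk).
- have h := perturb_lead (k := n.+2) isT p1 dk (homog_omega star eps).
  rewrite derNl do_ oppr0 subr0 in h.
  by rewrite -(subrK (subst phi omega) (subst _ _)) -addrA; apply: ordD.
- move=> x; have := perturb_defect (k := n.+2) isT p1 dk x.
  rewrite derN derNl -opprD dc => h.
  rewrite -[defect _ _](subrK (defect phi (L x) - hp n.+3 (defect phi (L x)))).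
  apply: ordD; last exact: hp_ord.
  exact: h.
- by move=> x; rewrite addrAC subrr add0r.
Qed.

(** The leading term of omega - phi(omega) is a difference of two expressions
    whose rotations sum to zero by [spin_omega], so that [darboux] removes it.
    The correction has the length of the leading term minus one, and therefore does
    not affect the vanishing of the defect already achieved. *)
Lemma darboux_step n psi :
  [/\ forall x, sup (src x) (tgt x) (sd x) (psi x),
      forall x, ord 2 (psi x - L x),
      ord n.+3 (subst psi omega - omega) &
      forall x, ord n.+3 (defect psi (L x))] ->
  exists chi, stage n.+3 chi /\ forall x, ord n.+2 (chi x - psi x).
Proof.
move=> [qs q1 qo qE]; have q0 := phi_nil q1.
pose g := hp n.+3 (omega - subst psi omega).
have gE : omega - subst psi omega =
   \sum_x ep x *: (L x * L (st x)) - \sum_x ep x *: (psi x * psi (st x)).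
  by rewrite (subst_omega q0).
have gc : csupp sA tA g.
  have cs i f : sup i i 0 f -> csupp sA tA f.
    by move=> fs u /fs [p s0]; split=> //; exists i.
  move=> u; rewrite /g /hp; case: ifP => [_|]; last by rewrite eqxx.
  rewrite (omega_sum sA) subst_sum // -sumrB; move: u; apply: csupp_sum => i _.
  apply: cs; have os := @sup_omega_at _ _ _ sA tA star eps sA_star tA_star i.
  by apply: supB; [exact: os|apply: subst_sup].
have g0 : \sum_(k < n.+3) iter k (@spin K I A) g = 0.
  apply: seriesP => u; rewrite sumsE zeroE.
  have [us|us] := eqVneq (size u) n.+3; last first.
    rewrite big1 // => k _; have ih : homog n.+3 (iter k (@spin K I A) g).
      by elim: (k : nat) => [|l IH]; [apply: hp_homog|apply: spin_homog].
    exact: ih.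
  have itE (k : 'I_n.+3) f : iter k (@spin K I A) f u = sgw (take k u) * f (rot k u).
    by rewrite iter_spin // us ltnW.
  have [su|su] := eqVneq (sgw u) 1; last first.
    rewrite big1 // => k _; rewrite itE.
    have [->|/gc [_ s0]] := eqVneq (g (rot k u)) 0; first by rewrite mulr0.
    have e : sdw u = sdw (rot k u).
      by rewrite /rot sdw_cat addrC -sdw_cat cat_take_drop.
    by case/eqP: su; rewrite /sgw e s0 expr0z.
  have e1 := spin_omega starK eps_star charK0 sup_letter (@letter_nil K X) us su.
  have e2 := spin_omega starK eps_star charK0 qs q0 us su.
  rewrite -[RHS](subrr 0) -[in X in _ = X - _]e1 -[in X in _ = _ - X]e2 -sumrB.
  apply: eq_bigr => k _.
  by rewrite !itE /g /hp size_rot us eqxx gE subsE mulrBr.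
have [d [dh ds do_]] : exists d : X -> P, [/\ forall x, homog n.+2 (d x),
    forall x, sup (src x) (tgt x) (sd x) (d x) & der one d omega = g].
  by apply: (darboux starK sA_star tA_star eps_star eps_sqr charK0) gc _ g0; apply: hp_homog.
have dk x : ord n.+2 (d x) by apply/homog_ord.
exists (fun x => psi x + d x); split; last first.
  by move=> x; rewrite addrAC subrr add0r.
split.
- by move=> x; apply: supD.
- exact: (perturb_letter (k := n.+2) isT q1 dk).
- have h := perturb_lead (k := n.+2) isT q1 dk (homog_omega star eps).
  rewrite do_ in h.
  rewrite (_ : _ - omega = (subst (fun x => psi x + d x) omega - subst psi omega - g)
     - (omega - subst psi omega - g)); last by pointwise.
  apply: ordB => //; apply: hp_ord.
  by rewrite -opprB; apply: ordN.
- move=> x; have h := perturb_defect (k := n.+2) isT q1 dk x.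
  rewrite -[defect _ _](subrK (defect psi (L x) + (der sg c2 (d x) - der one d (c2 x)))).
  apply: ordD; first by apply: ordW h.
  apply: ordD => //; apply: ordB.
    by apply: (@der_ord _ _ 1 sg _ n.+2) => // y; apply: ord_c2.
  have := @der_ord _ _ n.+1 one d 2 _ dk (ord_c2 sA tA star eps x).
  by rewrite addn2.
Qed.

Lemma next_stage n phi : stage n.+3 phi ->
  exists psi, stage n.+4 psi /\ forall x, ord n.+2 (psi x - phi x).
Proof.
move=> /key_step [psi [qs q1 qo qE qp]].
have [chi [cs cp]] := darboux_step (n := n.+1) (And4 qs q1 qo qE).
exists chi; split=> // x; rewrite -[chi x](subrK (psi x)) -addrA.
by apply: ordD => //; apply: ordW (cp x).
Qed.

Lemma first_stage : stage 3 L.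
Proof.
split=> [x|x||x]; first exact: sup_letter.
- by rewrite subrr.
- by rewrite subst_id subrr.
rewrite /defect !subst_id der_letter der_letter.
have -> : D x - D' x = (D x - c2 x) - (D' x - c2 x) by pointwise.
exact: ordB.
Qed.

(** The coefficients of the successive substitutions are eventually constant, and
    their limit has no defect. *)
Theorem conjugation : exists phi : X -> P,
  [/\ forall x, sup (src x) (tgt x) (sd x) (phi x),
      forall x, ord 2 (phi x - L x),
      subst phi omega = omega &
      forall x, der sg D (phi x) = subst phi (D' x)].
Proof.
pose step n (p : {phi | stage n.+3 phi}) : {psi | stage n.+4 psi} :=
  let: exist phi h := p in
  let w := cid (next_stage h) in exist _ (projT1 w) (projT2 w).1.
pose seqp := fix F n : {phi | stage n.+3 phi} :=
  if n is m.+1 then step m (F m) else exist _ L first_stage.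
pose ph n := sval (seqp n).
have phS n x : ord n.+2 (ph n.+1 x - ph n x).
  rewrite /ph /= /step; case: (seqp n) => phi h /=; exact: (projT2 (cid (next_stage h))).2.
have phD m n x : (n <= m)%N -> ord n.+2 (ph m x - ph n x).
  move=> /subnK <-; elim: (m - n)%N => [|k IH]; first by rewrite subrr.
  rewrite addSn -[ph _ x](subrK (ph (k + n)%N x)) -addrA; apply: ordD => //.
  by apply: ordW (@phS _ x); rewrite !ltnS leq_addl.
(* the coefficient of u no longer changes from stage [size u] on *)
pose phi x : P := fun u => ph (size u) x u.
have pD n x : ord n.+2 (phi x - ph n x).
  move=> u un; rewrite subsE /phi; case/orP: (leq_total (size u) n) => h.
    by rewrite -opprB -subsE (@phD _ _ x h u) ?oppr0.
  by have := @phD _ _ x h u un.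
have st_ n : stage n.+3 (ph n) := svalP (seqp n).
have p1 x : ord 2 (phi x - L x).
  have [_ h _ _] := st_ 0%N; rewrite -[phi x](subrK (ph 0%N x)) -addrA.
  by apply: ordD => //; apply: (@pD 0%N).
have p0 := phi_nil p1.
have n0 n := phi_nil (let: And4 _ h _ _ := st_ n in h).
exists phi; split=> //.
- move=> x u; rewrite /phi => nz; have [h _ _ _] := st_ (size u); exact: h nz.
- apply/eqP; rewrite -subr_eq0; apply/eqP; apply: seriesP => u.
  have [_ _ h _] := st_ (size u).
  rewrite -(subrK (subst (ph (size u)) omega) (subst phi omega)) -addrA.
  have o : ord 2 omega by apply/homog_ord/homog_omega.
  rewrite addsE (subst_diff_ord p0 (n0 _) (@pD (size u)) o) ?h ?addr0 //.
    by rewrite !ltnS; do 3 apply: leqW.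
  by rewrite addn1 !ltnS; do 2 apply: leqW.
- move=> x; apply/eqP; rewrite -subr_eq0; apply/eqP; apply: seriesP => u.
  have [_ _ _ h] := st_ (size u); have {h} := h x.
  rewrite /defect subst_letter // der_letter => h.
  have -> : der sg D (phi x) - subst phi (D' x) =
    der sg D (phi x - ph (size u) x) - (subst phi (D' x) - subst (ph (size u)) (D' x))
    + (der sg D (ph (size u) x) - subst (ph (size u)) (D' x)).
    by rewrite derB; pointwise.
  rewrite addsE subsE h ?addr0; last by rewrite !ltnS; do 2 apply: leqW.
  have D1 y : ord 1 (D y) by apply: ordW (D_ord (Dc y)).
  rewrite (@der_ord _ _ 0 sg _ (size u).+2 _ D1 (pD _ _)) ?sub0r //.
  rewrite (@subst_diff_ord _ _ _ _ (size u).+2 0 _ p0 (n0 _) (pD _)) ?oppr0 //.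
  by rewrite /= addn0; apply: leqW.
Qed.

End Error.
End Comparison.

(** * Coordinates on graded spaces of morphisms *)
Section Frames.
Variables (K : fieldType) (O : eqType) (H : O -> O -> int -> vectType K).
Variables (X : finType) (so to : X -> O) (dx : X -> int).

Definition fits (x : X) (i j : O) (d : int) : bool :=
  [&& so x == i, to x == j & dx x == d].

(** Bases of all the spaces H i j d at once, indexed by letters: the letter x
    contributes to the single space that it fits, and its basis vector is zero
    in all others.  This avoids transports along equalities of indices. *)
Record frame : Type := Frame {
  fr_cf : forall i j d, H i j d -> X -> K;
  fr_bas : X -> forall i j d, H i j d;
  cf_lin : forall i j d k (a b : H i j d) x,
    fr_cf (k *: a + b) x = k * fr_cf a x + fr_cf b x;
  cf_out : forall i j d (a : H i j d) x, ~~ fits x i j d -> fr_cf a x = 0;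
  cf_bas : forall i j d x y, fr_cf (fr_bas x i j d) y = ((x == y) && fits x i j d)%:R;
  cf_sum : forall i j d (a : H i j d), a = \sum_x fr_cf a x *: fr_bas x i j d
}.

Variable fr : frame.
Local Notation cf := (fr_cf fr).
Local Notation bas := (fr_bas fr).
Local Notation P := (series K X).

Lemma cfD i j d (a b : H i j d) x : cf (a + b) x = cf a x + cf b x.
Proof. by rewrite -[a]scale1r cf_lin mul1r scale1r. Qed.
Lemma cf0 i j d x : cf (0 : H i j d) x = 0.
Proof. by apply: (addrI (cf (0 : H i j d) x)); rewrite -cfD !addr0. Qed.
Lemma cfZ i j d k (a : H i j d) x : cf (k *: a) x = k * cf a x.
Proof. by rewrite -[k *: a]addr0 cf_lin cf0 addr0. Qed.
Lemma cf_sumE i j d (J : Type) (r : seq J) (Q : pred J) (F : J -> H i j d) x :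
  cf (\sum_(k <- r | Q k) F k) x = \sum_(k <- r | Q k) cf (F k) x.
Proof. by elim/big_rec2: _ => [|k y a _ <-]; rewrite ?cf0 ?cfD. Qed.
Lemma cf_comb i j d (al : X -> K) x :
  cf (\sum_y al y *: bas y i j d) x = al x * (fits x i j d)%:R.
Proof.
rewrite cf_sumE (bigD1 x) //= cfZ cf_bas eqxx big1 ?addr0 // => y yx.
by rewrite cfZ cf_bas (negbTE yx) mulr0.
Qed.
Lemma cf_inj i j d (a b : H i j d) : cf a =1 cf b -> a = b.
Proof.
move=> ab; rewrite (cf_sum fr a) (cf_sum fr b).
by apply: eq_bigr => x _; rewrite ab.
Qed.

(** A series is a multilinear functional on chains, in the coordinates of the
    frame. *)
Fixpoint ev i j (c : chain H i j) : P -> K :=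
  match c with
  | nilc _ => fun f => f [::]
  | consc _ _ _ _ a c' => fun f => \sum_x cf a x * ev c' (lquo x f)
  end.

Lemma evD i j (c : chain H i j) f g : ev c (f + g) = ev c f + ev c g.
Proof.
elim: c f g => [//|{}i k l d a c IH] f g /=.
by rewrite -big_split; apply: eq_bigr => x _; rewrite lquoD IH mulrDr.
Qed.
Lemma evZ i j (c : chain H i j) k f : ev c (k *: f) = k * ev c f.
Proof.
elim: c f => [//|{}i m l d a c IH] f /=.
by rewrite mulr_sumr; apply: eq_bigr => x _; rewrite lquoZ IH mulrCA.
Qed.
Lemma ev0 i j (c : chain H i j) : ev c 0 = 0.
Proof. by have := evZ c 0 0; rewrite scale0r mul0r. Qed.
Lemma ev_sum i j (c : chain H i j) (J : Type) (r : seq J) (Q : pred J) (F : J -> P) :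
  ev c (\sum_(k <- r | Q k) F k) = \sum_(k <- r | Q k) ev c (F k).
Proof. by elim/big_rec2: _ => [|k y a _ <-]; rewrite ?ev0 ?evD. Qed.

Lemma ev_onec i j d (a : H i j d) f : ev (onec a) f = \sum_x cf a x * f [:: x].
Proof. by []. Qed.

Lemma ev_letter_mul i j k d (a : H i j d) (c : chain H j k) x f :
  ev (consc a c) (letter K x * f) = cf a x * ev c f.
Proof.
rewrite /= (bigD1 x) //= big1 ?addr0.
  by rewrite lquoM letter_nil scale0r add0r lquo_letter eqxx scale1r mul1r.
move=> y /negbTE yx; rewrite lquoM letter_nil scale0r add0r lquo_letter yx.
by rewrite scale0r mul0r ev0 mulr0.
Qed.

Lemma ev_one_cons i j k d (a : H i j d) (c : chain H j k) : ev (consc a c) 1 = 0.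
Proof.
rewrite /= big1 // => x _; rewrite (_ : lquo x 1 = 0) ?ev0 ?mulr0 //.
Qed.

Lemma ev_one_rcons i j k d (c : chain H i j) (b : H j k d) :
  ev (catc c (onec b)) 1 = 0.
Proof. by case: c b => [i'|i' m j' e a c] b; apply: ev_one_cons. Qed.

Lemma ev_mul_letter i j k d (c : chain H i j) (b : H j k d) x f :
  ev (catc c (onec b)) (f * letter K x) = ev c f * cf b x.
Proof.
elim: c b f => [{}i|{}i l {}j e a c IH] b f.
  rewrite /= (bigD1 x) //= big1 ?addr0.
    by rewrite [lquo _ _ _](@rmul_rcons _ _ x f x [::]) eqxx mulr1 mulrC.
  move=> y /negbTE yx; rewrite [lquo _ _ _](@rmul_rcons _ _ x f y [::]).
  by rewrite eq_sym yx !mulr0.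
rewrite [LHS]/= [ev (consc _ _) _]/= mulr_suml; apply: eq_bigr => y _.
rewrite lquoM evD evZ IH -mulrA; congr (_ * _).
rewrite -[RHS]add0r; congr (_ + _); rewrite lquo_letter evZ.
by rewrite ev_one_rcons !mulr0.
Qed.

(** The product of series is dual to the deconcatenation of chains. *)
Lemma ev_mul i j (c : chain H i j) f g :
  ev c (f * g) = \sum_(s <- cuts c) ev (projT2 s).1 f * ev (projT2 s).2 g.
Proof.
elim: c f => [{}i|{}i m {}j d a c IH] f; first by rewrite /= big_seq1.
rewrite [cuts _]/= big_cons big_map /=.
have -> : \sum_(s <- cuts c) ev (consc a (projT2 s).1) f * ev (projT2 s).2 g =
   \sum_x cf a x * ev c (lquo x f * g).
  under eq_bigr => s _ do rewrite /= mulr_suml.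
  rewrite exchange_big; apply: eq_bigr => x _; rewrite IH mulr_sumr.
  by apply: eq_bigr => s _; rewrite mulrA.
rewrite mulr_sumr -big_split; apply: eq_bigr => x _.
by rewrite lquoM evD evZ mulrDr mulrCA.
Qed.

Lemma cuts_cons i j k d (a : H i j d) (c : chain H j k) : cuts (consc a c) =
  Cut (nilc i) (consc a c) :: [seq Cut (consc a (projT2 s).1) (projT2 s).2 | s <- cuts c].
Proof. by []. Qed.

Definition mlin i l (f : chain H i l -> K) : Prop :=
  forall j k d (p : chain H i j) (r : chain H k l) (x : K) (a b : H j k d),
    f (catc p (consc (x *: a + b) r)) = x * f (catc p (consc a r)) + f (catc p (consc b r)).

Lemma ev_mlin i l f : mlin (fun c : chain H i l => ev c f).
Proof.
move=> j k d p; elim: p f => [{}i|{}i m {}j e a' p IH] f r x a b /=.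
  rewrite mulr_sumr -big_split; apply: eq_bigr => y _.
  by rewrite cf_lin mulrDl mulrA.
rewrite mulr_sumr -big_split; apply: eq_bigr => y _.
by rewrite IH mulrDr mulrCA.
Qed.

Section Insertion.
Variables (m : operation H) (D : X -> P).
Hypothesis mD : forall i j d (q : chain H i j) x,
  cf (m d q) x = (dx x == d)%:R * ev q (D x).
Hypothesis D_deg : forall i j (q : chain H i j) x,
  ev q (D x) != 0 -> dx x = sdeg q + 2.
Local Notation tau := (fun x => (-1) ^ (dx x - 1) : K).

Lemma mD_top i j (q : chain H i j) x : cf (m (sdeg q + 2) q) x = ev q (D x).
Proof.
rewrite mD; have [->|/D_deg ->] := eqVneq (ev q (D x)) 0; first by rewrite mulr0.
by rewrite eqxx mul1r.
Qed.

(** Inserting an operation into chains is dual to the derivation whose value at x is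
    the x-coordinate of the operation; the sign in front of an insertion is the
    Koszul sign of the derivation. *)
Lemma ev_der i j (c : chain H i j) f :
  ev c (der tau D f) = \sum_(s <- cuts c) \sum_(t <- cuts (projT2 s).2)
    (-1) ^ sdeg (projT2 s).1 *
    ev (catc (projT2 s).1 (consc (m (sdeg (projT2 t).1 + 2) (projT2 t).1) (projT2 t).2)) f.
Proof.
have head i' j' (c' : chain H i' j') g : ev c' (\sum_x D x * lquo x g) =
   \sum_(t <- cuts c') ev (consc (m (sdeg (projT2 t).1 + 2) (projT2 t).1) (projT2 t).2) g.
  rewrite ev_sum; under eq_bigr => x _ do rewrite ev_mul.
  rewrite exchange_big; apply: eq_bigr => t _ /=; apply: eq_bigr => x _.
  by rewrite mD_top.
elim: c f => [{}i|{}i l {}j d a c IH] f.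
  rewrite big_seq1 -[RHS]/(\sum_(t <- cuts (nilc i)) (-1) ^ 0 * _).
  under [RHS]eq_bigr => t _ do rewrite expr0z mul1r.
  rewrite -(head _ _ (nilc i)) derE evD [X in _ + X]ev_sum [X in _ + X]big1 ?addr0 // => x _.
  by rewrite evZ [ev _ _]/= lmul_nil mulr0.
rewrite derE evD head; set S := (X in X + _ = _).
rewrite [in RHS]cuts_cons big_cons big_map; congr (_ + _).
  by apply: eq_bigr => t _; rewrite expr0z mul1r.
rewrite ev_sum.
under [LHS]eq_bigr => x _ do rewrite evZ ev_letter_mul.
transitivity (\sum_(s <- cuts c) \sum_x \sum_(t <- cuts (projT2 s).2)
   (-1) ^ (d - 1 + sdeg (projT2 s).1) * (cf a x *
    ev (catc (projT2 s).1 (consc (m (sdeg (projT2 t).1 + 2) (projT2 t).1) (projT2 t).2))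
      (lquo x f))); last first.
  apply: eq_bigr => s _; rewrite exchange_big; apply: eq_bigr => t _.
  by rewrite -mulr_sumr.
rewrite exchange_big /=; apply: eq_bigr => x _; rewrite IH mulrCA.
have [fx|fx] := boolP (fits x i l d); last first.
  rewrite cf_out // mul0r big1 // => s _; rewrite big1 // => t _.
  by rewrite mul0r mulr0.
have -> : dx x = d by apply/eqP; case/and3P: fx.
rewrite mulrA mulr_sumr; apply: eq_bigr => s _; rewrite mulr_sumr.
apply: eq_bigr => t _; rewrite (exprzDr (unitrN1 K) (d - 1)).
by rewrite [cf a x * (-1) ^ _]mulrC mulrACA.
Qed.

End Insertion.

Fixpoint gpth (i j : O) (u : seq X) : bool :=
  if u is x :: u' then (so x == i) && gpth (to x) j u' else i == j.

Lemma ev_supp i j (c : chain H i j) f : ev c f != 0 ->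
  exists u, [/\ f u != 0, gpth i j u, size u = sizec c &
    \sum_(x <- u) (dx x - 1) = sdeg c].
Proof.
elim: c f => [{}i|{}i l {}j d a c IH] f /=.
  by move=> f0; exists [::]; rewrite /= eqxx big_nil.
move=> nz; have [x] : exists x, cf a x * ev c (lquo x f) != 0.
  apply/existsP; apply: contraNT nz; rewrite negb_exists => /forallP nz.
  by rewrite big1 // => x _; apply/eqP; rewrite -[_ == _]negbK nz.
rewrite mulf_eq0 negb_or => /andP[ax /IH [u [fu pu su du]]].
have /and3P[/eqP xi /eqP xl /eqP xd] : fits x i l d.
  by apply: contraNT ax => fx; rewrite cf_out.
by exists (x :: u); rewrite /= xi xl eqxx pu su big_cons du xd.
Qed.

Fixpoint endp (i : O) (u : seq X) : O := if u is x :: u' then endp (to x) u' else i.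
(** The chain of basis vectors spelled by a word; the types force it to end at
    the end of the word, whether or not the word is composable. *)
Fixpoint chainw (u : seq X) (i : O) : chain H i (endp i u) :=
  match u return chain H i (endp i u) with
  | [::] => nilc i
  | x :: u' => consc (bas x i (to x) (dx x)) (chainw u' (to x))
  end.

Lemma ev_chainw u i f : ev (chainw u i) f = (gpth i (endp i u) u)%:R * f u.
Proof.
elim: u i f => [|x u IH] i f; first by rewrite /= eqxx mul1r.
rewrite /= (bigD1 x) //= big1 ?addr0 => [|y yx].
  rewrite cf_bas eqxx /= IH mulrA -natrM mulnb /fits !eqxx !andbT.
  by rewrite /lquo.
by rewrite cf_bas eq_sym (negbTE yx) mul0r.
Qed.

Lemma gpth_endp i j u : gpth i j u -> endp i u = j.
Proof. by elim: u i => [|x u IH] i /=; [move/eqP|move=> /andP[_ /IH]]. Qed.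

Lemma ev_path i j u : gpth i j u -> exists c : chain H i j, forall f, ev c f = f u.
Proof.
move=> p; have e := gpth_endp p; case: j / e p => p.
by exists (chainw u i) => f; rewrite ev_chainw p mul1r.
Qed.

(** A multilinear functional is determined by its values on basis vectors. *)
Lemma mlin_rep i (G : forall j, chain H i j -> K) :
  (forall j, mlin (G j)) ->
  forall j (c : chain H i j), G j c = ev c (fun u => G _ (chainw u i)).
Proof.
move=> Gl j c; elim: c G Gl => [{}i|{}i l {}j d a c IH] G Gl //=.
have Ga : G _ (consc a c) = \sum_x cf a x * G _ (consc (bas x i l d) c).
  have hD k (b b' : H i l d) : G _ (consc (k *: b + b') c) =
      k * G _ (consc b c) + G _ (consc b' c).
    exact: (Gl j i l d (nilc i) c).
  have h0 : G _ (consc (0 : H i l d) c) = 0.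
    apply: (addrI (G _ (consc (0 : H i l d) c))); rewrite addr0.
    by have := hD 1 0 0; rewrite scale1r addr0 mul1r.
  rewrite {1}(cf_sum fr a); elim/big_rec2: _ => [//|x y b _ <-]; exact: hD.
rewrite Ga; apply: eq_bigr => x _.
have [fx|fx] := boolP (fits x i l d); last by rewrite cf_out // !mul0r.
congr (_ * _).
rewrite (IH (fun j' c' => G j' (consc (bas x i l d) c'))); last first.
  move=> j' j1 k1 d1 p r x1 a1 b1.
  exact: (Gl j' j1 k1 d1 (consc (bas x i l d) p) r x1 a1 b1).
case/and3P: fx => _ /eqP xl /eqP xd; case: l / xl c a Ga IH => c a Ga IH.
by case: d / xd a Ga.
Qed.

End Frames.

(** * The power series of a Calabi-Yau structure *)
Definition dl (I A : finType) (x : letters I A) : int :=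
  match x with inl (inl _) => 0 | inl (inr _) => 2 | inr _ => 1 end.

Lemma dl_sd (I A : finType) (x : letters I A) : dl x - 1 = sd x.
Proof. by case: x => [[i|i]|a]. Qed.

Section SymplecticFrame.
Variables (K : fieldType) (I A : finType).
Variables (sA tA : A -> I) (star : A -> A) (eps : A -> K).
Hypothesis starK : involutive star.
Hypothesis sA_star : forall a, sA (star a) = tA a.
Hypothesis tA_star : forall a, tA (star a) = sA a.
Hypothesis eps_star : forall a, eps (star a) = - eps a.
Hypothesis eps_sqr : forall a, eps a * eps a = 1.

Local Notation X := (letters I A).
Local Notation P := (series K X).
Local Notation zl := (@zl I A).
Local Notation wl := (@wl I A).
Local Notation vl := (@vl I A).
Local Notation src := (@src I A sA).
Local Notation tgt := (@tgt I A tA).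
Local Notation st := (@st I A star).
Local Notation isz := (@isz I A).
Local Notation sd := (@sd I A).
Local Notation sdw := (@sdw I A).
Local Notation pth := (@pth I A sA tA).
Local Notation L := (@letter K X).
Local Notation ep := (@ep K I A eps).
Local Notation sg := (@sg K I A).
Local Notation sup := (@sup K I A sA tA).
Local Notation c0 := (@c0 K I A sA star eps).
Local Notation D0 := (der sg c0).
Implicit Types (f g h : P) (u p q r : seq X) (x y : X).

Local Notation c2 := (@c2 K I A sA tA star eps).
Local Notation omega := (@omega K I A star eps).
Section Any.
Variables (O : eqType) (H : O -> O -> int -> vectType K) (o : I -> O).
Hypothesis o_inj : injective o.
Local Notation so := (fun x => o (src x)).
Local Notation to := (fun x => o (tgt x)).
Variable fr : frame H so to (@dl I A).
Local Notation cf := (fr_cf fr).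
Local Notation ev := (@ev K O H X so to (@dl I A) fr).
Local Notation gpth := (@gpth O X so to).
Local Notation tau := (fun x : X => (-1) ^ (dl x - 1) : K).

Lemma tau_sg : tau = sg.
Proof. by apply/funext => x; rewrite dl_sd. Qed.

Lemma gpthE i j u : gpth (o i) (o j) u = pth i j u.
Proof.
elim: u i => [|x u IH] i /=; first by rewrite (inj_eq o_inj).
by rewrite (inj_eq o_inj) IH.
Qed.

Lemma gpth_img i' j' x u : gpth i' j' (x :: u) -> exists i j, i' = o i /\ j' = o j.
Proof.
move=> /= /andP[/eqP <- p]; exists (src x).
elim: u {i'} (tgt x) p => [|y u IH] i /=; first by move=> /eqP <-; exists i.
by move=> /andP[_ /IH].
Qed.

Lemma sdw_sum u : \sum_(x <- u) (dl x - 1) = sdw u.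
Proof. by rewrite /sdw; apply: eq_bigr => x _; rewrite dl_sd. Qed.

Lemma ev_sup i j d f i' j' (c : chain H i' j') : sup i j d f -> f [::] = 0 ->
  ev c f != 0 -> [/\ i' = o i, j' = o j & sdeg c = d].
Proof.
move=> fs f0 /ev_supp [u [fu pu _ su]].
case: u fu pu su => [|x u] fu pu su; first by rewrite f0 eqxx in fu.
have [pu' du] := fs _ fu; rewrite -su sdw_sum du {su c}.
have [i1 [j1 [ei ej]]] := gpth_img pu; move: pu; rewrite ei ej gpthE => pu.
move: pu pu' => /= /andP[/eqP <- pu] /andP[/eqP <- pu'].
by rewrite (pth_end pu pu').
Qed.

Lemma ev_eq0 i j d f : sup i j d f ->
  (forall c : chain H (o i) (o j), ev c f = 0) -> f = 0.
Proof.
move=> fs f0; apply: seriesP => u; have [//|nz] := eqVneq (f u) 0.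
have [p _] := fs _ nz; rewrite -gpthE in p.
by have [c ec] := ev_path fr p; rewrite -ec.
Qed.

Section Operation.
Variables (m : operation H) (D : X -> P).
Hypothesis Ds : forall x, sup (src x) (tgt x) (sd x - 1) (D x).
Hypothesis D0 : forall x, D x [::] = 0.
Hypothesis mD : forall i j d (q : chain H i j) x,
  cf (m d q) x = (dl x == d)%:R * ev q (D x).

Lemma D_deg i j (q : chain H i j) x : ev q (D x) != 0 -> dl x = sdeg q + 2.
Proof.
move=> /(ev_sup (@Ds x) (D0 x)) [_ _ ->]; rewrite -dl_sd; ring.
Qed.

Lemma ev_insertion i j (c : chain H i j) f :
  ev c (der sg D f) = insertion (V := K^o) m (fun c' => ev c' f) c.
Proof. by rewrite -tau_sg (ev_der mD D_deg). Qed.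

End Operation.

Section Pairing.
Variable b : pairing_family H.
Hypothesis bE : forall i j d e (a : H i j d) (a' : H j i e),
  suspended b a a' = \sum_x ep x * (cf a x * cf a' (st x)).

(** Graded symmetry of the pairing in terms of its Gram matrix. *)
Lemma sus_sym i j d e (a : H i j d) (a' : H j i e) :
  suspended b a a' = - (-1) ^ (d - 1) * suspended b a' a.
Proof.
rewrite !bE (reindex_inj (inv_inj (stK starK))) mulr_sumr; apply: eq_bigr => x _.
rewrite (stK starK) (ep_st eps_star).
have [fx|fx] := boolP (fits so to (@dl I A) (st x) i j d); last first.
  by rewrite (cf_out fr a fx) !(mul0r, mulr0).
have -> : (-1) ^ (d - 1) = sg x by case/and3P: fx => _ _ /eqP <-; rewrite dl_sd -(sg_st K star).
ring.
Qed.

Variables (m : operation H) (D : X -> P).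
Hypothesis Ds : forall x, sup (src x) (tgt x) (sd x - 1) (D x).
Hypothesis D0 : forall x, D x [::] = 0.
Hypothesis mD : forall i j d (q : chain H i j) x,
  cf (m d q) x = (dl x == d)%:R * ev q (D x).

(** The two products x * st x of D omega in which D hits the first or the second
    factor give the two sides of the cyclicity condition. *)
Lemma ev_der_omega i j k d e (a : H i j d) (c : chain H j k) (a' : H k i e) :
  ev (consc a (catc c (onec a'))) (der sg D omega) =
  suspended b (m (sdeg (consc a c) + 2) (consc a c)) a' -
  suspended b (m (sdeg (catc c (onec a')) + 2) (catc c (onec a'))) a.
Proof.
set cb := catc c (onec a'); set y := m (sdeg cb + 2) cb.
have -> : suspended b y a = - ((-1) ^ (d - 1) * suspended b a y).
  by rewrite [suspended b a y]sus_sym mulrA mulrN mulNr opprK sgz_sqr mul1r.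
rewrite opprK der_omega ev_sum /y /cb {y cb}.
rewrite !bE mulr_sumr -big_split; apply: eq_bigr => x _.
rewrite evZ evD evZ ev_letter_mul -[consc a (catc c _)]/(catc (consc a c) (onec a')).
rewrite ev_mul_letter !(mD_top mD (D_deg Ds D0)) mulrDr; congr (_ + _).
have [fx|fx] := boolP (fits so to (@dl I A) x i j d); last first.
  by rewrite (cf_out fr a fx) !(mul0r, mulr0).
have -> : (-1) ^ (d - 1) = sg x by case/and3P: fx => _ _ /eqP <-; rewrite dl_sd.
by rewrite mulrCA.
Qed.

End Pairing.
End Any.

Section FromCategory.
Variables (C : minCY2 K) (o : I -> obj C).
Hypothesis o_inj : injective o.
Local Notation so := (fun x => o (src x)).
Local Notation to := (fun x => o (tgt x)).
Variable fr : frame (@Ext K C) so to (@dl I A).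
Local Notation cf := (fr_cf fr).
Local Notation bas := (fr_bas fr).
Local Notation ev := (@ev K (obj C) (@Ext K C) X so to (@dl I A) fr).
Local Notation gpth := (@gpth (obj C) X so to).
Hypothesis bE : forall i j d e (a : Ext i j d) (a' : Ext j i e),
  suspended (@pairing K C) a a' = \sum_x ep x * (cf a x * cf a' (st x)).
Hypothesis bas_z : forall i, bas (zl i) (o i) (o i) 0 = idm (o i).

(** The coefficients of the operations of C in the frame, as the values at the
    letters of a derivation. *)
Definition bar_der (x : X) : P :=
  fun u => cf (op (dl x) (@chainw K (obj C) _ X so to _ fr u (o (src x)))) x.

Lemma op_mlin i j d x : mlin (fun c : chain (@Ext K C) i j => cf (op d c) x).
Proof. by move=> j' k' d' p r k a b; rewrite op_linear cf_lin. Qed.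

Lemma bar_der_nil x : bar_der x [::] = 0.
Proof. by rewrite /bar_der op_uncurved cf0. Qed.

Lemma sdeg_chainw u i : sdeg (@chainw K (obj C) _ X so to _ fr u i) = sdw u.
Proof. by elim: u i => [|x u IH] i /=; rewrite ?sdw_nil // IH sdw_cons dl_sd. Qed.

Lemma bar_der_sup x : sup (src x) (tgt x) (sd x - 1) (bar_der x).
Proof.
move=> u nz; have p : gpth (o (src x)) (endp to (o (src x)) u) u.
  apply: contraNT nz => /negbTE np; rewrite /bar_der.
  rewrite (mlin_rep fr (fun j => @op_mlin (o (src x)) j (dl x) x)).
  by rewrite ev_chainw np mul0r.
have et : endp to (o (src x)) u = o (tgt x).
  apply/eqP; apply: contraNT nz => ne; rewrite /bar_der cf_out //.
  by rewrite /fits eq_sym (negbTE ne) andbF.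
rewrite et gpthE // in p; split=> //.
apply/eqP; apply: contraNT nz => ne; rewrite /bar_der op_degree ?cf0 //.
by rewrite sdeg_chainw; apply: contraNneq ne; rewrite -dl_sd => ->; apply/eqP; ring.
Qed.

Lemma bar_der_op i j d (q : chain (@Ext K C) i j) x :
  cf (op d q) x = (dl x == d)%:R * ev q (bar_der x).
Proof.
have [<-{d}|/negbTE xd] := eqVneq (dl x) d; last first.
  by rewrite cf_out ?mul0r // /fits xd !andbF.
rewrite mul1r; have [e|ne] := eqVneq (o (src x)) i.
  by case: i / e q => q; rewrite (mlin_rep fr (fun j => @op_mlin (o (src x)) j (dl x) x)).
rewrite cf_out; last by rewrite /fits (negbTE ne).
apply/esym/eqP; apply: contraNT ne => /(ev_sup o_inj (@bar_der_sup x) (bar_der_nil x)).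
by case=> e _ _; rewrite e.
Qed.

Lemma bar_der_sqr x : der sg bar_der (bar_der x) = 0.
Proof.
apply: (ev_eq0 o_inj (fr := fr) (der_sup bar_der_sup (@bar_der_sup x))) => c.
rewrite (ev_insertion o_inj bar_der_sup bar_der_nil bar_der_op).
rewrite -[RHS](cf0 fr (o (src x)) (o (tgt x)) (dl x) x) -(op_ainf _ c) /insertion.
rewrite cf_sumE; apply: eq_bigr => s _; rewrite cf_sumE; apply: eq_bigr => t _.
by rewrite cfZ bar_der_op eqxx mul1r.
Qed.

Lemma chain_ends i j (c : chain (@Ext K C) i j) : (1 < sizec c)%N ->
  exists k l d e (a : Ext i k d) (c' : chain (@Ext K C) k l) (b : Ext l j e),
    c = consc a (catc c' (onec b)).
Proof.
have last_ i' j' (c' : chain (@Ext K C) i' j') : (0 < sizec c')%N ->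
    exists l e (c2 : chain (@Ext K C) i' l) (b : Ext l j' e), c' = catc c2 (onec b).
  elim: c' => [//|k l m d a c2 IH] _.
  case: c2 a IH => [l'|l' n m' d' a' c3] a IH; first by exists _, _, (nilc _), a.
  have [//|l1 [e1 [c2 [b ->]]]] := IH.
  by exists _, _, (consc a c2), b.
case: c => [//|{}i l {}j d a c'] /= /last_ [l1 [e1 [c2 [b ->]]]].
by exists _, _, _, _, a, c2, b.
Qed.

Lemma bar_der_ord x : ord 2 (bar_der x).
Proof.
case=> [|y [|//]] _; first exact: bar_der_nil.
by rewrite /bar_der [chainw _ _ _]/= [X in op _ X]/(onec _) op_minimal cf0.
Qed.

Lemma sgz_even (d : int) : (-1 : K) ^ ((d - 1) * d) = 1.
Proof.
have h (n : nat) : (-1 : K) ^ ((n%:Z - 1) * n) = 1.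
  elim: n => [|n IH]; first by rewrite mulr0 expr0z.
  rewrite (_ : _ * _ = (n%:Z - 1) * n + (n%:Z + n)); last by rewrite intS; ring.
  by rewrite sgzD IH sgzD sgz_sqr mul1r.
case: d => n; first exact: h.
rewrite NegzE (_ : _ * _ = (n.+2%:Z - 1) * n.+2) ?h //.
by rewrite !intS; ring.
Qed.

(** The sign in the cyclicity condition of C is trivial: where the pairing is
    nonzero, the exponent is (d - 1) d up to sign, which is even. *)
Lemma bar_der_omega : der sg bar_der omega = 0.
Proof.
have oo : ord 3 (der sg bar_der omega).
  by apply: (@der_ord _ _ 1 sg bar_der 2) bar_der_ord _; apply/homog_ord/homog_omega.
have omE : der sg bar_der omega = \sum_i der sg bar_der (@omega_at K I A sA star eps i).
  by rewrite (omega_sum sA) der_sum.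
rewrite omE big1 // => i _.
have os := @sup_omega_at K I A sA tA star eps sA_star tA_star i.
have ds := der_sup (tau := sg) bar_der_sup os.
apply: (ev_eq0 o_inj (fr := fr) ds) => c.
have -> : ev c (der sg bar_der (@omega_at K I A sA star eps i)) = ev c (der sg bar_der omega).
  rewrite omE (bigD1 i) //= evD [X in _ + X](_ : _ = 0) ?addr0 //.
  rewrite ev_sum big1 // => k ki; apply/eqP; apply: contraNT ki.
  have ks := @sup_omega_at K I A sA tA star eps sA_star tA_star k.
  have k0 : der sg bar_der (@omega_at K I A sA star eps k) [::] = 0.
    apply: (@der_ord _ _ 1 sg bar_der 2) => //; first exact: bar_der_ord.
    apply: ord_sum => x _; apply: ordZ; apply: (@ordM _ _ 1 1); exact: ord_letter.
  by move=> /(ev_sup o_inj (der_sup (tau := sg) bar_der_sup ks) k0) [/o_inj e _ _]; rewrite e.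
have [->//|nz] := eqVneq (ev c (der sg bar_der omega)) 0.
have [u [fu _ su _]] := ev_supp nz.
have sc : (1 < sizec c)%N.
  rewrite -su; apply/ltnW; rewrite ltnNge; apply: contra fu => u2; apply/eqP.
  by apply: oo; rewrite ltnS.
have [k [l [d [e [a [c' [b cE]]]]]]] := chain_ends sc.
rewrite cE (ev_der_omega o_inj bE bar_der_sup bar_der_nil bar_der_op).
rewrite pairing_cyclic.
set y := suspended _ _ _; have [->|ynz] := eqVneq y 0; first by rewrite mulr0 subrr.
rewrite (_ : _ ^ _ = 1) ?mul1r ?subrr //.
have e2 : sdeg (catc c' (onec b)) + 2 + d = 2.
  by apply/eqP; apply: contraNT ynz => ne; rewrite /y /suspended pairing_degree ?mulr0.
rewrite (_ : (d - 1) * _ = - ((d - 1) * d)) ?sgzN ?sgz_even //.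
by rewrite (_ : sdeg _ = - d); [ring|lia].
Qed.

Lemma letter2 (y z a b : X) : (L y * L z) [:: a; b] = (a == y)%:R * (b == z)%:R.
Proof. by rewrite lmul_cons /letter eqseq_cons andbT. Qed.

Lemma bar_der_zl x i (q : X) : i = src x -> src q = i -> tgt q = tgt x ->
  bar_der x [:: zl i; q] = (q == x)%:R.
Proof.
move=> ei es et; rewrite /bar_der /= -ei bas_z -[consc (bas q _ _ _) _]/(onec _).
have [e|ne] := eqVneq (dl x) (dl q).
  by rewrite e idm_l cf_bas /fits /= es !eqxx /= andbT.
rewrite op_degree ?cf0; first by case: (q =P x) ne => // ->; rewrite eqxx.
by rewrite /= (_ : _ + 2 = dl q) //; ring.
Qed.

Lemma bar_der_zr x i (p : X) : i = tgt x -> tgt p = i -> src p = src x ->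
  bar_der x [:: p; zl i] = - sg x * (p == x)%:R.
Proof.
move=> ei et es; rewrite /bar_der /=.
have -> : consc (bas (zl i) (o (tgt p)) (o i) 0) (nilc (o i)) = onec (bas (zl i) (o (tgt p)) (o i) 0) by [].
rewrite et bas_z.
have [e|ne] := eqVneq (dl x) (dl p).
  rewrite e idm_r cfZ cf_bas /fits /= es et !eqxx /= andbT -e; congr (_ * _).
  by rewrite -[dl x](subrK 1) dl_sd sgzD expr1z mulrN1.
rewrite op_degree ?cf0; first by case: (p =P x) ne => [->|_ _]; rewrite ?eqxx // mulr0.
by rewrite /= (_ : _ + 2 = dl p) //; ring.
Qed.

Lemma c2_zl x i (q : X) : i = src x -> src q = i -> tgt q = tgt x ->
  c2 x [:: zl i; q] = (q == x)%:R.
Proof.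
case: x => [[j|j]|a] /= -> es et.
- by rewrite -/(zl j) c2_z letter2 eqxx mul1r.
- rewrite -/(zl j) -/(wl j) c2_w omega_atE !addsE !letter2 sumsE big1 => [|b _].
    by rewrite eqxx mul1r mul0r !addr0.
  by rewrite scalesE letter2 mul0r mulr0.
- by rewrite -/(vl a) c2_v subsE !letter2 eqxx mul1r mul0r subr0.
Qed.

Lemma c2_zr x i (p : X) : i = tgt x -> tgt p = i -> src p = src x ->
  c2 x [:: p; zl i] = - sg x * (p == x)%:R.
Proof.
case: x => [[j|j]|a] /= -> et es.
- by rewrite -/(zl j) c2_z letter2 eqxx mulr1 sgzE opprK mul1r.
- rewrite -/(zl j) -/(wl j) c2_w omega_atE !addsE !letter2 sumsE big1 => [|b _].
    by rewrite eqxx mulr1 mulr0 add0r addr0 sgwE opprK mul1r.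
  by rewrite scalesE letter2 !mulr0.
- by rewrite -/(vl a) c2_v subsE !letter2 eqxx mulr1 mulr0 sub0r sgvE mulN1r.
Qed.

(** In the quadratic part, words with a letter z are given by the identities.  The
    only other words allowed by the degree are v_a v_b in the value at w; their
    coefficients are related, by cyclicity, to those of words with a z. *)
Lemma bar_der_c2 x : ord 3 (bar_der x - c2 x).
Proof.
move=> u u3; pose De y := bar_der y - c2 y.
have Ds y : sup (src y) (tgt y) (sd y - 1) (De y).
  by apply: supB; [exact: bar_der_sup|apply: sup_c2].
have Do : der sg De omega = 0.
  by rewrite derDl derNl bar_der_omega (c2_omega eps sA_star tA_star) subrr.
have [u2|] := leqP 2 (size u); last first.
  move=> u2; apply: (ordB (@bar_der_ord x) (ord_c2 sA tA star eps x)) u2.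
case: u u3 u2 => [|p [|q [|]]] // _ _.
rewrite -/(De x); have [//|nz] := eqVneq (De x [:: p; q]) 0.
have [/= /and3P[/eqP sp /eqP sq /eqP tq]] := Ds _ _ nz.
rewrite !sdw_cons sdw_nil addr0 => sdE.
have Dl y i (r : X) : i = src y -> src r = i -> tgt r = tgt y -> De y [:: zl i; r] = 0.
  by move=> h1 h2 h3; rewrite /De subsE bar_der_zl ?c2_zl ?subrr.
have Dr y i (r : X) : i = tgt y -> tgt r = i -> src r = src y -> De y [:: r; zl i] = 0.
  by move=> h1 h2 h3; rewrite /De subsE bar_der_zr ?c2_zr ?subrr.
have [pz|pz] := boolP (isz p).
  by case: p pz sp sq {nz sdE} => [[i|i]|a] //= _ sp sq; apply: Dl.
have [qz|qz] := boolP (isz q).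
  by case: q qz sq tq {nz sdE} => [[i|i]|a] //= _ sq tq; apply: Dr.
have : exists a b j, [/\ p = vl a, q = vl b & x = wl j].
  case: p pz sdE {sp sq nz} => [[i|i]|a] // _; case: q qz {tq} => [[k|k]|b] // _;
  case: x => [[j|j]|c] //= _; by exists a, b, j.
move=> [a [b [j [pE qE xE]]]]; move: sp sq tq {nz pz qz sdE}; rewrite pE qE xE /= => sp sq tq.
(* the coefficient of v_a v_b at w_j is, up to sign, that of v_b z_j at the
   letter dual to v_a *)
have := congr1 (fun f : P => f (vl a :: rcons [:: vl b] (zl j))) Do.
rewrite (der_omegaE starK eps_star) zeroE /= sgzE sgvE opprK !mul1r => <-.
rewrite -/(vl (star a)) Dr /= ?tA_star ?sA_star //.
by rewrite mulr0 addr0.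
Qed.

End FromCategory.
End SymplecticFrame.

(** * Morphisms as substitutions *)
Section Blocks.
Variables (K : fieldType) (C C' : minCY2 K) (s : obj C -> obj C').
Variables (X : finType) (so to : X -> obj C) (so' to' : X -> obj C') (dx : X -> int).
Variables (fr : frame (@Ext K C) so to dx) (fr' : frame (@Ext K C') so' to' dx).
Local Notation P := (series K X).
Local Notation ev' := (@ev K (obj C') (@Ext K C') X so' to' dx fr').
Local Notation ev := (@ev K (obj C) (@Ext K C) X so to dx fr).
Variables (F : component s) (phi : X -> P).
Hypothesis phi0 : forall x, phi x [::] = 0.
Hypothesis Fphi : forall i j (c : chain (@Ext K C) i j) x,
  fr_cf fr' (F (sdeg c + 1) c) x = ev c (phi x).

(** Partial evaluation of a series on an initial segment of a chain. *)
Fixpoint contr i j (p : chain (@Ext K C) i j) : P -> P :=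
  match p with
  | nilc _ => id
  | consc _ _ _ _ a p' => fun f => \sum_x fr_cf fr a x *: contr p' (lquo x f)
  end.

Lemma contr_nil i j (p : chain (@Ext K C) i j) f : contr p f [::] = ev p f.
Proof.
elim: p f => [//|{}i l {}j d a p IH] f /=.
by rewrite sumsE; apply: eq_bigr => x _; rewrite scalesE IH.
Qed.

Lemma contr_rcons i j k d (p : chain (@Ext K C) i j) (a : Ext j k d) f :
  contr (catc p (onec a)) f = \sum_x fr_cf fr a x *: lquo x (contr p f).
Proof.
elim: p a f => [//|{}i l {}j e b p IH] a f /=.
under eq_bigr => x _ do rewrite IH scaler_sumr.
rewrite exchange_big; apply: eq_bigr => y _; rewrite lquo_sum scaler_sumr.
by apply: eq_bigr => x _; rewrite lquoZ !scalerA mulrC.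
Qed.

Lemma ev_lin_sum i j (c : chain (@Ext K C) i j) (J : finType) (al : J -> K) (G : J -> P) :
  \sum_y al y * ev c (G y) = ev c (\sum_y al y *: G y).
Proof. by rewrite ev_sum; apply: eq_bigr => y _; rewrite evZ. Qed.

(** The first block is already under construction: it consists of p and of an
    initial segment of c.  The recursion of the blocks matches the Leibniz rule
    for the first letter of c. *)
Lemma ev_blocks_from h i j (p : chain (@Ext K C) h i) (c : chain (@Ext K C) i j) g :
  \sum_(b <- blocks_from F p c) ev' b g =
  ev c (\sum_x contr p (phi x) * subst phi (lquo x g)).
Proof.
elim: c h p g => [{}i|{}i l {}j d a c IH] h p g.
  rewrite /= big_seq1 /= sumsE; apply: eq_bigr => x _.
  by rewrite muls_nil contr_nil Fphi.
rewrite [blocks_from _ _ _]/= big_cat big_map IH.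
have -> : \sum_(b <- blocks_from F (onec a) c)
    ev' (consc (F (sdeg p + 1) p) b) g =
  \sum_x ev p (phi x) * ev c (\sum_y contr (onec a) (phi y) * subst phi (lquo y (lquo x g))).
  transitivity (\sum_(b <- blocks_from F (onec a) c) \sum_x
    fr_cf fr' (F (sdeg p + 1) p) x * ev' b (lquo x g)); first by [].
  rewrite exchange_big; apply: eq_bigr => x _.
  by rewrite -IH mulr_sumr; apply: eq_bigr => b _; rewrite Fphi.
rewrite (ev_lin_sum c (fun x => ev p (phi x))) -[LHS]/(_ + _) -evD [RHS]/=.
rewrite (ev_lin_sum c (fr_cf fr a)); congr (ev c _).
under [RHS]eq_bigr => y _ do rewrite lquo_sum scaler_sumr.
rewrite exchange_big -big_split; apply: eq_bigr => x _ /=.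
rewrite contr_rcons mulr_suml.
under [RHS]eq_bigr => y _ do rewrite lquoM scalerDr contr_nil.
rewrite big_split /= addrC; congr (_ + _); last first.
  by apply: eq_bigr => y _; rewrite scalerAl.
have lq y : lquo y (subst phi (lquo x g)) =
    \sum_z lquo y (phi z) * subst phi (lquo z (lquo x g)).
  rewrite (substE phi0) lquoD lquoZ (_ : lquo y 1 = 0) // scaler0 add0r lquo_sum.
  by apply: eq_bigr => z _; rewrite lquoM phi0 scale0r add0r.
under [RHS]eq_bigr => y _ do rewrite lq scalerA mulrC -scalerA scaler_sumr.
rewrite -scaler_sumr; congr (_ *: _); rewrite exchange_big.
by apply: eq_bigr => z _; rewrite /= mulr_suml; apply: eq_bigr => y _; rewrite scalerAl.
Qed.

(** Cutting a chain into blocks and applying F to each of them is dual to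
    substitution. *)
Lemma ev_blocks i j (c : chain (@Ext K C) i j) g :
  \sum_(b <- blocks F c) ev' b g = ev c (subst phi g).
Proof.
case: c => [{}i|{}i l {}j d a c]; first by rewrite big_seq1.
rewrite [blocks _ _]/= ev_blocks_from.
have -> : subst phi g = g [::] *: 1 + \sum_x phi x * subst phi (lquo x g).
  exact: substE.
rewrite evD evZ ev_one_cons mulr0 add0r [RHS]/=.
rewrite (ev_lin_sum c (fr_cf fr a)); congr (ev c _).
under [RHS]eq_bigr => y _ do rewrite lquo_sum scaler_sumr.
rewrite exchange_big; apply: eq_bigr => x _; rewrite /= mulr_suml.
by apply: eq_bigr => y _; rewrite lquoM phi0 scale0r add0r scalerAl.
Qed.

End Blocks.

Section Isomorphism.
Variables (K : fieldType) (I A : finType).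
Variables (sA tA : A -> I) (star : A -> A) (eps : A -> K).
Hypothesis starK : involutive star.
Hypothesis sA_star : forall a, sA (star a) = tA a.
Hypothesis tA_star : forall a, tA (star a) = sA a.
Hypothesis eps_star : forall a, eps (star a) = - eps a.
Hypothesis eps_sqr : forall a, eps a * eps a = 1.

Local Notation X := (letters I A).
Local Notation P := (series K X).
Local Notation zl := (@zl I A).
Local Notation src := (@src I A sA).
Local Notation tgt := (@tgt I A tA).
Local Notation st := (@st I A star).
Local Notation sd := (@sd I A).
Local Notation L := (@letter K X).
Local Notation ep := (@ep K I A eps).
Local Notation sg := (@sg K I A).
Local Notation sup := (@sup K I A sA tA).
Implicit Types (f g h : P) (u p q r : seq X) (x y : X).

Local Notation omega := (@omega K I A star eps).

Hypothesis charK0 : [pchar K] =i pred0.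
Variables (C C' : minCY2 K) (o : I -> obj C) (s : obj C -> obj C').
Hypothesis o_inj : injective o.
Hypothesis s_bij : bijective s.
Local Notation so := (fun x => o (src x)).
Local Notation to := (fun x => o (tgt x)).
Local Notation so' := (fun x => s (o (src x))).
Local Notation to' := (fun x => s (o (tgt x))).
Variables (fr : frame (@Ext K C) so to (@dl I A)).
Variables (fr' : frame (@Ext K C') so' to' (@dl I A)).
Local Notation ev := (@ev K (obj C) (@Ext K C) X so to (@dl I A) fr).
Hypothesis bE : forall i j d e (a : Ext i j d) (a' : Ext j i e),
  suspended (@pairing K C) a a' = \sum_x ep x * (fr_cf fr a x * fr_cf fr a' (st x)).
Hypothesis bE' : forall i j d e (a : Ext i j d) (a' : Ext j i e),
  suspended (@pairing K C') a a' = \sum_x ep x * (fr_cf fr' a x * fr_cf fr' a' (st x)).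
Hypothesis bas_z : forall i, fr_bas fr (zl i) (o i) (o i) 0 = idm (o i).
Hypothesis bas_z' : forall i, fr_bas fr' (zl i) (s (o i)) (s (o i)) 0 = idm (s (o i)).

Local Notation o' := (fun i => s (o i)).
Local Notation D := (@bar_der K I A sA tA C o fr).
Local Notation D' := (@bar_der K I A sA tA C' o' fr').

Let s_inj := bij_inj s_bij.
Let o_inj' : injective o' := inj_comp s_inj o_inj.

Lemma fits_s x i j d : fits so' to' (@dl I A) x (s i) (s j) d = fits so to (@dl I A) x i j d.
Proof. by rewrite /fits !(inj_eq s_inj). Qed.

Section Component.
Variable phi : X -> P.
Hypothesis ps : forall x, sup (src x) (tgt x) (sd x) (phi x).
Hypothesis p1 : forall x, ord 2 (phi x - L x).
Let p0 := phi_nil p1.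

(** The morphism with the series phi x as coordinates. *)
Definition series_component : component s :=
  fun i j d c => \sum_x ev c (phi x) *: fr_bas fr' x (s i) (s j) d.

Lemma cf_component i j d (c : chain (@Ext K C) i j) x :
  fr_cf fr' (series_component d c) x = (dl x == d)%:R * ev c (phi x).
Proof.
rewrite cf_comb fits_s mulrC.
have [->|nz] := eqVneq (ev c (phi x)) 0; first by rewrite !mulr0.
have [ei ej _] := ev_sup o_inj (@ps x) (p0 x) nz.
congr (_ * _); congr (_%:R); congr (nat_of_bool _).
by rewrite /fits -ei -ej !eqxx.
Qed.

Lemma phi_deg i j (c : chain (@Ext K C) i j) x : ev c (phi x) != 0 -> dl x = sdeg c + 1.
Proof.
move=> /(ev_sup o_inj (@ps x) (p0 x)) [_ _ ->]; rewrite -dl_sd; ring.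
Qed.

Lemma cf_component_top i j (c : chain (@Ext K C) i j) x :
  fr_cf fr' (series_component (sdeg c + 1) c) x = ev c (phi x).
Proof.
rewrite cf_component; have [->|/phi_deg ->] := eqVneq (ev c (phi x)) 0; first by rewrite mulr0.
by rewrite eqxx mul1r.
Qed.

Lemma cf_component1 i j d (a : Ext i j d) x : fr_cf fr' (series_component d (onec a)) x = fr_cf fr a x.
Proof.
rewrite cf_component ev_onec (bigD1 x) //= big1 ?addr0.
  rewrite (_ : phi x [:: x] = 1) ?mulr1; last first.
    by have := @p1 x [:: x] isT; rewrite subsE /letter eqxx => /subr0_eq.
  have [fx|fx] := boolP (fits so to (@dl I A) x i j d); last by rewrite cf_out ?mulr0.
  by case/and3P: fx => _ _ /eqP ->; rewrite eqxx mul1r.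
move=> y yx; have := @p1 x [:: y] isT; rewrite subsE /letter eqseq_cons (negbTE yx) subr0.
by move=> ->; rewrite mulr0.
Qed.

Hypothesis pconj : forall x, der sg D (phi x) = subst phi (D' x).
Hypothesis pomega : subst phi omega = omega.

Lemma series_component_iso : cyclic_ainf_iso series_component.
Proof.
split.
- move=> i j d j1 k1 d1 p r k a b; apply: (@cf_inj _ _ _ _ _ _ _ fr') => x.
  by rewrite cf_lin !cf_component ev_mlin mulrDr mulrCA.
- move=> i j d c dc; apply: (@cf_inj _ _ _ _ _ _ _ fr') => x; rewrite cf0 cf_component.
  have [->|/phi_deg e] := eqVneq (ev c (phi x)) 0; first by rewrite mulr0.
  by rewrite e eq_sym (negbTE dc) mul0r.
- by move=> i d; apply: (@cf_inj _ _ _ _ _ _ _ fr') => x; rewrite cf0 cf_component /= p0 mulr0.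
- move=> i j d c; apply: (@cf_inj _ _ _ _ _ _ _ fr') => x.
  rewrite [RHS]cf_sumE.
  under [RHS]eq_bigr => b _ do rewrite (@bar_der_op K I A sA tA C' o' o_inj' fr').
  rewrite -mulr_sumr (ev_blocks p0 cf_component_top) -pconj.
  rewrite (ev_insertion o_inj (fun x => @bar_der_sup K I A sA tA C o o_inj fr x) (bar_der_nil fr) (bar_der_op o_inj fr)).
  rewrite /insertion cf_sumE mulr_sumr; apply: eq_bigr => t _.
  rewrite cf_sumE mulr_sumr; apply: eq_bigr => v _.
  by rewrite cfZ cf_component mulrCA.
- move=> i j d; exists (fun a' => \sum_x fr_cf fr' a' x *: fr_bas fr x i j d).
    move=> a; rewrite [RHS](cf_sum fr); apply: eq_bigr => x _.
    by rewrite cf_component1.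
  move=> a'; apply: (@cf_inj _ _ _ _ _ _ _ fr') => x; rewrite cf_component1 cf_comb.
  have [fx|fx] := boolP (fits so to (@dl I A) x i j d); first by rewrite mulr1.
  by rewrite mulr0 cf_out // fits_s.
- move=> i j d e a b.
  have h : suspended (@pairing K C') (series_component d (onec a)) (series_component e (onec b)) =
      suspended (@pairing K C) a b.
    by rewrite bE bE'; apply: eq_bigr => x _; rewrite !cf_component1.
  have u : (-1 : K) ^ d != 0 by rewrite expfz_eq0 oppr_eq0 oner_eq0 andbF.
  exact: (mulfI u h).
move=> i c c3.
under eq_bigr => t _.
  rewrite bE'; under eq_bigr => x _ do rewrite !cf_component_top.
  over.
rewrite exchange_big.
have -> : \sum_x \sum_(t <- cuts c) ep x *
    (ev (projT2 t).1 (phi x) * ev (projT2 t).2 (phi (st x))) = ev c (subst phi omega).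
  rewrite (subst_omega star eps p0) ev_sum; apply: eq_bigr => x _.
  by rewrite evZ ev_mul mulr_sumr.
rewrite pomega; apply/eqP/negPn/negP => /ev_supp [u [+ _ su _]].
by rewrite (homog_omega star eps) ?eqxx // su; case: (sizec c) c3 => [|[|[|n]]].
Qed.

End Component.

(** Two categories with frames in which the pairings have the same Gram matrix
    and the identities are the letters z are equivalent. *)
Theorem framed_equivalence : CY_equivalent C C'.
Proof.
exists s; split=> //.
have [phi [ps p1 po pc]] := conjugation starK sA_star tA_star eps_star eps_sqr charK0
  (fun x => @bar_der_sup K I A sA tA C o o_inj fr x)
  (fun x => @bar_der_c2 K I A sA tA star eps starK sA_star tA_star eps_star C o o_inj fr bE bas_z x)
  (bar_der_sqr o_inj fr)
  (bar_der_omega starK sA_star tA_star eps_star o_inj bE)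
  (fun x => @bar_der_c2 K I A sA tA star eps starK sA_star tA_star eps_star C' o' o_inj' fr' bE' bas_z' x)
  (@bar_der_sqr K I A sA tA C' o' o_inj' fr')
  (@bar_der_omega K I A sA tA star eps starK sA_star tA_star eps_star C' o' o_inj' fr' bE')
  (fun x => @bar_der_sup K I A sA tA C' o' o_inj' fr' x).
by exists (series_component phi); apply: series_component_iso.
Qed.

End Isomorphism.

(** * Frames of simple collections *)
Section SimpleFrame.
Variables (K : fieldType) (I A : finType).
Variables (sA tA : A -> I) (star : A -> A) (eps : A -> K).
Hypothesis starK : involutive star.
Hypothesis sA_star : forall a, sA (star a) = tA a.
Hypothesis tA_star : forall a, tA (star a) = sA a.
Hypothesis eps_star : forall a, eps (star a) = - eps a.
Hypothesis eps_sqr : forall a, eps a * eps a = 1.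

Local Notation X := (letters I A).
Local Notation P := (series K X).
Local Notation zl := (@zl I A).
Local Notation wl := (@wl I A).
Local Notation vl := (@vl I A).
Local Notation src := (@src I A sA).
Local Notation tgt := (@tgt I A tA).
Local Notation st := (@st I A star).
Local Notation ep := (@ep K I A eps).
Local Notation c0 := (@c0 K I A sA star eps).
Implicit Types (f g h : P) (u p q r : seq X) (x y : X).

Variables (C : minCY2 K) (simpleC : simple_collection C) (o : I -> obj C).
Hypothesis o_bij : bijective o.
Let o_inj := bij_inj o_bij.
Local Notation so := (fun x => o (src x)).
Local Notation to := (fun x => o (tgt x)).
Local Notation sus := (suspended (@pairing K C)).
Local Notation fitx := (fits so to (@dl I A)).

Variable vv : A -> forall i j : obj C, Ext i j 1.
Hypothesis vv_out : forall a i j,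
  ~~ ((o (sA a) == i) && (o (tA a) == j)) -> vv a i j = 0.
Hypothesis vv_gram : forall a b i j,
  o (sA a) = i -> o (tA a) = j -> o (sA b) = j -> o (tA b) = i ->
  sus (vv a i j) (vv b j i) = eps a * (b == star a)%:R.
Hypothesis vv_span : forall i j (b : Ext i j 1),
  exists be : A -> K, b = \sum_a be a *: vv a i j.

Lemma pairingDl (i j : obj C) (d e : int) (a a' : Ext i j d) (b : Ext j i e) :
  pairing (a + a') b = pairing a b + pairing a' b.
Proof. by rewrite -[a]scale1r pairing_linear mul1r scale1r. Qed.
Lemma pairing0l (i j : obj C) (d e : int) (b : Ext j i e) : pairing (0 : Ext i j d) b = 0.
Proof. by apply: (addrI (pairing (0 : Ext i j d) b)); rewrite -pairingDl !addr0. Qed.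
Lemma pairingZl (i j : obj C) (d e : int) k (a : Ext i j d) (b : Ext j i e) :
  pairing (k *: a) b = k * pairing a b.
Proof. by rewrite -[k *: a]addr0 pairing_linear pairing0l addr0. Qed.
Lemma pairing_suml (i j : obj C) (d e : int) (J : Type) (r : seq J) (Q : pred J) (F : J -> Ext i j d)
    (b : Ext j i e) :
  pairing (\sum_(k <- r | Q k) F k) b = \sum_(k <- r | Q k) pairing (F k) b.
Proof. by elim/big_rec2: _ => [|k y a _ <-]; rewrite ?pairing0l ?pairingDl. Qed.
Lemma pairingZr (i j : obj C) (d e : int) k (a : Ext i j d) (b : Ext j i e) :
  pairing a (k *: b) = k * pairing a b.
Proof. by rewrite pairing_sym pairingZl mulrCA -pairing_sym. Qed.
Lemma pairing_sumr (i j : obj C) (d e : int) (J : Type) (r : seq J) (Q : pred J) (F : J -> Ext j i e)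
    (a : Ext i j d) :
  pairing a (\sum_(k <- r | Q k) F k) = \sum_(k <- r | Q k) pairing a (F k).
Proof.
rewrite pairing_sym pairing_suml mulr_sumr; apply: eq_bigr => k _.
by rewrite -pairing_sym.
Qed.
Lemma pairing0r (i j : obj C) (d e : int) (a : Ext i j d) : pairing a (0 : Ext j i e) = 0.
Proof. by rewrite pairing_sym pairing0l mulr0. Qed.

Lemma idm_span (i : obj C) (b : Ext i i 0) : exists k : K, b = k *: idm i.
Proof.
have /andP[/eqP sp _] := Ext0_diag simpleC i.
have : b \in {:Ext i i 0}%VS by apply: memvf.
by rewrite -sp span_seq1 => /vlineP [k ->]; exists k.
Qed.

Lemma idm_neq0 (i : obj C) : idm i != 0.
Proof.
by have /andP[_] := Ext0_diag simpleC i; rewrite free_cons /= span_nil memv0 => /andP[].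
Qed.

Lemma dual_idm (i : obj C) : exists w : Ext i i 2, pairing (idm i) w == 1.
Proof.
have [w nz] : exists w : Ext i i (2 - 0), pairing (idm i) w != 0.
  apply/not_existsP => h; case/eqP: (idm_neq0 i).
  apply: pairing_nondegenerate => b; apply/eqP/negPn/negP => nz; exact: (h b nz).
exists ((pairing (idm i) w)^-1 *: (w : Ext i i 2)).
by rewrite pairingZr mulVf.
Qed.

(** A class in degree 2 dual to the identity. *)
Definition wv (i : obj C) : Ext i i 2 := xchoose (dual_idm i).
Lemma wvE i : pairing (idm i) (wv i) = 1.
Proof. exact/eqP/(xchooseP (dual_idm i)). Qed.

Lemma Ext_ge3 (i j : obj C) (d : int) (a : Ext i j d) : 2 < d -> a = 0.
Proof.
move=> d2; apply: pairing_nondegenerate => b.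
by rewrite (Ext_neg simpleC _ b) ?pairing0r //; lia.
Qed.

Let E3 (t : obj C * obj C * int) := Ext t.1.1 t.1.2 t.2.

(** The comparisons of indices with their transports make each basis vector
    available in every space Ext i j d, where it is zero unless the letter
    fits. *)
Definition bsx (x : X) (i j : obj C) (d : int) : Ext i j d :=
  match x with
  | inl (inl k) => if ((o k, o k, 0 : int) =P (i, j, d)) is ReflectT e
                   then ecast t (E3 t) e (idm (o k)) else 0
  | inl (inr k) => if ((o k, o k, 2 : int) =P (i, j, d)) is ReflectT e
                   then ecast t (E3 t) e (wv (o k)) else 0
  | inr a => if ((1 : int) =P d) is ReflectT e
             then ecast d (Ext i j d) e (vv a i j) else 0
  end.

Lemma bsx_z k : bsx (zl k) (o k) (o k) 0 = idm (o k).
Proof. by rewrite /bsx /=; case: eqP => // e; rewrite (eq_irrelevance e erefl). Qed.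
Lemma bsx_w k : bsx (wl k) (o k) (o k) 2 = wv (o k).
Proof. by rewrite /bsx /=; case: eqP => // e; rewrite (eq_irrelevance e erefl). Qed.
Lemma bsx_v a i j : bsx (vl a) i j 1 = vv a i j.
Proof. by rewrite /bsx /=; case: eqP => // e; rewrite (eq_irrelevance e erefl). Qed.

Lemma bsx_out x (i j : obj C) (d : int) : ~~ fitx x i j d -> bsx x i j d = 0.
Proof.
case: x => [[k|k]|a]; rewrite /bsx /fits /=.
- by move=> h; case: eqP => // e; case/negP: h; case: e => <- <- <-; rewrite !eqxx.
- by move=> h; case: eqP => // e; case/negP: h; case: e => <- <- <-; rewrite !eqxx.
move=> h; case: eqP => // e; case: d / e h => /=; rewrite eqxx andbT; exact: vv_out.
Qed.

Lemma bsx_gram x y (i j : obj C) (d e : int) :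
  sus (bsx x i j d) (bsx y j i e) =
  (fitx x i j d && fitx y j i e)%:R * (ep x * (y == st x)%:R).
Proof.
have [fx|fx] := boolP (fitx x i j d); last first.
  by rewrite (bsx_out fx) /suspended pairing0l mulr0 mul0r.
have [fy|fy] := boolP (fitx y j i e); last first.
  by rewrite (bsx_out fy) /suspended pairing0r mulr0 mul0r.
rewrite mul1r; have [de|/eqP de] := boolP (d + e == 2); last first.
  rewrite /suspended pairing_degree ?mulr0; last exact/eqP.
  case: (y =P _) => [yx|_]; last by rewrite mulr0.
  case/and3P: fx => _ _ /eqP dx; case/and3P: fy => _ _ /eqP dy; case: de.
  by rewrite -dx -dy yx; case: (x) => [[k|k]|a].
case: x fx => [[k|k]|a] /and3P[/eqP /= ei /eqP ej /eqP ed];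
case: y fy => [[l|l]|b] /and3P[/eqP /= ei' /eqP ej' /eqP ed'];
move: de; rewrite -?ed -?ed' // => _.
- have kl : l = k by apply: o_inj; rewrite ei' -ej.
  rewrite kl eqxx mulr1; case: i / ei ej ei' ej' => ej ei' ej'.
  case: j / ej ei' ej' => _ _; case: d / ed; case: e / ed'.
  have h : sus (bsx (zl k) (o k) (o k) 0) (bsx (wl k) (o k) (o k) 2) = 1.
    by rewrite bsx_z bsx_w /suspended expr0z mul1r wvE.
  exact: h.
- have kl : l = k by apply: o_inj; rewrite ei' -ej.
  rewrite kl eqxx mulr1; case: i / ei ej ei' ej' => ej ei' ej'.
  case: j / ej ei' ej' => _ _; case: d / ed; case: e / ed'.
  have h : sus (bsx (wl k) (o k) (o k) 2) (bsx (zl k) (o k) (o k) 0) = 1.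
    rewrite bsx_z bsx_w /suspended pairing_sym wvE mulr1.
    by rewrite mulr0 expr0z mulr1 -exprnP sqrrN expr1n.
  exact: h.
case: d / ed; case: e / ed'.
have h : sus (bsx (vl a) i j 1) (bsx (vl b) j i 1) = eps a * (b == star a)%:R.
  by rewrite !bsx_v vv_gram.
exact: h.
Qed.

Lemma bsx_span (i j : obj C) (d : int) (b : Ext i j d) :
  exists be : X -> K, b = \sum_x be x *: bsx x i j d.
Proof.
have zero : b = 0 -> exists be : X -> K, b = \sum_x be x *: bsx x i j d.
  by move=> ->; exists (fun=> 0); rewrite big1 // => x _; rewrite scale0r.
have one x0 k : b = k *: bsx x0 i j d -> exists be : X -> K, b = \sum_x be x *: bsx x i j d.
  move=> ->; exists (fun x => if x == x0 then k else 0).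
  rewrite (bigD1 x0) //= eqxx big1 ?addr0 // => x /negbTE ->.
  by rewrite scale0r.
have [g og go] := o_bij.
have [d0|] := ltP d 0; first by apply: zero; apply: Ext_neg.
have [d2|d2] := ltP 2 d; first by move=> _; apply: zero; apply: Ext_ge3.
move=> d0; have : [\/ d = 0, d = 1 | d = 2].
  by case: d d0 d2 b zero one => [[|[|[|n]]]|n] // *; [constructor 1|constructor 2|constructor 3].
case=> e; move: b zero one; rewrite e => b zero one {d d0 d2 e}.
- have [ij|ij] := eqVneq i j; last by apply: zero; apply: Ext0_offdiag ij _.
  case: j / ij b zero one => b _ one.
  have [k bk] := idm_span b; apply: (one (zl (g i)) k).
  by have := bsx_z (g i); rewrite go bk => ->.
- have [be bE] := vv_span b.
  exists (fun x => if x is inr a then be a else 0).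
  rewrite !big_sumType /= big1 ?add0r; last by move=> k _; rewrite scale0r.
  rewrite big1 ?add0r; last by move=> k _; rewrite scale0r.
  by rewrite {1}bE; apply: eq_bigr => a _; congr (_ *: _); exact: (esym (bsx_v a i j)).
have [ij|ij] := eqVneq i j; last first.
  apply: zero; apply: pairing_nondegenerate => b'.
  by rewrite (Ext0_offdiag simpleC _ (b' : Ext j i 0)) ?pairing0r // eq_sym.
case: j / ij b zero one => b _ one.
apply: (one (wl (g i)) (pairing b (idm i))).
have -> : bsx (wl (g i)) i i 2 = wv i by have := bsx_w (g i); rewrite go.
apply/eqP; rewrite -subr_eq0; apply/eqP; apply: pairing_nondegenerate => b'.
have [k ->] := idm_span (b' : Ext i i 0).
have wi : pairing (wv i) (idm i) = 1.
  by rewrite pairing_sym wvE mulr1 mulr0 expr0z.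
by rewrite -scaleN1r pairingDl !pairingZr !pairingZl wi; ring.
Qed.

(** Coordinates are read off by pairing with the dual basis vector. *)
Definition cfs (i j : obj C) (d : int) (a : Ext i j d) (x : X) : K :=
  ep x * sus a (bsx (st x) j i (2 - d)).

Lemma fits_st x (i j : obj C) (d : int) : fitx (st x) j i (2 - d) = fitx x i j d.
Proof.
rewrite /fits (src_st sA_star) (tgt_st tA_star) andbCA; congr [&& _, _ & _].
by case: x => [[k|k]|a] /=; lia.
Qed.

Lemma cfs_bas (i j : obj C) (d : int) x y : cfs (bsx x i j d) y = ((x == y) && fitx x i j d)%:R.
Proof.
rewrite /cfs bsx_gram (inj_eq (inv_inj (stK starK))) fits_st.
case: (y =P x) => [->|yx]; last first.
  by rewrite !mulr0 (_ : (x == y) = false) //; apply/eqP => e; apply: yx.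
rewrite eqxx andbb /= mulr1 mulrCA (ep_sqr eps_sqr) mulr1 //.
Qed.

Lemma cfs_lin (i j : obj C) (d : int) k (a b : Ext i j d) x :
  cfs (k *: a + b) x = k * cfs a x + cfs b x.
Proof. by rewrite /cfs /suspended pairing_linear; ring. Qed.

Lemma cfs_out (i j : obj C) (d : int) (a : Ext i j d) x : ~~ fitx x i j d -> cfs a x = 0.
Proof. by rewrite -fits_st => /bsx_out e; rewrite /cfs e /suspended pairing0r !mulr0. Qed.

Lemma cfs_sum (i j : obj C) (d : int) (a : Ext i j d) : a = \sum_x cfs a x *: bsx x i j d.
Proof.
have cD (b b' : Ext i j d) x : cfs (b + b') x = cfs b x + cfs b' x.
  by rewrite -[b]scale1r cfs_lin mul1r scale1r.
have c0 x : cfs (0 : Ext i j d) x = 0.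
  by apply: (addrI (cfs (0 : Ext i j d) x)); rewrite -cD !addr0.
have [be aE] := bsx_span a.
rewrite {1}aE; apply: eq_bigr => x _.
have -> : cfs a x = \sum_y cfs (be y *: bsx y i j d) x.
  by rewrite aE; elim/big_rec2: _ => [|y u v _ <-]; rewrite ?c0 ?cD.
have cZ y : cfs (be y *: bsx y i j d) x = be y * cfs (bsx y i j d) x.
  by rewrite -[be y *: _]addr0 cfs_lin c0 addr0.
rewrite (bigD1 x) //= cZ cfs_bas eqxx big1 ?addr0; last first.
  by move=> y yx; rewrite cZ cfs_bas (negbTE yx) mulr0.
by case: (boolP (fitx x i j d)) => [_|/bsx_out ->]; rewrite ?mulr1 ?scaler0.
Qed.

Definition simple_frame : frame (@Ext K C) so to (@dl I A) :=
  Frame cfs_lin cfs_out cfs_bas cfs_sum.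

Lemma simple_frame_pairing (i j : obj C) (d e : int) (a : Ext i j d) (b : Ext j i e) :
  sus a b = \sum_x ep x * (fr_cf simple_frame a x * fr_cf simple_frame b (st x)).
Proof.
rewrite {1}(cfs_sum a) /suspended pairing_suml mulr_sumr; apply: eq_bigr => x _ /=.
rewrite pairingZl {1}(cfs_sum b) pairing_sumr mulr_sumr mulr_sumr (bigD1 (st x)) //= big1 ?addr0.
  rewrite pairingZr; have := bsx_gram x (st x) i j d e; rewrite /suspended => g.
  have -> : (-1) ^ d * (cfs a x * (cfs b (st x) * pairing (bsx x i j d) (bsx (st x) j i e))) =
     cfs a x * (cfs b (st x) * ((-1) ^ d * pairing (bsx x i j d) (bsx (st x) j i e))) by ring.
  rewrite g eqxx mulr1; have [fx|fx] := boolP (fitx x i j d); last by rewrite cfs_out ?mul0r ?mulr0.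
  have [fy|fy] := boolP (fitx (st x) j i e); last by rewrite [cfs b _]cfs_out // !(mul0r, mulr0).
  by rewrite mul1r; ring.
move=> y yx; rewrite pairingZr; have := bsx_gram x y i j d e; rewrite /suspended => g.
have -> : (-1) ^ d * (cfs a x * (cfs b y * pairing (bsx x i j d) (bsx y j i e))) =
   cfs a x * (cfs b y * ((-1) ^ d * pairing (bsx x i j d) (bsx y j i e))) by ring.
by rewrite g (negbTE yx) !mulr0.
Qed.

Lemma simple_frame_z i : fr_bas simple_frame (zl i) (o i) (o i) 0 = idm (o i).
Proof. exact: bsx_z. Qed.

End SimpleFrame.

(** * Dual and symplectic bases *)
Section DualBases.
Variable K : fieldType.

Lemma last_nat (Q : nat -> Prop) N : Q 0%N -> (forall m, Q m -> (m <= N)%N) ->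
  exists2 m, Q m & ~ Q m.+1.
Proof.
move=> Q0 QN; have ex : exists m, `[< Q m >] by exists 0%N; apply/asboolP.
have bd m : `[< Q m >] -> (m <= N)%N by move/asboolP; apply: QN.
case: (ex_maxnP ex bd) => m /asboolP Qm mx; exists m => // /asboolP /mx.
by rewrite ltnn.
Qed.

(** A family with a biorthogonal family of functionals is linearly
    independent. *)
Lemma free_dual_dim (V : vectType K) (n : nat) (u : nat -> V) (phi : nat -> V -> K) (c : nat -> K) :
  (forall l k (a b : V), phi l (k *: a + b) = k * phi l a + phi l b) ->
  (forall k l, (k < n)%N -> (l < n)%N -> phi l (u k) = c k * (l == k)%:R) ->
  (forall k, c k != 0) ->
  (n <= \dim {:V})%N.
Proof.
move=> phiP phiu cn0.
have phi0 l : phi l 0 = 0.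
  by apply: (addrI (1 * phi l 0)); rewrite -phiP scale1r !addr0 mul1r.
pose t := [tuple u (val k) | k < n].
have : free t.
  apply/freeP => k e0 i.
  have : phi i (\sum_(j < n) k j *: t`_j) = 0 by rewrite e0 phi0.
  have -> : phi i (\sum_(j < n) k j *: t`_j) = \sum_(j < n) k j * phi i (u j).
    under eq_bigr => j _ do rewrite -tnth_nth tnth_mktuple.
    elim/big_rec2: _ => [|j y a _ <-]; first exact: phi0.
    by rewrite phiP.
  rewrite (bigD1 i) //= phiu // eqxx big1 ?addr0 ?mulr1; last first.
    by move=> j ji; rewrite phiu // eq_sym (_ : (j : nat) == i = false) ?mulr0 //; apply/negbTE.
  by move/eqP; rewrite mulf_eq0 (negbTE (cn0 _)) orbF => /eqP.
rewrite /free => /eqP e; have := dimvS (subvf <<t>>%VS).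
by rewrite e size_tuple.
Qed.

Lemma spanning_dim (V : vectType K) (n : nat) (u : nat -> V) :
  (forall v : V, exists be : nat -> K, v = \sum_(k < n) be k *: u k) ->
  (\dim {:V} <= n)%N.
Proof.
move=> sp; pose t := [tuple u (val k) | k < n].
have : ({:V} <= <<t>>)%VS.
  apply/subvP => v _; have [be ->] := sp v.
  apply: memv_suml => k _; apply/memvZ/memv_span.
  by apply/mapP; exists k; rewrite ?mem_enum.
move/dimvS => h; apply: leq_trans h _; apply: leq_trans (dim_span _) _.
by rewrite size_tuple.
Qed.

Section Form.
Variables (V V' : vectType K) (B : V -> V' -> K).
Hypothesis BDl : forall k a a' b, B (k *: a + a') b = k * B a b + B a' b.
Hypothesis BDr : forall k a b b', B a (k *: b + b') = k * B a b + B a b'.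
Hypothesis Bnd : forall a, (forall b, B a b = 0) -> a = 0.
Hypothesis Bnd' : forall b, (forall a, B a b = 0) -> b = 0.

Lemma form0l b : B 0 b = 0.
Proof. by apply: (addrI (1 * B 0 b)); rewrite -BDl scale1r !addr0 mul1r. Qed.
Lemma form0r a : B a 0 = 0.
Proof. by apply: (addrI (1 * B a 0)); rewrite -BDr scale1r !addr0 mul1r. Qed.
Lemma formDl a a' b : B (a + a') b = B a b + B a' b.
Proof. by rewrite -[a]scale1r BDl mul1r scale1r. Qed.
Lemma formDr a b b' : B a (b + b') = B a b + B a b'.
Proof. by rewrite -[b]scale1r BDr mul1r scale1r. Qed.
Lemma formZl k a b : B (k *: a) b = k * B a b.
Proof. by rewrite -[k *: a]addr0 BDl form0l addr0. Qed.
Lemma formZr k a b : B a (k *: b) = k * B a b.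
Proof. by rewrite -[k *: b]addr0 BDr form0r addr0. Qed.
Lemma formBl a a' b : B (a - a') b = B a b - B a' b.
Proof. by rewrite -scaleN1r formDl formZl mulN1r. Qed.
Lemma formBr a b b' : B a (b - b') = B a b - B a b'.
Proof. by rewrite -scaleN1r formDr formZr mulN1r. Qed.
Lemma form_suml n (F : nat -> V) (c : nat -> K) b :
  B (\sum_(k < n) c k *: F k) b = \sum_(k < n) c k * B (F k) b.
Proof. by elim/big_rec2: _ => [|k y a _ <-]; rewrite ?form0l ?BDl. Qed.
Lemma form_sumr n (F : nat -> V') (c : nat -> K) a :
  B a (\sum_(k < n) c k *: F k) = \sum_(k < n) c k * B a (F k).
Proof. by elim/big_rec2: _ => [|k y b _ <-]; rewrite ?form0r ?BDr. Qed.

Lemma sum_delta n (F : nat -> K) l : (l < n)%N ->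
  \sum_(k < n) F k * ((k : nat) == l)%:R = F l.
Proof.
move=> ln; rewrite (bigD1 (Ordinal ln)) //= eqxx mulr1 big1 ?addr0 // => k kl.
by rewrite (_ : (k : nat) == l = false) ?mulr0 //; apply/negbTE.
Qed.

Definition snoc (T : Type) (u : nat -> T) m x := fun k => if (k < m)%N then u k else x.

Lemma nondegenerate_dual (v : V) : v <> 0 -> exists w, B v w = 1.
Proof.
move=> v0; have [w nz] : exists w, B v w != 0.
  apply/not_existsP => h; apply: v0; apply: Bnd => b.
  by apply/eqP/negPn/negP => nz; exact: (h b nz).
by exists ((B v w)^-1 *: w); rewrite formZr mulVf.
Qed.

(** Take a biorthogonal pair of families of maximal length.  A vector not in the
    span could be corrected to one orthogonal to the second family and,
    together with a vector that it pairs with to 1, would extend the pair. *)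
Lemma dual_bases : exists (u : nat -> V) (w : nat -> V'),
  [/\ forall k l, (k < \dim {:V})%N -> (l < \dim {:V})%N -> B (u k) (w l) = (k == l)%:R,
      forall v, exists be : nat -> K, v = \sum_(k < \dim {:V}) be k *: u k,
      forall v, exists be : nat -> K, v = \sum_(k < \dim {:V}) be k *: w k &
      \dim {:V} = \dim {:V'}].
Proof.
pose dual m (u : nat -> V) (w : nat -> V') :=
  forall k l, (k < m)%N -> (l < m)%N -> B (u k) (w l) = (k == l)%:R.
have dual_dim m u w : dual m u w -> (m <= \dim {:V})%N.
  move=> d; apply: (@free_dual_dim V m u (fun l a => B a (w l)) (fun=> 1)).
  - by move=> l k a b; rewrite BDl.
  - by move=> k l km lm; rewrite d // mul1r eq_sym.
  by move=> _; apply: oner_neq0.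
have dual_dim' m u w : dual m u w -> (m <= \dim {:V'})%N.
  move=> d; apply: (@free_dual_dim V' m w (fun l a => B (u l) a) (fun=> 1)).
  - by move=> l k a b; rewrite BDr.
  - by move=> k l km lm; rewrite d // mul1r.
  by move=> _; apply: oner_neq0.
have [m [u [w d]] mx] : exists2 m, (exists u w, dual m u w) & ~ exists u w, dual m.+1 u w.
  apply: (@last_nat _ (\dim {:V})); first by exists (fun=> 0), (fun=> 0).
  by move=> m [u [w d]]; apply: dual_dim d.
have sp v0 : v0 = \sum_(k < m) B v0 (w k) *: u k.
  apply: contrapT => v0P; apply: mx.
  pose v := v0 - \sum_(k < m) B v0 (w k) *: u k.
  have vw l : (l < m)%N -> B v (w l) = 0.
    move=> lm; rewrite /v formBl (form_suml m u (fun k => B v0 (w k))).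
    rewrite (eq_bigr (fun k : 'I_m => B v0 (w k) * ((k : nat) == l)%:R)) ?(sum_delta (fun k => B v0 (w k))) ?subrr //.
    by move=> k _; rewrite d.
  have [w0 vw0] : exists w0, B v w0 = 1.
    by apply: nondegenerate_dual => /eqP; rewrite subr_eq0 => /eqP.
  pose w1 := w0 - \sum_(k < m) B (u k) w0 *: w k.
  have uw1 l : (l < m)%N -> B (u l) w1 = 0.
    move=> lm; rewrite /w1 formBr (form_sumr m w (fun k => B (u k) w0)).
    rewrite (eq_bigr (fun k : 'I_m => B (u k) w0 * ((k : nat) == l)%:R)) ?(sum_delta (fun k => B (u k) w0)) ?subrr //.
    by move=> k _; rewrite d // eq_sym.
  have vw1 : B v w1 = 1.
    rewrite /w1 formBr (form_sumr m w (fun k => B (u k) w0)) big1 ?subr0 //.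
    by move=> k _; rewrite vw ?mulr0.
  exists (snoc u m v), (snoc w m w1) => k l; rewrite /snoc !ltnS => km lm.
  case: ltnP => km'; case: ltnP => lm'.
  - exact: d.
  - by rewrite uw1 // (_ : k == l = false) //; apply/eqP; lia.
  - by rewrite vw // (_ : k == l = false) //; apply/eqP; lia.
  by rewrite vw1 (_ : k == l = true) //; apply/eqP; lia.
have spu v : exists be : nat -> K, v = \sum_(k < m) be k *: u k.
  by exists (fun k => B v (w k)); apply: sp.
have spw v : exists be : nat -> K, v = \sum_(k < m) be k *: w k.
  exists (fun k => B (u k) v); apply/eqP; rewrite -subr_eq0; apply/eqP; apply: Bnd' => a.
  rewrite (sp a) (form_suml m u (fun k => B a (w k))) big1 // => l _.
  rewrite formBr (form_sumr m w (fun k => B (u k) v)).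
  rewrite (eq_bigr (fun k : 'I_m => B (u k) v * ((k : nat) == l)%:R)) ?(sum_delta (fun k => B (u k) v)) ?subrr ?mulr0 //.
  by move=> k _; rewrite d // eq_sym.
have em : m = \dim {:V}.
  by apply/eqP; rewrite eqn_leq (dual_dim _ _ _ d) (spanning_dim spu).
have em' : m = \dim {:V'}.
  by apply/eqP; rewrite eqn_leq (dual_dim' _ _ _ d) (spanning_dim spw).
by exists u, w; rewrite -em; split=> //; rewrite -em'.
Qed.

End Form.
End DualBases.

(** The partner of the k-th vector in a symplectic basis of size h + h, ordered as
    e_0, .., f_0, .. *)
Definition half_swap (h k : nat) : nat := (if k < h then k + h else k - h)%N.

Section Symplectic.
Variables (K : fieldType) (V : vectType K) (B : V -> V -> K).
Hypothesis BDl : forall k a a' b, B (k *: a + a') b = k * B a b + B a' b.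
Hypothesis Balt : forall a b, B a b = - B b a.
Hypothesis Bnil : forall a, B a a = 0.
Hypothesis Bnd : forall a, (forall b, B a b = 0) -> a = 0.

(** As for [dual_bases], with a maximal hyperbolic family: a vector is projected
    to the orthogonal complement of the family. *)
Lemma symplectic_basis : exists (h : nat) (u : nat -> V),
  [/\ \dim {:V} = (h + h)%N,
      forall k l, (k < h + h)%N -> (l < h + h)%N ->
        B (u k) (u l) = (if (k < h)%N then 1 else -1) * (l == half_swap h k)%:R &
      forall v, exists be : nat -> K, v = \sum_(k < h + h) be k *: u k].
Proof.
have BDr k a b b' : B a (k *: b + b') = k * B a b + B a b'.
  by rewrite Balt BDl [in RHS]Balt [B a b']Balt; ring.
pose hyp m (e f : nat -> V) := forall k l, (k < m)%N -> (l < m)%N ->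
  [/\ B (e k) (f l) = (k == l)%:R, B (e k) (e l) = 0 & B (f k) (f l) = 0].
pose join m (e f : nat -> V) k := if (k < m)%N then e k else f (k - m)%N.
have joinP m e f : hyp m e f -> forall k l, (k < m + m)%N -> (l < m + m)%N ->
    B (join m e f k) (join m e f l) = (if (k < m)%N then 1 else -1) * (l == half_swap m k)%:R.
  move=> d k l km lm; rewrite /join /half_swap; case: ltnP => km'; case: ltnP => lm'.
  - have [_ -> _] := d k l km' lm'.
    by rewrite (_ : _ == _ = false) ?mulr0 //; apply/eqP; lia.
  - have [|-> _ _] := d k (l - m)%N km'; first by lia.
    by rewrite mul1r; congr (nat_of_bool _)%:R; lia.
  - rewrite Balt; have [|-> _ _] := d l (k - m)%N lm'; first by lia.
    by rewrite mulN1r; congr (- (nat_of_bool _)%:R); lia.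
  have [||_ _ ->] := d (k - m)%N (l - m)%N; try by lia.
  by rewrite (_ : _ == _ = false) ?mulr0 //; apply/eqP; lia.
have hyp_dim m e f : hyp m e f -> (m + m <= \dim {:V})%N.
  move=> d; apply: (@free_dual_dim K V _ (join m e f)
    (fun l a => B a (join m e f (half_swap m l))) (fun k => if (k < m)%N then 1 else -1)).
  - by move=> l k a b; rewrite BDl.
  - move=> k l km lm; rewrite (joinP _ _ _ d) //; last by rewrite /half_swap; case: (ltnP l m); lia.
    by congr (_ * (nat_of_bool _)%:R); rewrite /half_swap; case: (ltnP k m); case: (ltnP l m); lia.
  by move=> k; case: ifP; rewrite ?oppr_eq0 oner_neq0.
have [m [e [f d]] mx] : exists2 m, (exists e f, hyp m e f) & ~ exists e f, hyp m.+1 e f.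
  apply: (@last_nat _ (\dim {:V})); first by exists (fun=> 0), (fun=> 0).
  by move=> m [e [f d]]; apply: leq_trans (hyp_dim _ _ _ d); apply: leq_addr.
pose pr v := v - (\sum_(k < m) B v (f k) *: e k - \sum_(k < m) B v (e k) *: f k).
have pre v l : (l < m)%N -> B (pr v) (e l) = 0.
  move=> lm; rewrite /pr !(formBl BDl) (form_suml BDl m e (fun k => B v (f k)))
    (form_suml BDl m f (fun k => B v (e k))).
  rewrite big1 => [|k _]; last by have [_ -> _] := d k l (ltn_ord k) lm; rewrite mulr0.
  rewrite sub0r (eq_bigr (fun k : 'I_m => - B v (e k) * ((k : nat) == l)%:R)).
    by rewrite (sum_delta (fun k => - B v (e k))) // opprK subrr.
  by move=> k _; have [E _ _] := d l k lm (ltn_ord k); rewrite [B (f k) _]Balt E eq_sym; ring.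
have prf v l : (l < m)%N -> B (pr v) (f l) = 0.
  move=> lm; rewrite /pr !(formBl BDl) (form_suml BDl m e (fun k => B v (f k)))
    (form_suml BDl m f (fun k => B v (e k))).
  rewrite [X in _ - (_ - X)]big1 => [|k _]; last by have [_ _ ->] := d k l (ltn_ord k) lm; rewrite mulr0.
  rewrite subr0 (eq_bigr (fun k : 'I_m => B v (f k) * ((k : nat) == l)%:R)).
    by rewrite (sum_delta (fun k => B v (f k))) // subrr.
  by move=> k _; have [-> _ _] := d k l (ltn_ord k) lm.
have sp v0 : pr v0 = 0.
  apply: contrapT => v0P; apply: mx; set v := pr v0 in v0P.
  have [w0 vw0] := nondegenerate_dual BDr Bnd v0P.
  have vw : B v (pr w0) = 1.
    rewrite /pr !(formBr BDr) (form_sumr BDr m e (fun k => B w0 (f k)))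
      (form_sumr BDr m f (fun k => B w0 (e k))).
    by rewrite !big1 ?subr0 // => k _; rewrite ?pre ?prf ?mulr0.
  exists (snoc e m v), (snoc f m (pr w0)) => k l; rewrite /snoc !ltnS => km lm.
  case: ltnP => km'; case: ltnP => lm'.
  - exact: d.
  - split; first by rewrite Balt pre // oppr0 (_ : k == l = false) //; apply/eqP; lia.
      by rewrite Balt pre ?oppr0.
    by rewrite Balt prf ?oppr0.
  - by rewrite !prf // !pre // (_ : k == l = false) //; apply/eqP; lia.
  by rewrite vw !Bnil (_ : k == l = true) //; apply/eqP; lia.
exists m, (join m e f); split; last 1 first.
- move=> v; exists (fun k => if (k < m)%N then B v (f k) else - B v (e (k - m)%N)).
  move: (sp v) => /eqP; rewrite subr_eq0 => /eqP {1}->.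
  rewrite big_split_ord /= -sumrN; congr (_ + _); apply: eq_bigr => k _.
    by rewrite /join ltn_ord.
  by rewrite /join ltnNge leq_addr /= addKn scaleNr.
- apply/eqP; rewrite eqn_leq (hyp_dim _ _ _ d) andbT; apply: (@spanning_dim _ _ _ (join m e f)).
  move=> v; exists (fun k => if (k < m)%N then B v (f k) else - B v (e (k - m)%N)).
  move: (sp v) => /eqP; rewrite subr_eq0 => /eqP {1}->.
  rewrite big_split_ord /= -sumrN; congr (_ + _); apply: eq_bigr => k _.
    by rewrite /join ltn_ord.
  by rewrite /join ltnNge leq_addr /= addKn scaleNr.
exact: joinP.
Qed.

End Symplectic.

(** * The pairing in degree one *)
Section DegreeOne.
Variables (K : fieldType) (charK0 : [pchar K] =i pred0) (C : minCY2 K).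
Local Notation sus := (suspended (@pairing K C)).

Lemma sus1_linear (i j : obj C) k (a a' : Ext i j 1) (b : Ext j i 1) :
  sus (k *: a + a') b = k * sus a b + sus a' b.
Proof. by rewrite /suspended pairing_linear; ring. Qed.

Lemma sus1_anti (i j : obj C) (a : Ext i j 1) (b : Ext j i 1) : sus a b = - sus b a.
Proof. by rewrite /suspended pairing_sym mulr1 expr1z; ring. Qed.

Lemma sus1_linear_r (i j : obj C) k (a : Ext i j 1) (b b' : Ext j i 1) :
  sus a (k *: b + b') = k * sus a b + sus a b'.
Proof. by rewrite sus1_anti sus1_linear [in RHS]sus1_anti [sus a b']sus1_anti; ring. Qed.

Lemma sus1_nd (i j : obj C) (a : Ext i j 1) : (forall b : Ext j i 1, sus a b = 0) -> a = 0.
Proof.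
move=> h; apply: pairing_nondegenerate => b; apply: oppr_inj; rewrite oppr0.
by have := h b; rewrite /suspended expr1z mulN1r.
Qed.

Lemma sus1_nd_r (i j : obj C) (b : Ext j i 1) : (forall a : Ext i j 1, sus a b = 0) -> b = 0.
Proof. by move=> h; apply: sus1_nd => a; rewrite sus1_anti h oppr0. Qed.

Lemma sus1_nil (i : obj C) (a : Ext i i 1) : sus a a = 0.
Proof.
have /eqP := sus1_anti a a; rewrite -subr_eq0 opprK -mulr2n -mulr_natl mulf_eq0.
by rewrite (negbTE (natr_neq0 charK0 _)) // => /eqP.
Qed.

Definition ext1_dual (i j : obj C) :=
  dual_bases (@sus1_linear i j) (@sus1_linear_r i j) (@sus1_nd i j) (@sus1_nd_r i j).

Definition ext1_symplectic (i : obj C) :=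
  symplectic_basis (@sus1_linear i i) (@sus1_anti i i) (@sus1_nil i) (@sus1_nd i i).

Lemma ext1_dim_sym (i j : obj C) : \dim {:Ext i j 1} = \dim {:Ext j i 1}.
Proof. by have [u [w []]] := ext1_dual i j. Qed.

Lemma ext1_dim_even (i : obj C) : ~~ odd (\dim {:Ext i i 1}).
Proof. by have [h [u [-> _ _]]] := ext1_symplectic i; rewrite addnn odd_double. Qed.

End DegreeOne.

(** * Standard indexing of the arrows *)
Section StandardLetters.
Variables (K : fieldType) (I : finType) (n : I -> I -> nat).
Hypothesis n_sym : forall i j, n i j = n j i.
Hypothesis n_even : forall i, ~~ odd (n i i).

(** The k-th arrow from i to j, for k < n i j. *)
Definition arrow_letter : finType := {p : I * I & 'I_(n p.1 p.2)}.

Definition ar_src (a : arrow_letter) : I := (tag a).1.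
Definition ar_tgt (a : arrow_letter) : I := (tag a).2.
Definition ar_num (a : arrow_letter) : nat := tagged a.

Lemma arrow_letterP (a b : arrow_letter) :
  ar_src a = ar_src b -> ar_tgt a = ar_tgt b -> ar_num a = ar_num b -> a = b.
Proof.
case: a b => [[i j] k] [[i' j'] k']; rewrite /ar_src /ar_tgt /ar_num /= => ei ej.
by case: i' / ei k' => k'; case: j' / ej k' => k' /val_inj ->.
Qed.

(** Arrows between distinct vertices are matched with the arrow of the same
    number in the opposite direction, and loops in symplectic pairs. *)
Definition partner (i j : I) (k : nat) : nat :=
  if i == j then half_swap (n i i)./2 k else k.

(** A sign that is opposite for partners; between distinct vertices it records an
    arbitrary order of the vertices. *)
Definition orient (i j : I) (k : nat) : K :=
  if i == j then (if (k < (n i i)./2)%N then 1 else -1)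
  else if (enum_rank i < enum_rank j)%N then 1 else -1.

Lemma half_nE i : n i i = ((n i i)./2 + (n i i)./2)%N.
Proof. by rewrite addnn even_halfK ?n_even. Qed.

Lemma partner_lt (i j : I) (k : nat) : (k < n i j)%N -> (partner i j k < n j i)%N.
Proof.
rewrite /partner; case: eqP => [<-|_]; last by rewrite n_sym.
by have := half_nE i; rewrite /half_swap; case: (ltnP k (n i i)./2); lia.
Qed.

Lemma partnerK (i j : I) (k : nat) : (k < n i j)%N -> partner j i (partner i j k) = k.
Proof.
rewrite /partner [j == i]eq_sym; case: eqP => [<-|_] //.
by have := half_nE i; rewrite /half_swap; case: (ltnP k (n i i)./2) => h; case: ifP; lia.
Qed.

Lemma orient_partner (i j : I) (k : nat) : (k < n i j)%N ->
  orient j i (partner i j k) = - orient i j k.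
Proof.
rewrite /partner /orient [j == i]eq_sym; case: eqP => [<-|ij] kn.
  have := half_nE i; rewrite /half_swap; case: (ltnP k (n i i)./2) => h e; case: ifP => // h'.
  - by exfalso; lia.
  - by rewrite opprK.
  by exfalso; lia.
have : enum_rank i != enum_rank j :> nat by apply/eqP => /ord_inj/enum_rank_inj.
by case: ltngtP => //; rewrite ?opprK.
Qed.

Lemma orient_sqr i j k : orient i j k * orient i j k = 1.
Proof. by rewrite /orient; do ![case: ifP => _]; rewrite ?mulrNN mulr1. Qed.

Definition ar_star (a : arrow_letter) : arrow_letter :=
  Tagged (fun p : I * I => 'I_(n p.1 p.2))
    (Ordinal (partner_lt (ltn_ord (tagged a))) : (fun p : I * I => 'I_(n p.1 p.2)) ((tag a).2, (tag a).1)).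

Definition ar_eps (a : arrow_letter) : K := orient (ar_src a) (ar_tgt a) (ar_num a).

Lemma ar_num_lt a : (ar_num a < n (ar_src a) (ar_tgt a))%N.
Proof. exact: ltn_ord. Qed.

Lemma ar_star_num a : ar_num (ar_star a) = partner (ar_src a) (ar_tgt a) (ar_num a).
Proof. by []. Qed.

Lemma ar_star_src a : ar_src (ar_star a) = ar_tgt a. Proof. by []. Qed.
Lemma ar_star_tgt a : ar_tgt (ar_star a) = ar_src a. Proof. by []. Qed.

Lemma ar_starK : involutive ar_star.
Proof.
by move=> a; apply: arrow_letterP => //; rewrite !ar_star_num partnerK ?ar_num_lt.
Qed.

Lemma ar_eps_star a : ar_eps (ar_star a) = - ar_eps a.
Proof. by rewrite /ar_eps ar_star_num orient_partner ?ar_num_lt. Qed.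

Lemma ar_eps_sqr a : ar_eps a * ar_eps a = 1.
Proof. exact: orient_sqr. Qed.

End StandardLetters.

(** * Standard bases in degree one *)
Section StandardBases.
Variables (K : fieldType) (charK0 : [pchar K] =i pred0) (C : minCY2 K).
Variables (I : finType) (o : I -> obj C) (n : I -> I -> nat).
Hypothesis o_bij : bijective o.
Hypothesis n_dim : forall i j, n i j = \dim {:Ext (o i) (o j) 1}.
Local Notation sus := (suspended (@pairing K C)).

Lemma n_dim_sym i j : n i j = n j i.
Proof. by rewrite !n_dim ext1_dim_sym. Qed.
Lemma n_dim_even i : ~~ odd (n i i).
Proof. by rewrite n_dim ext1_dim_even. Qed.

(** For distinct objects the dual bases are chosen once per unordered pair; in
    the decreasing direction the second members are used, and antisymmetry
    produces the sign of [orient]. *)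
Lemma standard_bases : exists V : forall i j : obj C, nat -> Ext i j 1,
  (forall i j k l, (k < n i j)%N -> (l < n i j)%N ->
     sus (V (o i) (o j) k) (V (o j) (o i) l) = orient K n i j k * (l == partner n i j k)%:R) /\
  (forall i j (b : Ext (o i) (o j) 1),
     exists be : nat -> K, b = \sum_(k < n i j) be k *: V (o i) (o j) k).
Proof.
have [g og go] := o_bij; pose rk (x : obj C) : nat := enum_rank (g x).
have sy (x : obj C) : {u : nat -> Ext x x 1 |
    (forall k l, (k < \dim {:Ext x x 1})%N -> (l < \dim {:Ext x x 1})%N ->
      sus (u k) (u l) = (if (k < (\dim {:Ext x x 1})./2)%N then 1 else -1)
        * (l == half_swap (\dim {:Ext x x 1})./2 k)%:R) /\
    forall b, exists be : nat -> K, b = \sum_(k < \dim {:Ext x x 1}) be k *: u k}.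
  apply: cid; have [h [u [e gr sp]]] := ext1_symplectic charK0 x.
  by exists u; rewrite e addnn doubleK -addnn.
have du (x y : obj C) := cid (ext1_dual x y).
pose V (x y : obj C) k : Ext x y 1 :=
  match x =P y with
  | ReflectT e => ecast y (Ext x y 1) e (projT1 (sy x) k)
  | _ => if (rk x < rk y)%N then projT1 (du x y) k else projT1 (cid (projT2 (du y x))) k
  end.
have Vd x k : V x x k = projT1 (sy x) k.
  by rewrite /V; case: eqP => // e; rewrite (eq_irrelevance e erefl).
have Vl x y k : x <> y -> (rk x < rk y)%N -> V x y k = projT1 (du x y) k.
  by move=> xy lt; rewrite /V; case: eqP => // _; rewrite lt.
have Vr x y k : x <> y -> (rk y < rk x)%N -> V x y k = projT1 (cid (projT2 (du y x))) k.
  by move=> xy lt; rewrite /V; case: eqP => // _; rewrite ltnNge (ltnW lt).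
have oI := bij_inj o_bij.
have rko i : rk (o i) = enum_rank i by rewrite /rk og.
exists V; split.
  move=> i j k l; have [->|/eqP ij] := eqVneq i j.
    rewrite !Vd /orient /partner eqxx n_dim; case: (sy _) => u [gr sp] /=; exact: gr.
  have oij : o i <> o j by move/oI.
  have oji : o j <> o i by move/oI/esym.
  rewrite /orient /partner; case: eqP => // _.
  have : enum_rank i != enum_rank j :> nat by apply/eqP => /ord_inj/enum_rank_inj.
  rewrite neq_ltn => /orP[lt|lt] kn ln.
    rewrite lt Vl ?rko // Vr ?rko // mul1r; case: (du _ _) => u uP /=.
    case: (cid _) => w [gr _ _ _] /=; rewrite gr -?n_dim // eq_sym //.
  rewrite ltnNge (ltnW lt) /= Vr ?rko // Vl ?rko // mulN1r sus1_anti; case: (du _ _) => u uP /=.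
  by case: (cid _) => w [gr _ _ _] /=; rewrite gr -?n_dim // n_dim_sym.
move=> i j b; have [ij|/eqP ij] := eqVneq i j.
  case: j / ij b => b; rewrite n_dim.
  have [_ sp] := projT2 (sy (o i)); have [be bE] := sp b; exists be.
  by rewrite {1}bE; apply: eq_bigr => k _; rewrite Vd.
have oij : o i <> o j by move/oI.
have : enum_rank i != enum_rank j :> nat by apply/eqP => /ord_inj/enum_rank_inj.
rewrite neq_ltn => /orP[lt|lt].
  have [_ sp _ _] := projT2 (cid (projT2 (du (o i) (o j)))).
  have [be bE] := sp b; exists be; rewrite n_dim {1}bE.
  by apply: eq_bigr => k _; rewrite Vl ?rko.
have [_ _ sp _] := projT2 (cid (projT2 (du (o j) (o i)))).
have [be bE] := sp b; exists be; rewrite n_dim_sym n_dim {1}bE.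
by apply: eq_bigr => k _; rewrite Vr ?rko.
Qed.

Local Notation AL := (arrow_letter n).
Local Notation sA := (@ar_src I n).
Local Notation tA := (@ar_tgt I n).

Lemma standard_vectors : exists vv : AL -> forall i j : obj C, Ext i j 1,
  [/\ forall a i j, ~~ ((o (sA a) == i) && (o (tA a) == j)) -> vv a i j = 0,
      forall a b i j, o (sA a) = i -> o (tA a) = j -> o (sA b) = j -> o (tA b) = i ->
        sus (vv a i j) (vv b j i) = ar_eps K a * (b == ar_star n_dim_sym n_dim_even a)%:R &
      forall i j (b : Ext i j 1), exists be : AL -> K, b = \sum_a be a *: vv a i j].
Proof.
have [V [gr sp]] := standard_bases.
pose vv (a : AL) (i j : obj C) : Ext i j 1 :=
  if (o (sA a) == i) && (o (tA a) == j) then V i j (ar_num a) else 0.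
have oI := bij_inj o_bij.
exists vv; split.
- by move=> a i j /negbTE h; rewrite /vv h.
- move=> a b i j <- <- /oI sb /oI tb; rewrite /vv sb tb !eqxx /= gr ?ar_num_lt //; last first.
    by have := ar_num_lt b; rewrite sb tb n_dim_sym.
  congr (_ * (nat_of_bool _)%:R); apply/eqP/eqP => [e|->]; last exact: ar_star_num.
  by apply: arrow_letterP; rewrite ?ar_star_src ?ar_star_tgt ?ar_star_num.
have [g og go] := o_bij.
move=> i j; rewrite -[i]go -[j]go => b; have [be ->] := sp _ _ b.
elim/big_ind: _ => [|x y [bx ->] [b' ->]|k _].
- by exists (fun=> 0); rewrite big1 // => a _; rewrite scale0r.
- exists (fun a => bx a + b' a); rewrite -big_split; apply: eq_bigr => a _.
  by rewrite scalerDl.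
pose a : AL := Tagged (fun p : I * I => 'I_(n p.1 p.2)) (k : (fun p : I * I => 'I_(n p.1 p.2)) (g i, g j)).
exists (fun x => if x == a then be k else 0).
rewrite (bigD1 a) //= eqxx big1 ?addr0; first by rewrite /vv !eqxx.
by move=> x /negbTE ->; rewrite scale0r.
Qed.

End StandardBases.

(** * Quivers and equivalences *)
Lemma surj_dim (K : fieldType) (V V' : vectType K) (f : V -> V') (g : V' -> V) :
  (forall k a b, f (k *: a + b) = k *: f a + f b) -> cancel g f ->
  (\dim {:V'} <= \dim {:V})%N.
Proof.
move=> fl fg; have f0 : f 0 = 0.
  by apply: (addrI (1 *: f 0)); rewrite -fl scale1r !addr0 scale1r.
apply: (@spanning_dim _ _ _ (fun k => f (vbasis {:V})`_k)) => v.
exists (fun k => if insub k is Some i then coord (vbasis {:V}) i (g v) else 0).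
rewrite -[v in LHS]fg [g v in LHS](coord_vbasis (memvf (g v))).
have fS (r : seq 'I_(\dim {:V})) (c : 'I_(\dim {:V}) -> K) :
    f (\sum_(i <- r) c i *: (vbasis {:V})`_i) = \sum_(i <- r) c i *: f (vbasis {:V})`_i.
  by elim: r => [|i r IH]; rewrite ?big_nil // !big_cons fl IH.
by rewrite fS; apply: eq_bigr => i _; rewrite valK.
Qed.

Lemma linear_bij_dim (K : fieldType) (V V' : vectType K) (f : V -> V') :
  (forall k a b, f (k *: a + b) = k *: f a + f b) -> bijective f ->
  \dim {:V'} = \dim {:V}.
Proof.
move=> fl [g fg gf]; apply/eqP; rewrite eqn_leq (surj_dim fl gf) /=.
by apply: (surj_dim (f := g) _ fg) => k a b; apply: (can_inj fg); rewrite fl !gf.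
Qed.

Lemma card_letters (I : finType) (n : I -> I -> nat) (i j : I) :
  #|[set a : arrow_letter n | (ar_src a == i) && (ar_tgt a == j)]| = n i j.
Proof.
pose f (k : 'I_(n i j)) : arrow_letter n :=
  Tagged (fun p : I * I => 'I_(n p.1 p.2)) (k : (fun p : I * I => 'I_(n p.1 p.2)) (i, j)).
have f_inj : injective f by move=> k l /(congr1 (@ar_num I n)) /val_inj.
rewrite -[RHS]card_ord -cardsT -(card_imset _ f_inj); congr #|pred_of_set _|.
apply/setP => a; rewrite inE; apply/andP/imsetP => [[/eqP si /eqP tj]|[k _ ->]]; last by [].
have ln : (ar_num a < n i j)%N by have := ar_num_lt a; rewrite si tj.
by exists (Ordinal ln); [rewrite inE|apply: arrow_letterP].
Qed.

Lemma card_ext_arrows (K : fieldType) (C : minCY2 K) (i j : obj C) :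
  #|@arrows (ext_quiver C) i j| = \dim {:Ext i j 1}.
Proof. exact: (@card_letters (obj C) (fun i j => \dim {:Ext i j 1})). Qed.

(** Arrows from i to j are matched according to their positions in the
    enumerations of the two sets. *)
Lemma arrow_injection (Q Q' : quiver) (f : vertex Q -> vertex Q') : injective f ->
  (forall i j, #|arrows i j| <= #|arrows (f i) (f j)|)%N ->
  exists g : arrow Q -> arrow Q', [/\ injective g,
    forall a, source (g a) = f (source a) & forall a, target (g a) = f (target a)].
Proof.
move=> fI le; pose E (Q0 : quiver) (i j : vertex Q0) := enum (arrows i j).
have inE' (a : arrow Q) : a \in E Q (source a) (target a) by rewrite mem_enum inE !eqxx.
have lt (a : arrow Q) :
    (index a (E Q (source a) (target a)) < size (E Q' (f (source a)) (f (target a))))%N.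
  by rewrite -cardE; apply: leq_trans (le _ _); rewrite cardE index_mem inE'.
have df (a : arrow Q) : {x : arrow Q' | x \in E Q' (f (source a)) (f (target a))}.
  apply: cid; have := lt a; case: (E Q' _ _) => // x r _.
  by exists x; rewrite mem_head.
pose g a := nth (projT1 (df a)) (E Q' (f (source a)) (f (target a))) (index a (E Q (source a) (target a))).
have gP a : (source (g a) == f (source a)) && (target (g a) == f (target a)).
  by have := mem_nth (projT1 (df a)) (lt a); rewrite mem_enum inE.
exists g; split=> [a b e|a|a]; try by case/andP: (gP a) => /eqP ? /eqP ?.
have /andP[/eqP s1 /eqP t1] := gP a; have /andP[/eqP s2 /eqP t2] := gP b.
have sE : source a = source b by apply: fI; rewrite -s1 -s2 e.
have tE : target a = target b by apply: fI; rewrite -t1 -t2 e.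
move: e (lt a) (inE' a); rewrite /g; move: (projT1 (df a)) (projT1 (df b)) => xa xb.
rewrite sE tE => e la ia; move: e; rewrite (set_nth_default xb xa) //.
move/eqP; rewrite nth_uniq ?enum_uniq ?lt // => /eqP h.
by rewrite -(nth_index a ia) h nth_index ?inE'.
Qed.

(** An injection in each direction suffices, since the sets of arrows are
    finite. *)
Lemma quiver_iso_card (Q Q' : quiver) (f : vertex Q -> vertex Q') : bijective f ->
  (forall i j, #|arrows (f i) (f j)| = #|arrows i j|) -> quiver_iso Q Q'.
Proof.
move=> fb ct; have [f' ff' f'f] := fb.
have [g [gI gs gt]] : exists g : arrow Q -> arrow Q', [/\ injective g,
    forall a, source (g a) = f (source a) & forall a, target (g a) = f (target a)].
  by apply: arrow_injection (can_inj ff') _ => i j; rewrite ct.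
have [g' [g'I _ _]] : exists g : arrow Q' -> arrow Q, [/\ injective g,
    forall a, source (g a) = f' (source a) & forall a, target (g a) = f' (target a)].
  by apply: arrow_injection (can_inj f'f) _ => i j; rewrite -ct !f'f.
by exists f, g; split=> //; apply: inj_card_bij gI _; apply: leq_card g'I.
Qed.

Lemma quiver_iso_arrows (Q Q' : quiver) : quiver_iso Q Q' ->
  exists f : vertex Q -> vertex Q', bijective f /\
    forall i j, #|arrows (f i) (f j)| = #|arrows i j|.
Proof.
move=> [f [g [fb [g' gg' g'g] gs gt]]]; exists f; split=> // i j.
rewrite -(card_imset _ (can_inj gg')); congr #|pred_of_set _|.
apply/setP => a; rewrite inE; apply/andP/imsetP => [[/eqP sa /eqP ta]|[b]].
  exists (g' a); last by rewrite g'g.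
  by rewrite inE -!(inj_eq (bij_inj fb)) -gs -gt g'g sa ta !eqxx.
by rewrite inE => /andP[/eqP <- /eqP <-] ->; rewrite gs gt.
Qed.

Section Classification.
Variables (K : fieldType) (charK0 : [pchar K] =i pred0).

(** The linear part of an equivalence is a linear bijection on Ext^1. *)
Lemma equivalent_dim (C C' : minCY2 K) : CY_equivalent C C' ->
  exists s : obj C -> obj C', bijective s /\
    forall i j, \dim {:Ext (s i) (s j) 1} = \dim {:Ext i j 1}.
Proof.
move=> [s [sb [F Fiso]]]; exists s; split=> // i j.
apply: (linear_bij_dim _ (@cai_iso _ _ _ _ _ Fiso i j 1)) => k a b.
exact: (@cai_linear _ _ _ _ _ Fiso i j 1 i j 1 (nilc i) (nilc j) k a b).
Qed.

(** Both categories receive frames over the same letters. *)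
Lemma equivalent_of_dim (C C' : minCY2 K) (s : obj C -> obj C') :
  simple_collection C -> simple_collection C' -> bijective s ->
  (forall i j, \dim {:Ext (s i) (s j) 1} = \dim {:Ext i j 1}) -> CY_equivalent C C'.
Proof.
move=> sC sC' sb dE; pose n (i j : obj C) := \dim {:Ext i j 1}.
have idb : bijective (fun x : obj C => x) by exists id.
have nE i j : n i j = \dim {:Ext i j 1} by [].
have nE' i j : n i j = \dim {:Ext (s i) (s j) 1} by rewrite dE.
have [vv [vv_out vv_gram vv_span]] := standard_vectors charK0 idb nE.
have [vv' [vv_out' vv_gram' vv_span']] := standard_vectors charK0 sb nE'.
set star := ar_star (n_dim_sym nE) (n_dim_even charK0 nE) in vv_gram.
have star_eq a : ar_star (n_dim_sym nE') (n_dim_even charK0 nE') a = star a.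
  exact: arrow_letterP.
have gram' a b i j : s (ar_src a) = i -> s (ar_tgt a) = j ->
    s (ar_src b) = j -> s (ar_tgt b) = i ->
    suspended (@pairing K C') (vv' a i j) (vv' b j i) = ar_eps K a * (b == star a)%:R.
  by move=> *; rewrite vv_gram' // star_eq.
have starK : involutive star := @ar_starK _ _ _ _.
have stars a : ar_src (star a) = ar_tgt a by [].
have start a : ar_tgt (star a) = ar_src a by [].
have eps_star a : ar_eps K (star a) = - ar_eps K a := ar_eps_star K _ _ a.
have eps_sqr (a : arrow_letter n) : ar_eps K a * ar_eps K a = 1 := ar_eps_sqr K a.
exact: (framed_equivalence starK stars start eps_star eps_sqr charK0 (o := fun x => x) (bij_inj idb) sb
  (simple_frame_pairing starK stars start eps_sqr sC idb vv_out vv_gram vv_span)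
  (simple_frame_pairing starK stars start eps_sqr sC' sb vv_out' gram' vv_span')
  (simple_frame_z starK stars start eps_sqr sC idb vv_out vv_gram vv_span)
  (simple_frame_z starK stars start eps_sqr sC' sb vv_out' gram' vv_span')).
Qed.

End Classification.

(** * The category of a quiver *)
Section Standard.
Variables (K : fieldType) (I A : finType).
Variables (sA tA : A -> I) (star : A -> A) (eps : A -> K).
Hypothesis starK : involutive star.
Hypothesis sA_star : forall a, sA (star a) = tA a.
Hypothesis tA_star : forall a, tA (star a) = sA a.
Hypothesis eps_star : forall a, eps (star a) = - eps a.
Hypothesis eps_sqr : forall a, eps a * eps a = 1.

Local Notation X := (letters I A).
Local Notation P := (series K X).
Local Notation zl := (@zl I A).
Local Notation src := (@src I A sA).
Local Notation tgt := (@tgt I A tA).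
Local Notation st := (@st I A star).
Local Notation sd := (@sd I A).
Local Notation ep := (@ep K I A eps).
Local Notation sg := (@sg K I A).
Implicit Types (f g h : P) (u p q r : seq X) (x y : X).

Local Notation c2 := (@c2 K I A sA tA star eps).
Local Notation fitx := (fits (fun x => src x) (fun x => tgt x) (@dl I A)).
Let o (i : I) : I := i.
Let o_inj : injective o. Proof. by []. Qed.

(** The coordinate space on the letters that fit. *)
Definition standard_ext (i j : I) (d : int) : vectType K :=
  {ffun {x : X | fitx x i j d} -> K^o}.

Definition standard_cf (i j : I) (d : int) (a : standard_ext i j d) (x : X) : K :=
  if insub x is Some u then (a : {ffun {x : X | fitx x i j d} -> K^o}) u else 0.

Definition standard_bas (x : X) (i j : I) (d : int) : standard_ext i j d :=
  [ffun u : {x : X | fitx x i j d} => (val u == x)%:R : K^o].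

Lemma standard_cf_lin i j d k (a b : standard_ext i j d) x : standard_cf (k *: a + b) x = k * standard_cf a x + standard_cf b x.
Proof. by rewrite /standard_cf; case: insubP => [u _ _|_]; rewrite ?ffunE ?mulr0 ?addr0. Qed.

Lemma standard_cf_out i j d (a : standard_ext i j d) x : ~~ fitx x i j d -> standard_cf a x = 0.
Proof. by move=> h; rewrite /standard_cf insubN. Qed.

Lemma standard_cf_bas i j d x y : standard_cf (standard_bas x i j d) y = ((x == y) && fitx x i j d)%:R.
Proof.
rewrite /standard_cf; case: insubP => [u fy uE|fy]; last first.
  by case: eqP => [->|//]; rewrite (negbTE fy).
rewrite ffunE uE eq_sym; case: eqP => [->|//]; by rewrite fy.
Qed.

Lemma standard_cf_sum i j d (a : standard_ext i j d) : a = \sum_x standard_cf a x *: standard_bas x i j d.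
Proof.
apply/ffunP => u; rewrite sum_ffunE (bigD1 (val u)) //= big1 ?addr0.
  by rewrite !ffunE eqxx /standard_cf valK; apply/esym/mulr1.
by move=> x xu; rewrite !ffunE eq_sym (negbTE xu); apply: mulr0.
Qed.

Definition standard_frame : frame standard_ext (fun x => o (src x)) (fun x => o (tgt x)) (@dl I A) :=
  Frame standard_cf_lin standard_cf_out standard_cf_bas standard_cf_sum.

Local Notation cf := (fr_cf standard_frame).
Local Notation bas := (fr_bas standard_frame).
Local Notation sev := (ev standard_frame).

Lemma c2_nil x : c2 x [::] = 0.
Proof. exact: (@ord_c2 K I A sA tA star eps x [::]). Qed.

Lemma c2_one x y : c2 x [:: y] = 0.
Proof. exact: (@ord_c2 K I A sA tA star eps x [:: y]). Qed.

Let c2s x := sup_c2 eps sA_star tA_star x.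

(** The operations dual to the derivation c2; only the composition of two
    morphisms is nonzero, since c2 is quadratic. *)
Definition standard_op : operation standard_ext :=
  fun i j d c => \sum_x sev c (c2 x) *: bas x i j d.

Lemma standard_op_cf i j d (c : chain standard_ext i j) x : cf (standard_op d c) x = sev c (c2 x) * (fitx x i j d)%:R.
Proof. exact: cf_comb. Qed.

Lemma standard_op_cf_deg i j d (c : chain standard_ext i j) x :
  cf (standard_op d c) x = (dl x == d)%:R * sev c (c2 x).
Proof.
rewrite standard_op_cf /fits; have [->|nz] := eqVneq (sev c (c2 x)) 0; first by rewrite mul0r mulr0.
have [ei ej _] := ev_sup o_inj (@c2s x) (c2_nil x) nz.
have -> : (src x == i) = true by apply/eqP; rewrite ei.
by have -> : (tgt x == j) = true; [apply/eqP; rewrite ej|rewrite mulrC].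
Qed.

Lemma standard_op_linear i j d : multilinear (@standard_op i j d).
Proof.
move=> k l e p r k0 a b; apply: (cf_inj (fr := standard_frame)) => x.
by rewrite cf_lin !standard_op_cf ev_mlin mulrDl mulrA.
Qed.

Lemma standard_op_degree i j d (c : chain standard_ext i j) : d != sdeg c + 2 -> standard_op d c = 0.
Proof.
move=> dc; apply: (cf_inj (fr := standard_frame)) => x; rewrite cf0 standard_op_cf_deg.
have [->|nz] := eqVneq (sev c (c2 x)) 0; first by rewrite mulr0.
rewrite (D_deg o_inj c2s c2_nil nz) (_ : _ == _ = false) ?mul0r //.
by apply/negbTE; rewrite eq_sym.
Qed.

Lemma standard_op_uncurved i d : standard_op d (nilc i) = 0.
Proof. by apply: (cf_inj (fr := standard_frame)) => x; rewrite cf0 standard_op_cf /= c2_nil mul0r. Qed.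

Lemma standard_op_minimal i j d e (a : standard_ext i j d) : standard_op e (onec a) = 0.
Proof.
apply: (cf_inj (fr := standard_frame)) => x; rewrite cf0 standard_op_cf ev_onec big1 ?mul0r // => y _.
by rewrite c2_one mulr0.
Qed.

Lemma standard_op_ainf i j d (c : chain standard_ext i j) : insertion standard_op (@standard_op i j d) c = 0.
Proof.
apply: (cf_inj (fr := standard_frame)) => x; rewrite cf0.
transitivity ((dl x == d)%:R * sev c (der sg c2 (c2 x))); last first.
  by rewrite c2_sqr // ev0 mulr0.
rewrite (ev_insertion o_inj c2s c2_nil standard_op_cf_deg) /insertion cf_sumE mulr_sumr.
apply: eq_bigr => s _; rewrite cf_sumE mulr_sumr; apply: eq_bigr => t _.
by rewrite cfZ standard_op_cf_deg mulrCA.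
Qed.

Definition standard_idm (i : I) : standard_ext i i 0 := bas (zl i) i i 0.

Lemma standard_idm_cf i x : cf (standard_idm i) x = (zl i == x)%:R.
Proof. by rewrite /standard_idm cf_bas; case: (zl i =P x) => // _; rewrite /fits /= !eqxx. Qed.

Lemma standard_idm_l i j d (a : standard_ext i j d) : standard_op d (consc (standard_idm i) (onec a)) = a.
Proof.
apply: (cf_inj (fr := standard_frame)) => x; rewrite standard_op_cf.
have [fx|fx] := boolP (fitx x i j d); last by rewrite mulr0 cf_out.
rewrite mulr1 /= (bigD1 (zl i)) //= [X in _ + X]big1 ?addr0 => [|y yx]; last first.
  by have := standard_idm_cf i y; rewrite eq_sym (negbTE yx) /= => ->; rewrite mul0r.
have := standard_idm_cf i (zl i); rewrite /= eqxx => ->; rewrite mul1r.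
case/and3P: (fx) => /eqP sx /eqP tx _.
rewrite (bigD1 x) //= big1 ?addr0 => [|q qx].
  by rewrite -[lquo _ _ _]/(c2 x [:: zl i; x]) c2_zl // eqxx mulr1.
rewrite -[lquo _ _ _]/(c2 x [:: zl i; q]).
have [fq|fq] := boolP (fitx q i j d); last by rewrite standard_cf_out ?mul0r.
case/and3P: fq => /eqP sq /eqP tq _.
by rewrite c2_zl ?sx ?tx // (negbTE qx) mulr0.
Qed.

Lemma sg_dl x : sg x = - (-1) ^ dl x.
Proof.
rewrite -[sg x]/((-1) ^ sd x) -dl_sd expfzDr ?oppr_eq0 ?oner_neq0 //.
by rewrite exprN1 invrN invr1 mulrN1.
Qed.

Lemma standard_idm_r i j d (a : standard_ext i j d) :
  standard_op d (consc a (onec (standard_idm j))) = (-1) ^ d *: a.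
Proof.
apply: (cf_inj (fr := standard_frame)) => x; rewrite standard_op_cf cfZ.
have [fx|fx] := boolP (fitx x i j d); last by rewrite mulr0 cf_out ?mulr0.
have inner (q : X) : \sum_y standard_cf (standard_idm j) y * lquo y (lquo q (c2 x)) [::] = c2 x [:: q; zl j].
  rewrite (bigD1 (zl j)) //= big1 ?addr0 => [|y yx]; last first.
    by have := standard_idm_cf j y; rewrite eq_sym (negbTE yx) /= => ->; rewrite mul0r.
  by have := standard_idm_cf j (zl j); rewrite /= eqxx => ->; rewrite mul1r.
rewrite mulr1 /=; under eq_bigr => q _ do rewrite inner.
case/and3P: (fx) => /eqP sx /eqP tx /eqP dx.
rewrite (bigD1 x) //= big1 ?addr0 => [|q qx].
  by rewrite c2_zr // eqxx mulr1 sg_dl opprK dx mulrC.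
have [fq|fq] := boolP (fitx q i j d); last by rewrite standard_cf_out ?mul0r.
case/and3P: fq => /eqP sq /eqP tq _.
by rewrite c2_zr ?sx ?tx // (negbTE qx) !mulr0.
Qed.

Definition standard_pairing : pairing_family standard_ext := fun i j d e a b =>
  (-1) ^ d * \sum_x ep x * (cf a x * cf b (st x)).

Lemma standard_pairing_sus i j d e (a : standard_ext i j d) (b : standard_ext j i e) :
  suspended standard_pairing a b = \sum_x ep x * (cf a x * cf b (st x)).
Proof. by rewrite /suspended /standard_pairing mulrA sgz_sqr mul1r. Qed.

Lemma standard_pairing_linear i j d e (k : K) (a a' : standard_ext i j d) (b : standard_ext j i e) :
  standard_pairing (k *: a + a') b = k * standard_pairing a b + standard_pairing a' b.
Proof.
rewrite /standard_pairing [k * _]mulrCA -mulrDr; congr (_ * _); rewrite mulr_sumr -big_split.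
by apply: eq_bigr => x _; rewrite cf_lin /=; ring.
Qed.

Lemma standard_pairing_degree i j d e (a : standard_ext i j d) (b : standard_ext j i e) :
  d + e != 2 -> standard_pairing a b = 0.
Proof.
move=> de; rewrite /standard_pairing big1 ?mulr0 // => x _.
have [fx|fx] := boolP (fitx x i j d); last by rewrite [cf a x]cf_out // mul0r mulr0.
have [fy|fy] := boolP (fitx (st x) j i e); last by rewrite [cf b _]cf_out // !mulr0.
case/negP: de; case/and3P: fx => _ _ /eqP <-; case/and3P: fy => _ _ /eqP <-.
by case: (x) => [[k|k]|c].
Qed.

(** Symmetry in shifted degrees gives the sign of exponent e; when d + e = 2,
    this has the parity of d e. *)
Lemma standard_pairing_sym i j d e (a : standard_ext i j d) (b : standard_ext j i e) :
  standard_pairing a b = (-1) ^ (d * e) * standard_pairing b a.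
Proof.
have [de|de] := eqVneq (d + e) 2; last by rewrite !standard_pairing_degree ?mulr0 // addrC.
have s2 : standard_pairing a b = (-1) ^ e * standard_pairing b a.
  have := sus_sym starK eps_star standard_pairing_sus a b; rewrite /suspended => h.
  have -> : standard_pairing a b = (-1) ^ d * ((-1) ^ d * standard_pairing a b) by rewrite mulrA sgz_sqr mul1r.
  rewrite h !mulrA; congr (_ * _).
  rewrite expfzDr ?oppr_eq0 ?oner_neq0 // exprN1 invrN invr1 mulrN1 opprK.
  by rewrite sgz_sqr mul1r.
rewrite s2; congr (_ * _); have -> : d * e = e + - ((e - 1) * e).
  by rewrite -[d](addrK e) de; ring.
by rewrite expfzDr ?oppr_eq0 ?oner_neq0 // -invr_expz sgz_even invr1 mulr1.
Qed.

Lemma standard_pairing_nondegenerate i j d (a : standard_ext i j d) :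
  (forall b : standard_ext j i (2 - d), standard_pairing a b = 0) -> a = 0.
Proof.
move=> h; apply: (cf_inj (fr := standard_frame)) => x; rewrite cf0.
have [fx|fx] := boolP (fitx x i j d); last by rewrite cf_out.
have := standard_pairing_sus a (bas (st x) j i (2 - d)); rewrite /suspended h mulr0.
rewrite (bigD1 x) //= big1 ?addr0 => [|y yx]; last first.
  rewrite standard_cf_bas (inj_eq (inv_inj (stK starK))) eq_sym (negbTE yx) /=; ring.
rewrite standard_cf_bas eqxx /= (_ : fitx _ _ _ _) /= ?mulr1; last first.
  case/and3P: fx => /eqP sx /eqP tx /eqP dx.
  rewrite /fits (src_st sA_star) (tgt_st tA_star) sx tx -dx !eqxx /=.
  by case: (x) => [[k|k]|c].
move/esym/(congr1 ( *%R (ep x))); rewrite mulrA (ep_sqr eps_sqr) mul1r mulr0 //.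
Qed.

Lemma standard_pairing_cyclic i j k d e (a : standard_ext i j d) (c : chain standard_ext j k) (b : standard_ext k i e) :
  let ac := consc a c in let cb := catc c (onec b) in
  suspended standard_pairing (standard_op (sdeg ac + 2) ac) b
  = (-1) ^ ((d - 1) * sdeg cb) * suspended standard_pairing (standard_op (sdeg cb + 2) cb) a.
Proof.
move=> ac cb; have := ev_der_omega starK eps_star o_inj standard_pairing_sus c2s c2_nil standard_op_cf_deg a c b.
rewrite c2_omega // ev0 => /esym/eqP; rewrite subr_eq0 -/ac -/cb => /eqP ->.
have [e0|ne] := eqVneq (sdeg cb + 2 + d) 2; last first.
  by rewrite /suspended [standard_pairing _ a]standard_pairing_degree ?mulr0.
have -> : sdeg cb = - d by rewrite -[sdeg cb](addrK (2 + d)) addrA e0; ring.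
by rewrite mulrN -invr_expz sgz_even invr1 mul1r.
Qed.

Lemma standard_ext_finite : exists N : nat, forall i j (d : int),
  (N < absz d)%N -> forall x : standard_ext i j d, x = 0.
Proof.
exists 2%N => i j d d2 a; apply: (cf_inj (fr := standard_frame)) => x; rewrite cf0 cf_out //.
apply/negP => /and3P[_ _ /eqP dx]; move: d2; rewrite -dx; by case: (x) => [[k|k]|c].
Qed.

(** The relations are [c2_sqr], and cyclicity is [c2_omega]. *)
Definition standard_category : minCY2 K :=
  MinCY2 standard_ext_finite standard_op_linear standard_op_degree standard_op_uncurved standard_op_minimal standard_op_ainf
    standard_idm_l standard_idm_r standard_pairing_linear standard_pairing_degree standard_pairing_sym standard_pairing_nondegenerate standard_pairing_cyclic.

Lemma standard_simple : simple_collection standard_category.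
Proof.
split.
- move=> i; rewrite basisEfree; apply/and3P; split=> //.
  + rewrite free_cons /= span_nil memv0 nil_free andbT; apply/eqP => /(congr1 (fun a => standard_cf a (zl i))).
    rewrite -[LHS]/(cf (standard_idm i) (zl i)) standard_idm_cf eqxx -[RHS]/(cf (0 : standard_ext i i 0) (zl i)) cf0.
    by move/eqP; rewrite oner_eq0.
  + by apply: subvf.
  apply: leq_trans (dimvS _) (dim_span [:: (standard_idm i : @Ext _ standard_category i i 0)]).
  apply/subvP => a _; rewrite span_seq1; apply/vlineP; exists (standard_cf a (zl i)).
  rewrite [LHS](standard_cf_sum a) (bigD1 (zl i)) //= big1 ?addr0 // => x xz.
  rewrite standard_cf_out ?scale0r //; apply: contra xz => /and3P[/eqP sx /eqP tx /eqP].
  by case: x sx tx => [[k|k]|c] //= ->.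
- move=> i j ij a; apply: (cf_inj (fr := standard_frame)) => x; rewrite cf0 cf_out //.
  apply: contra ij => /and3P[/eqP sx /eqP tx /eqP].
  by case: x sx tx => [[k|k]|c] //= <- <-.
move=> i j d d0 a; apply: (cf_inj (fr := standard_frame)) => x; rewrite cf0 cf_out //.
by apply/negP => /and3P[_ _ /eqP dx]; move: d0; rewrite -dx; case: (x) => [[k|k]|c].
Qed.

Lemma standard_dim (i j : I) :
  \dim {:@Ext _ standard_category i j 1} = #|[set a | (sA a == i) && (tA a == j)]|.
Proof.
rewrite dimvf.
transitivity #|{: {x : X | fitx x i j 1}}|; first exact: muln1.
rewrite card_sig -[RHS](card_imset _ (@inr_inj (I + I) A)); apply: eq_card => x.
apply/idP/imsetP => [|[a]].
  case: x => [[k|k]|a] /and3P[/eqP /= sx /eqP tx /eqP] // _.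
  by exists a => //; rewrite inE sx tx !eqxx.
by rewrite inE => /andP[/eqP sa /eqP ta] ->; rewrite unfold_in /fits /= sa ta !eqxx.
Qed.

End Standard.

Theorem mainTheorem1 (K : fieldType) (charK0 : [pchar K] =i pred0) :
  bijection_on_classes
    (@simple_collection K) (@CY_equivalent K)
    (fun Q : quiver => symmetric_quiver Q /\ even_loops Q) quiver_iso
    (@ext_quiver K).
Proof.
split.
- move=> C _; split=> [i j|i]; first by rewrite !card_ext_arrows ext1_dim_sym.
  by rewrite card_ext_arrows ext1_dim_even.
- move=> C C' sC sC'; split.
    move=> /equivalent_dim [s [sb dE]]; apply: (@quiver_iso_card (ext_quiver C) (ext_quiver C') s sb).
    by move=> i j; rewrite !card_ext_arrows dE.
  move=> /quiver_iso_arrows [f [fb ct]].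
  apply: (equivalent_of_dim charK0 (s := f : obj C -> obj C')) => // i j.
  by rewrite -!card_ext_arrows; apply: ct.
move=> Q [Qs Qe].
pose n (i j : vertex Q) := #|arrows i j|.
have ns i j : n i j = n j i := Qs i j.
have ne i : ~~ odd (n i i) := Qe i.
have starK := ar_starK ns ne.
have eps_star := @ar_eps_star K _ _ ns ne.
have eps_sqr := @ar_eps_sqr K _ n.
pose C := (@standard_category K _ _ (@ar_src _ n) (@ar_tgt _ n) _ _ starK (fun=> erefl) (fun=> erefl) eps_star eps_sqr).
exists C; first exact: standard_simple.
apply: (@quiver_iso_card (ext_quiver C) Q (fun i : vertex Q => i)); first by exists id.
move=> i j; rewrite card_ext_arrows standard_dim; exact: esym (card_letters n i j).
Qed.
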